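(* Let $C$ be a conilpotent coalgebra over a field $k$ and let $n\ge1$ be the minimal integer for which the vector space $\operatorname{Ext}_C^n(k,k)$ is infinite-dimensional. Then the map $\operatorname{Ext}^n_C(k,k)\to\operatorname{Ext}^n_{C^*}(k,k)$ induced by the comodule inclusion functor $\Upsilon$ from left $C$-comodules to left $C^*$-modules is injective, but not surjective. In fact, if $\lambda$ is the dimension cardinality of the $k$-vector space $\operatorname{Ext}^n_C(k,k)$ and $\kappa$ is the cardinality of the field $k$, then the dimension cardinality of $\operatorname{Ext}^n_{C^*}(k,k)$ is equal to $\kappa^{\kappa^\lambda}$.
   Context: Coalgebras over $k$ are coassociative and counital, with comultiplication $\mu\colon C\to C\otimes_kC$ and counit $\epsilon\colon C\to k$. Left $C$-comodules are $k$-vector spaces with a coassociative counital coaction $\nu\colon M\to C\otimes_kM$. The dual space $C^*=\operatorname{Hom}_k(C,k)$ is an associative unital algebra with $(fg)(c)=f(c_{(2)})g(c_{(1)})$, where $\mu(c)=c_{(1)}\otimes c_{(2)}$, and unit $\epsilon$; with this convention left $C$-comodules become left $C^*$-modules via $C^*\otimes_kM\to C^*\otimes_kC\otimes_kM\to M$. This defines the exact fully faithful comodule inclusion functor $\Upsilon$. $\operatorname{Ext}_C^*$ denotes the Yoneda Ext in the abelian category of left $C$-comodules and $\operatorname{Ext}_{C^*}^*$ the Ext over left $C^*$-modules. A coaugmentation of $C$ is a coalgebra homomorphism $\gamma\colon k\to C$. A noncounital coalgebra $D$ is conilpotent if for each $d\in D$ some iterated comultiplication $\mu^{(m)}(d)\in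 D^{\otimes m+1}$, $m\ge1$, vanishes. A coaugmented coalgebra $(C,\gamma)$ is conilpotent if the noncounital coalgebra $C/\gamma(k)$ is conilpotent; then $\gamma$ is the unique coaugmentation. The one-dimensional space $k$ is viewed as a left $C$-comodule via $\gamma$, hence as a left $C^*$-module (via the augmentation $\gamma^*\colon C^*\to k$). *)

(* Defs.v *)
From HB Require Import structures.
From mathcomp Require Import all_boot all_algebra.
From mathcomp Require Import boolp.
From Stdlib Require Import Relation_Operators.

Set Implicit Arguments.
Unset Strict Implicit.
Unset Printing Implicit Defensive.
Import GRing.Theory.
Local Open Scope ring_scope.
Local Open Scope quotient_scope.

Section LinearLemmas.
Variables (k : pzRingType) (U V : lmodType k) (f : U -> V).
Hypothesis hf : linear f.

Lemma lin0 : f 0 = 0.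
Proof. by have := hf (-1) 0 0; rewrite scaler0 addr0 scaleN1r addNr. Qed.
Lemma linD x y : f (x + y) = f x + f y.
Proof. by have := hf 1 x y; rewrite !scale1r. Qed.
Lemma linZ a x : f (a *: x) = a *: f x.
Proof. by have := hf a x 0; rewrite !addr0 lin0 addr0. Qed.
Lemma linN x : f (- x) = - f x.
Proof. by rewrite -scaleN1r linZ scaleN1r. Qed.
Lemma linB x y : f (x - y) = f x - f y.
Proof. by rewrite linD linN. Qed.
Lemma linS I (r : seq I) (F : I -> U) :
  f (\sum_(i <- r) F i) = \sum_(i <- r) f (F i).
Proof.
elim: r => [|i r IH]; first by rewrite !big_nil lin0.
by rewrite !big_cons linD IH.
Qed.
End LinearLemmas.

Section LinearClosure.
Variables (k : fieldType) (U V W : lmodType k).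
Lemma lin_id : linear (fun x : U => x). Proof. by []. Qed.
Lemma lin_comp (g : V -> W) (f : U -> V) :
  linear g -> linear f -> linear (fun x => g (f x)).
Proof. by move=> hg hf a x y; rewrite hf hg. Qed.
Lemma lin_cst0 : linear (fun _ : U => 0 : V).
Proof. by move=> a x y; rewrite scaler0 addr0. Qed.
Lemma lin_comb (a : k) (f g : U -> V) :
  linear f -> linear g -> linear (fun x => a *: f x + g x).
Proof.
move=> hf hg b x y; rewrite hf hg !scalerDr !scalerA (mulrC b a).
by rewrite addrACA.
Qed.
End LinearClosure.

Section Tensor.
Variables (k : fieldType) (V W : lmodType k).

(* A list [:: (v1, w1); ..; (vr, wr)] stands for the sum of the vi (x) wi. *)
Inductive tens_rel : seq (V * W) -> seq (V * W) -> Prop :=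
| TensRefl s : tens_rel s s
| TensSym s t : tens_rel s t -> tens_rel t s
| TensTrans s t u : tens_rel s t -> tens_rel t u -> tens_rel s u
| TensCat s s' t t' :
    tens_rel s s' -> tens_rel t t' -> tens_rel (s ++ t) (s' ++ t')
| TensComm s t : tens_rel (s ++ t) (t ++ s)
| TensZero w : tens_rel [:: (0, w)] [::]
| TensAddl v v' w : tens_rel [:: (v + v', w)] [:: (v, w); (v', w)]
| TensAddr v w w' : tens_rel [:: (v, w + w')] [:: (v, w); (v, w')]
| TensScale a v w : tens_rel [:: (a *: v, w)] [:: (v, a *: w)].

Definition tens_relb : rel (seq (V * W)) := fun s t => `[< tens_rel s t >].

Lemma tens_relb_refl : reflexive tens_relb.
Proof. by move=> s; apply/asboolP; apply: TensRefl. Qed.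
Lemma tens_relb_sym : symmetric tens_relb.
Proof. by move=> s t; apply/asboolP/asboolP; apply: TensSym. Qed.
Lemma tens_relb_trans : transitive tens_relb.
Proof.
by move=> t s u /asboolP h1 /asboolP h2; apply/asboolP; apply: TensTrans h1 h2.
Qed.
Canonical tens_equiv : equiv_rel (seq (V * W)) :=
  EquivRel tens_relb tens_relb_refl tens_relb_sym tens_relb_trans.

Definition tensor : Type := {eq_quot tens_equiv}.
HB.instance Definition _ := Choice.copy tensor {eq_quot tens_equiv}.

Definition tcls (s : seq (V * W)) : tensor := \pi_({eq_quot tens_equiv}) s.
Definition trep (x : tensor) : seq (V * W) := repr (x : {eq_quot tens_equiv}).

Lemma trepK x : tcls (trep x) = x.
Proof. by rewrite /tcls /trep reprK. Qed.

Lemma tclsP s t : tcls s = tcls t <-> tens_rel s t.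
Proof.
split=> [/eqP|h]; first by rewrite /tcls eqmodE => /asboolP.
by apply/eqP; rewrite /tcls eqmodE; apply/asboolP.
Qed.

Lemma trep_rel s : tens_rel (trep (tcls s)) s.
Proof. by apply/tclsP; rewrite trepK. Qed.

Definition tens (v : V) (w : W) : tensor := tcls [:: (v, w)].

Definition tzero := tcls [::].
Definition tadd x y := tcls (trep x ++ trep y).
Definition tscale (a : k) x := tcls [seq (a *: p.1, p.2) | p <- trep x].

Lemma taddE s t : tadd (tcls s) (tcls t) = tcls (s ++ t).
Proof. by apply/tclsP; apply: TensCat; apply: trep_rel. Qed.

Lemma tens_rel_scale a s t : tens_rel s t ->
  tens_rel [seq (a *: p.1, p.2) | p <- s] [seq (a *: p.1, p.2) | p <- t].
Proof.
elim=> {s t} [s|s t _ h|s t u _ h1 _ h2|s s' t t' _ h1 _ h2|s t|w|v v' w|v w w'|b v w] /=.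
- exact: TensRefl.
- exact: TensSym.
- exact: TensTrans h1 h2.
- by rewrite !map_cat; apply: TensCat.
- by rewrite !map_cat; apply: TensComm.
- by rewrite scaler0; apply: TensZero.
- by rewrite scalerDr; apply: TensAddl.
- exact: TensAddr.
- by rewrite scalerA mulrC -scalerA; apply: TensScale.
Qed.

Lemma tscaleE a s : tscale a (tcls s) = tcls [seq (a *: p.1, p.2) | p <- s].
Proof. by apply/tclsP; apply: tens_rel_scale; apply: trep_rel. Qed.

Lemma tens_ind1 (P : tensor -> Prop) : (forall s, P (tcls s)) -> forall x, P x.
Proof. by move=> h x; rewrite -(trepK x). Qed.

Lemma taddA : associative tadd.
Proof.
elim/tens_ind1=> s; elim/tens_ind1=> t; elim/tens_ind1=> u.
by rewrite !taddE catA.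
Qed.
Lemma taddC : commutative tadd.
Proof.
elim/tens_ind1=> s; elim/tens_ind1=> t; rewrite !taddE.
by apply/tclsP; apply: TensComm.
Qed.
Lemma tadd0 : left_id tzero tadd.
Proof. by elim/tens_ind1=> s; rewrite taddE. Qed.
Lemma tens_rel_swap x y s t :
  tens_rel ([:: x; y] ++ (s ++ t)) ((x :: s) ++ (y :: t)).
Proof.
rewrite -[[:: x; y] ++ _]/([:: x] ++ ([:: y] ++ (s ++ t))).
rewrite -[(x :: s) ++ _]/([:: x] ++ (s ++ ([:: y] ++ t))).
apply: TensCat; first exact: TensRefl.
by rewrite !catA; apply: TensCat; [exact: TensComm | exact: TensRefl].
Qed.
Lemma tscale0 x : tscale 0 x = tzero.
Proof.
elim/tens_ind1: x => s; rewrite tscaleE; apply/tclsP.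
elim: s => [|[v w] s IH] /=; first exact: TensRefl.
rewrite scale0r -cat1s -[nil]/([::] ++ [::]); apply: TensCat IH.
exact: TensZero.
Qed.
Lemma tscaleDl x a b : tscale (a + b) x = tadd (tscale a x) (tscale b x).
Proof.
elim/tens_ind1: x => s; rewrite !tscaleE taddE; apply/tclsP.
elim: s => [|[v w] s IH] /=; first exact: TensRefl.
rewrite scalerDl -cat1s.
apply: TensTrans (TensCat (TensAddl _ _ _) IH) _.
exact: tens_rel_swap.
Qed.
Lemma tscale1 : left_id 1 tscale.
Proof.
elim/tens_ind1=> s; rewrite tscaleE; congr tcls.
by elim: s => [|[v w] s IH] //=; rewrite IH scale1r.
Qed.
Lemma tscaleDr : right_distributive tscale tadd.
Proof.
move=> a; elim/tens_ind1=> s; elim/tens_ind1=> t.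
by rewrite taddE !tscaleE taddE map_cat.
Qed.
Lemma tscaleA a b x : tscale a (tscale b x) = tscale (a * b) x.
Proof.
elim/tens_ind1: x => s; rewrite !tscaleE -map_comp; congr tcls.
by apply: eq_map => p /=; rewrite scalerA.
Qed.
Lemma taddN : left_inverse tzero (tscale (-1)) tadd.
Proof.
move=> x; rewrite -[X in tadd _ X]tscale1 -tscaleDl addNr.
exact: tscale0.
Qed.

HB.instance Definition _ :=
  GRing.isZmodule.Build tensor taddA taddC tadd0 taddN.
HB.instance Definition _ :=
  GRing.Zmodule_isLmodule.Build k tensor tscaleA tscale1 tscaleDr tscaleDl.

Lemma tclsE s : tcls s = \sum_(p <- s) tens p.1 p.2.
Proof.
elim: s => [|[v w] s IH]; first by rewrite big_nil.
rewrite big_cons -IH /tens /=.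
by rewrite -cat1s -taddE.
Qed.

Definition bilin (U : lmodType k) (b : V -> W -> U) : Prop :=
  (forall w, linear (b^~ w)) /\ (forall v, linear (b v)).

Lemma tens_bilin : bilin tens.
Proof.
have D v v' w : tens (v + v') w = tens v w + tens v' w.
  by rewrite /tens; transitivity (tcls ([:: (v, w)] ++ [:: (v', w)]));
    [apply/tclsP; apply: TensAddl | rewrite -taddE].
have D' v w w' : tens v (w + w') = tens v w + tens v w'.
  by rewrite /tens; transitivity (tcls ([:: (v, w)] ++ [:: (v, w')]));
    [apply/tclsP; apply: TensAddr | rewrite -taddE].
have Z a v w : tens (a *: v) w = a *: tens v w.
  by rewrite -[RHS]/(tscale a (tens v w)) tscaleE.
have Z' a v w : tens v (a *: w) = a *: tens v w.
  by rewrite -Z; apply/esym/tclsP; apply: TensScale.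
by split=> [w a v v'|v a w w']; rewrite ?D ?D' ?Z ?Z'.
Qed.

Lemma tensDl v v' w : tens (v + v') w = tens v w + tens v' w.
Proof. exact: (linD (tens_bilin.1 w)). Qed.
Lemma tensDr v w w' : tens v (w + w') = tens v w + tens v w'.
Proof. exact: (linD (tens_bilin.2 v)). Qed.
Lemma tensZl a v w : tens (a *: v) w = a *: tens v w.
Proof. exact: (linZ (tens_bilin.1 w)). Qed.
Lemma tensZr a v w : tens v (a *: w) = a *: tens v w.
Proof. exact: (linZ (tens_bilin.2 v)). Qed.

(* Computed on a chosen representative; for bilinear b this is the linear map
   induced by b (tliftE, tlift_linear). *)
Definition tlift (U : lmodType k) (b : V -> W -> U) (x : tensor) : U :=
  \sum_(p <- trep x) b p.1 p.2.

Section Lift.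
Variables (U : lmodType k) (b : V -> W -> U).
Hypothesis hb : bilin b.

Lemma tens_rel_lift s t : tens_rel s t ->
  \sum_(p <- s) b p.1 p.2 = \sum_(p <- t) b p.1 p.2.
Proof.
case: hb => hl hr.
elim=> {s t} [s|s t _ h|s t u _ h1 _ h2|s s' t t' _ h1 _ h2|s t|w|v v' w|v w w'|a v w] //=.
- by rewrite h1.
- by rewrite !big_cat /= h1 h2.
- by rewrite !big_cat /= addrC.
- by rewrite big_cons !big_nil addr0; apply: (lin0 (hl w)).
- by rewrite !big_cons !big_nil /= !addr0; apply: (linD (hl w)).
- by rewrite !big_cons !big_nil /= !addr0; apply: (linD (hr v)).
- rewrite !big_cons !big_nil /= !addr0.
  by rewrite (linZ (hr v)); apply: (linZ (hl w)).
Qed.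

Lemma tlift_cls s : tlift b (tcls s) = \sum_(p <- s) b p.1 p.2.
Proof. exact: tens_rel_lift (trep_rel s). Qed.

Lemma tliftE v w : tlift b (tens v w) = b v w.
Proof. by rewrite tlift_cls big_cons big_nil addr0. Qed.

Lemma tlift_linear : linear (tlift b).
Proof.
move=> a; elim/tens_ind1=> s; elim/tens_ind1=> t.
rewrite -[a *: _]/(tscale a _) tscaleE -[_ + _]/(tadd _ _) taddE.
rewrite !tlift_cls big_cat /= big_map scaler_sumr; congr (_ + _).
by apply: eq_bigr => p _; apply: (linZ (hb.1 p.2)).
Qed.
End Lift.

Lemma tens_ext (U : lmodType k) (f g : tensor -> U) :
  linear f -> linear g -> (forall v w, f (tens v w) = g (tens v w)) ->
  f =1 g.
Proof.
move=> hf hg h; elim/tens_ind1=> s; rewrite tclsE (linS hf) (linS hg).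
by apply: eq_bigr => p _; apply: h.
Qed.

End Tensor.

Arguments tens {k V W} v w.
Arguments tlift {k V W U} b x.

Section TensorMaps.
Variable k : fieldType.

Definition tmap (V W V' W' : lmodType k) (f : V -> V') (g : W -> W') :
  tensor V W -> tensor V' W' := tlift (fun v w => tens (f v) (g w)).

Definition tassoc (U V W : lmodType k) :
    tensor (tensor U V) W -> tensor U (tensor V W) :=
  tlift (fun x w => tlift (fun u v => tens u (tens v w)) x).

Section Tmap.
Variables (V W V' W' : lmodType k) (f : V -> V') (g : W -> W').
Hypotheses (hf : linear f) (hg : linear g).

Lemma tmap_bilin : bilin (fun v w => tens (f v) (g w)).
Proof.
split=> [w a x y|v a x y]; first by rewrite hf tensDl tensZl.
by rewrite hg tensDr tensZr.
Qed.

Lemma tmap_linear : linear (tmap f g).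
Proof. exact: tlift_linear tmap_bilin. Qed.

Lemma tmapE v w : tmap f g (tens v w) = tens (f v) (g w).
Proof. exact: tliftE tmap_bilin _ _. Qed.
End Tmap.

Lemma tmap_comp (V W V' W' V'' W'' : lmodType k)
    (f : V -> V') (g : W -> W') (f' : V' -> V'') (g' : W' -> W'') :
  linear f -> linear g -> linear f' -> linear g' ->
  forall x, tmap f' g' (tmap f g x) = tmap (fun v => f' (f v)) (fun w => g' (g w)) x.
Proof.
move=> hf hg hf' hg'.
have h1 := lin_comp hf' hf; have h2 := lin_comp hg' hg.
apply: tens_ext; [|exact: tmap_linear|by move=> v w; rewrite !tmapE].
exact: (lin_comp (tmap_linear hf' hg') (tmap_linear hf hg)).
Qed.

Lemma tmap_lincomb_r (V W V' W' : lmodType k) (f : V -> V') (g g' : W -> W') a :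
  linear f -> linear g -> linear g' ->
  forall x, tmap f (fun w => a *: g w + g' w) x = a *: tmap f g x + tmap f g' x.
Proof.
move=> hf hg hg'; have h := lin_comb a hg hg'.
apply: tens_ext; first exact: tmap_linear.
  by apply: lin_comb; apply: tmap_linear.
by move=> v w; rewrite !tmapE // tensDr tensZr.
Qed.

Section Tassoc.
Variables U V W : lmodType k.

Lemma tassoc_bilin_in (w : W) : bilin (fun (u : U) (v : V) => tens u (tens v w)).
Proof.
split=> [v a x y|u a x y]; first by rewrite tensDl tensZl.
by rewrite tensDl tensZl tensDr tensZr.
Qed.

Lemma tassoc_bilin :
  bilin (fun x (w : W) => tlift (fun (u : U) (v : V) => tens u (tens v w)) x).
Proof.
split=> [w|x a w w']; first exact: tlift_linear (tassoc_bilin_in w).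
have h := tassoc_bilin_in.
have hl := tlift_linear (h _).
have := @tens_ext _ _ _ _ _ _ (hl (a *: w + w')) (lin_comb a (hl w) (hl w')).
apply=> u v; rewrite !tliftE ?tensDr ?tensZr //.
Qed.

Lemma tassoc_linear : linear (@tassoc U V W).
Proof. exact: tlift_linear tassoc_bilin. Qed.

Lemma tassocE u v w : tassoc (tens (tens u v) w) = tens u (tens v w) :> tensor U (tensor V W).
Proof.
rewrite /tassoc (tliftE tassoc_bilin).
exact: tliftE (tassoc_bilin_in w) _ _.
Qed.
End Tassoc.

Lemma tassoc_tmap (U V W U' V' W' : lmodType k)
    (f : U -> U') (g : V -> V') (h : W -> W') :
  linear f -> linear g -> linear h ->
  forall x, tassoc (tmap (tmap f g) h x) = tmap f (tmap g h) (tassoc x).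
Proof.
move=> hf hg hh.
have hfg := tmap_linear hf hg; have hgh := tmap_linear hg hh.
have hl := lin_comp (@tassoc_linear U' V' W') (tmap_linear hfg hh).
have hr := lin_comp (tmap_linear hf hgh) (@tassoc_linear U V W).
apply: (tens_ext hl hr) => x w.
have b1 := lin_comp hl ((@tens_bilin k (tensor U V) W).1 w).
have b2 := lin_comp hr ((@tens_bilin k (tensor U V) W).1 w).
apply: (tens_ext b1 b2) => u v.
by rewrite !(tmapE, tassocE) //.
Qed.

End TensorMaps.

Arguments tassoc {k U V W} x.

Section Coker.
Variables (k : fieldType) (U V : lmodType k) (f : U -> V).
Hypothesis hf : linear f.

Definition coker_relb : rel V := fun x y => `[< exists u, f u = x - y >].

Lemma coker_relb_refl : reflexive coker_relb.
Proof. by move=> x; apply/asboolP; exists 0; rewrite (lin0 hf) subrr. Qed.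
Lemma coker_relb_sym : symmetric coker_relb.
Proof.
by move=> x y; apply/asboolP/asboolP => -[u hu]; exists (- u);
  rewrite (linN hf) hu opprB.
Qed.
Lemma coker_relb_trans : transitive coker_relb.
Proof.
move=> y x z /asboolP[u hu] /asboolP[v hv]; apply/asboolP; exists (u + v).
by rewrite (linD hf) hu hv addrA subrK.
Qed.
Definition coker_equiv : equiv_rel V :=
  EquivRel coker_relb coker_relb_refl coker_relb_sym coker_relb_trans.

Definition coker : Type := {eq_quot coker_equiv}.
HB.instance Definition _ := Choice.copy coker {eq_quot coker_equiv}.

Definition cokpi (x : V) : coker := \pi_({eq_quot coker_equiv}) x.
Definition cokrep (q : coker) : V := repr (q : {eq_quot coker_equiv}).

Lemma cokrepK q : cokpi (cokrep q) = q.
Proof. by rewrite /cokpi /cokrep reprK. Qed.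
Lemma cokpiP x y : cokpi x = cokpi y <-> exists u, f u = x - y.
Proof.
split=> [/eqP|h]; first by rewrite /cokpi eqmodE => /asboolP.
by apply/eqP; rewrite /cokpi eqmodE; apply/asboolP.
Qed.
Lemma cokrep_rel x : exists u, f u = cokrep (cokpi x) - x.
Proof. by apply/cokpiP; rewrite cokrepK. Qed.
Lemma coker_ind1 (P : coker -> Prop) : (forall x, P (cokpi x)) -> forall q, P q.
Proof. by move=> h q; rewrite -(cokrepK q). Qed.

Definition cokadd (p q : coker) := cokpi (cokrep p + cokrep q).
Definition cokopp (p : coker) := cokpi (- cokrep p).
Definition cokscale (a : k) (p : coker) := cokpi (a *: cokrep p).

Lemma cokaddE x y : cokadd (cokpi x) (cokpi y) = cokpi (x + y).
Proof.
apply/cokpiP; have [u hu] := cokrep_rel x; have [v hv] := cokrep_rel y.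
by exists (u + v); rewrite (linD hf) hu hv opprD addrACA.
Qed.
Lemma cokoppE x : cokopp (cokpi x) = cokpi (- x).
Proof.
apply/cokpiP; have [u hu] := cokrep_rel x.
by exists (- u); rewrite (linN hf) hu opprB opprK addrC.
Qed.
Lemma cokscaleE a x : cokscale a (cokpi x) = cokpi (a *: x).
Proof.
apply/cokpiP; have [u hu] := cokrep_rel x.
by exists (a *: u); rewrite (linZ hf) hu scalerBr.
Qed.

Lemma cokaddA : associative cokadd.
Proof.
elim/coker_ind1=> x; elim/coker_ind1=> y; elim/coker_ind1=> z.
by rewrite !cokaddE addrA.
Qed.
Lemma cokaddC : commutative cokadd.
Proof. by elim/coker_ind1=> x; elim/coker_ind1=> y; rewrite !cokaddE addrC. Qed.
Lemma cokadd0 : left_id (cokpi 0) cokadd.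
Proof. by elim/coker_ind1=> x; rewrite cokaddE add0r. Qed.
Lemma cokaddN : left_inverse (cokpi 0) cokopp cokadd.
Proof. by elim/coker_ind1=> x; rewrite cokoppE cokaddE addNr. Qed.
HB.instance Definition _ :=
  GRing.isZmodule.Build coker cokaddA cokaddC cokadd0 cokaddN.

Lemma cokscaleA a b q : cokscale a (cokscale b q) = cokscale (a * b) q.
Proof. by elim/coker_ind1: q => x; rewrite !cokscaleE scalerA. Qed.
Lemma cokscale1 : left_id 1 cokscale.
Proof. by elim/coker_ind1=> x; rewrite cokscaleE scale1r. Qed.
Lemma cokscaleDr : right_distributive cokscale +%R.
Proof.
move=> a; elim/coker_ind1=> x; elim/coker_ind1=> y.
by rewrite -![_ + _ in LHS]/(cokadd _ _) -[_ + _ in RHS]/(cokadd _ _)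
  !(cokaddE, cokscaleE) scalerDr.
Qed.
Lemma cokscaleDl q : {morph cokscale^~ q : a b / a + b}.
Proof.
move=> a b; elim/coker_ind1: q => x.
by rewrite -[_ + _ in RHS]/(cokadd _ _) !(cokaddE, cokscaleE) scalerDl.
Qed.
HB.instance Definition _ :=
  GRing.Zmodule_isLmodule.Build k coker cokscaleA cokscale1 cokscaleDr cokscaleDl.

Lemma cokpi_linear : linear cokpi.
Proof.
move=> a x y; rewrite -[_ *: _ in RHS]/(cokscale _ _) cokscaleE.
by rewrite -[_ + _ in RHS]/(cokadd _ _) cokaddE.
Qed.

Lemma cokpi0 u : cokpi (f u) = 0.
Proof. by apply/cokpiP; exists u; rewrite subr0. Qed.

Section Descent.
Variables (W : lmodType k) (g : V -> W).
Hypotheses (hg : linear g) (hgf : forall u, g (f u) = 0).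

Lemma cokrepE x : g (cokrep (cokpi x)) = g x.
Proof.
have [u hu] := cokrep_rel x.
by rewrite -[cokrep _](subrK x) -hu (linD hg) hgf add0r.
Qed.

Lemma cokrep_linear : linear (fun q => g (cokrep q)).
Proof.
move=> a; elim/coker_ind1=> x; elim/coker_ind1=> y.
by rewrite -cokpi_linear !cokrepE hg.
Qed.
End Descent.

End Coker.

Record coalgebra (k : fieldType) := Coalgebra {
  coalg_car :> lmodType k;
  comul : coalg_car -> tensor coalg_car coalg_car;
  counit : coalg_car -> k^o;
  comul_linear : linear comul;
  counit_linear : linear counit;
  comulA : forall c,
    tassoc (tmap comul id (comul c)) = tmap id comul (comul c);
  counitl : forall c, tlift (fun x y => counit x *: y) (comul c) = c;
  counitr : forall c, tlift (fun x y => counit y *: x) (comul c) = c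
}.

Definition coalg_hom (k : fieldType) (C D : coalgebra k) (f : C -> D) : Prop :=
  [/\ linear f,
      forall c, comul (f c) = tmap f f (comul c) &
      forall c, counit (f c) = counit c].

Section TrivialCoalgebra.
Variable k : fieldType.

Definition kcomul (a : k^o) : tensor k^o k^o := tens a 1.
Lemma kcomul_linear : linear kcomul.
Proof. by move=> a x y; rewrite /kcomul tensDl tensZl. Qed.
Lemma kid_linear : linear (id : k^o -> k^o).
Proof. by []. Qed.
Lemma kcomulA c : tassoc (tmap kcomul id (kcomul c)) = tmap id kcomul (kcomul c).
Proof.
have hk := kcomul_linear.
by rewrite /kcomul !tmapE // tassocE.
Qed.
Lemma bil_scalel (V : lmodType k) (W : lmodType k) (e : V -> k^o) :
  linear e -> bilin (fun (v : V) (w : W) => e v *: w).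
Proof.
move=> he; split=> [w a x y|v a x y].
  by rewrite he scalerDl scalerA.
by rewrite scalerDr !scalerA mulrC.
Qed.
Lemma bil_scaler (V : lmodType k) (W : lmodType k) (e : W -> k^o) :
  linear e -> bilin (fun (v : V) (w : W) => e w *: v).
Proof.
move=> he; split=> [w a x y|v a x y].
  by rewrite scalerDr !scalerA mulrC.
by rewrite he scalerDl scalerA.
Qed.
Lemma kcounitl c : tlift (fun x y : k^o => (x : k) *: y) (kcomul c) = c.
Proof.
rewrite /kcomul (tliftE (bil_scalel _ kid_linear)).
by rewrite -[LHS]/(c * 1) mulr1.
Qed.
Lemma kcounitr c : tlift (fun x y : k^o => (y : k) *: x) (kcomul c) = c.
Proof.
rewrite /kcomul (tliftE (bil_scaler _ kid_linear)).
by rewrite -[LHS]/(1 * c) mul1r.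
Qed.

Definition kcoalg : coalgebra k :=
  @Coalgebra k k^o kcomul id kcomul_linear kid_linear kcomulA kcounitl kcounitr.
End TrivialCoalgebra.

Record ncoalgebra (k : fieldType) := NCoalgebra {
  ncoalg_car :> lmodType k;
  ncomul : ncoalg_car -> tensor ncoalg_car ncoalg_car;
  ncomul_linear : linear ncomul;
  ncomulA : forall c,
    tassoc (tmap ncomul id (ncomul c)) = tmap id ncomul (ncomul c)
}.

Section Conilpotent.
Variable k : fieldType.

Fixpoint tpow (V : lmodType k) (m : nat) : lmodType k :=
  if m is m'.+1 then tensor V (tpow V m') else V.

Fixpoint iter_ncomul (D : ncoalgebra k) (m : nat) : D -> tpow D m :=
  if m is m'.+1 return D -> tpow D m
  then fun d => tmap id (iter_ncomul m') (ncomul d) else id.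

Definition nconilpotent (D : ncoalgebra k) : Prop :=
  forall d : D, exists2 m, (0 < m)%N & iter_ncomul m d = 0.

Record coaugmentation (C : coalgebra k) := Coaugmentation {
  coaug :> k^o -> C;
  coaug_hom : coalg_hom (C := kcoalg k) coaug
}.

Section Quotient.
Variables (C : coalgebra k) (g : coaugmentation C).

Lemma coaug_linear : linear g.
Proof. by case: (coaug_hom g). Qed.

Definition quot_coaug : lmodType k := coker coaug_linear.
Definition quot_pi : C -> quot_coaug := cokpi coaug_linear.
Definition quot_comul (q : quot_coaug) : tensor quot_coaug quot_coaug :=
  tmap quot_pi quot_pi (comul (cokrep q)).

Lemma quot_pi_linear : linear quot_pi.
Proof. exact: cokpi_linear. Qed.

Lemma quot_comul_pre_linear : linear (fun c => tmap quot_pi quot_pi (comul c)).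
Proof.
apply: lin_comp (@comul_linear _ C).
by apply: tmap_linear; apply: quot_pi_linear.
Qed.

Lemma quot_comul_pre0 a : tmap quot_pi quot_pi (comul (g a)) = 0.
Proof.
have hp := quot_pi_linear; have hl := coaug_linear.
case: (coaug_hom g) => _ h _.
rewrite h /= /kcomul tmapE // tmapE // {1}/quot_pi cokpi0.
exact: (lin0 ((@tens_bilin k quot_coaug quot_coaug).1 _)).
Qed.

Lemma quot_comulE c : quot_comul (quot_pi c) = tmap quot_pi quot_pi (comul c).
Proof.
exact: (cokrepE coaug_linear quot_comul_pre_linear quot_comul_pre0).
Qed.

Lemma quot_comul_linear : linear quot_comul.
Proof.
exact: (cokrep_linear (hf := coaug_linear) quot_comul_pre_linear quot_comul_pre0).
Qed.

Lemma quot_comulA q :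
  tassoc (tmap quot_comul id (quot_comul q)) =
  tmap id quot_comul (quot_comul q).
Proof.
have hp := quot_pi_linear; have hq := quot_comul_linear.
have hc := @comul_linear _ C; have hpp := tmap_linear hp hp.
elim/coker_ind1: q => c; rewrite -/(quot_pi c) quot_comulE !tmap_comp //.
have -> : (fun v => quot_comul (quot_pi v)) =
          (fun v => tmap quot_pi quot_pi (comul v)).
  by apply: funext => v; rewrite quot_comulE.
have := tmap_comp hc (lin_id (U := C)) hpp hp; rewrite /= => <-.
have := tmap_comp (lin_id (U := C)) hc hp hpp; rewrite /= => <-.
by rewrite tassoc_tmap // comulA.
Qed.

Definition quot_coalg : ncoalgebra k :=
  @NCoalgebra k quot_coaug quot_comul quot_comul_linear quot_comulA.
End Quotient.

Definition conilpotent (C : coalgebra k) (g : coaugmentation C) : Prop :=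
  nconilpotent (quot_coalg g).

End Conilpotent.

(* A k-linear category with finite direct sums and a faithful k-linear functor
   car to k-vector spaces: the morphisms from X to Y are the linear maps f
   between the underlying spaces such that mor f. *)
Record kcat (k : fieldType) := KCat {
  obj :> Type;
  car : obj -> lmodType k;
  mor : forall X Y : obj, (car X -> car Y) -> Prop;
  mor_linear : forall (X Y : obj) (f : car X -> car Y), mor f -> linear f;
  mor_id : forall X : obj, mor (fun x : car X => x);
  mor_comp : forall (X Y Z : obj) (g : car Y -> car Z) (f : car X -> car Y),
    mor g -> mor f -> mor (fun x => g (f x));
  mor_zero : forall X Y : obj, mor (fun _ : car X => 0 : car Y);
  mor_lincomb : forall (X Y : obj) (a : k) (f g : car X -> car Y),
    mor f -> mor g -> mor (fun x => a *: f x + g x);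
  zob : obj;
  zob_eq0 : forall x : car zob, x = 0;
  dsum : obj -> obj -> obj;
  dpair : forall X Y : obj, car X -> car Y -> car (dsum X Y);
  dfst : forall X Y : obj, car (dsum X Y) -> car X;
  dsnd : forall X Y : obj, car (dsum X Y) -> car Y;
  mor_dfst : forall X Y : obj, mor (@dfst X Y);
  mor_dsnd : forall X Y : obj, mor (@dsnd X Y);
  mor_dpair : forall (T X Y : obj) (f : car T -> car X) (g : car T -> car Y),
    mor f -> mor g -> mor (fun t => dpair (f t) (g t));
  dfst_pair : forall (X Y : obj) (x : car X) (y : car Y), dfst (dpair x y) = x;
  dsnd_pair : forall (X Y : obj) (x : car X) (y : car Y), dsnd (dpair x y) = y;
  dpair_eta : forall (X Y : obj) (z : car (dsum X Y)), dpair (dfst z) (dsnd z) = z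
}.

Arguments car {k A} X : rename.
Arguments mor {k A X Y} f : rename.
Arguments zob {k A} : rename.
Arguments dsum {k A} X Y : rename.
Arguments dpair {k A X Y} x y : rename.
Arguments dfst {k A X Y} z : rename.
Arguments dsnd {k A X Y} z : rename.

Section Yoneda.
Variables (k : fieldType) (A : kcat k).

(* 0 -> Y -> mid -> X -> 0, exact on the underlying vector spaces; in the
   categories of comodules and of modules this is exactness. *)
Record ses (X Y : A) := Ses {
  mid : A;
  inc : car Y -> car mid;
  prj : car mid -> car X;
  inc_mor : mor inc;
  prj_mor : mor prj;
  inc_inj : injective inc;
  prj_surj : forall x, exists e, prj e = x;
  ses_exact : forall e, prj e = 0 <-> exists y, inc y = e
}.

Arguments inc {X Y} S y : rename.
Arguments prj {X Y} S e : rename.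
Arguments inc_mor {X Y} S : rename.
Arguments prj_mor {X Y} S : rename.
Arguments inc_inj {X Y} S [x1 x2] : rename.
Arguments prj_surj {X Y} S x : rename.
Arguments ses_exact {X Y} S e : rename.

Definition ses_mor (X Y X' Y' : A) (f : car Y -> car Y') (g : car X -> car X')
    (S : ses X Y) (S' : ses X' Y') : Prop :=
  exists h : car (mid S) -> car (mid S'),
    [/\ mor h, forall y, h (inc S y) = inc S' (f y)
             & forall e, g (prj S e) = prj S' (h e)].

(* An exact sequence 0 -> Y -> E_m -> ... -> E_0 -> X -> 0, given as a splice
   of m.+1 short exact sequences: the first one is 0 -> Y -> E_m -> Z -> 0. *)
Fixpoint splice (m : nat) (X Y : A) : Type :=
  if m is m'.+1 then {Z : A & (ses Z Y * splice m' X Z)%type} else ses X Y.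

(* There is a morphism of exact sequences with f and g at the two ends. *)
Fixpoint splice_mor (m : nat) (X Y X' Y' : A)
    (f : car Y -> car Y') (g : car X -> car X') :
    splice m X Y -> splice m X' Y' -> Prop :=
  match m return splice m X Y -> splice m X' Y' -> Prop with
  | 0 => ses_mor f g
  | m'.+1 => fun S S' =>
      exists h : car (projT1 S) -> car (projT1 S'),
        [/\ mor h, ses_mor f h (projT2 S).1 (projT2 S').1
                 & splice_mor h g (projT2 S).2 (projT2 S').2]
  end.

Definition yequiv (m : nat) (X Y : A) : splice m X Y -> splice m X Y -> Prop :=
  clos_refl_sym_trans _ (splice_mor id id).

Section SplitSes.
Variables X Y : A.
Let i (y : car Y) : car (dsum Y X) := dpair y 0.
Let p (z : car (dsum Y X)) : car X := dsnd z.
Lemma split_inc_mor : mor i.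
Proof. by apply: mor_dpair; [apply: mor_id | apply: mor_zero]. Qed.
Lemma split_prj_mor : mor p.
Proof. exact: mor_dsnd. Qed.
Lemma split_inj : injective i.
Proof. by move=> y y' /(congr1 dfst); rewrite !dfst_pair. Qed.
Lemma split_surj x : exists e, p e = x.
Proof. by exists (dpair 0 x); rewrite /p dsnd_pair. Qed.
Lemma split_exact e : p e = 0 <-> exists y, i y = e.
Proof.
split=> [h|[y <-]]; last by rewrite /p dsnd_pair.
by exists (dfst e); rewrite /i -[0]h dpair_eta.
Qed.
Definition split_ses : ses X Y :=
  Ses split_inc_mor split_prj_mor split_inj split_surj split_exact.
End SplitSes.

Section DsumSes.
Variables (X Y X' Y' : A) (S : ses X Y) (S' : ses X' Y').
Let i (z : car (dsum Y Y')) : car (dsum (mid S) (mid S')) :=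
  dpair (inc S (dfst z)) (inc S' (dsnd z)).
Let p (e : car (dsum (mid S) (mid S'))) : car (dsum X X') :=
  dpair (prj S (dfst e)) (prj S' (dsnd e)).
Lemma dsum_inc_mor : mor i.
Proof.
by apply: mor_dpair; [apply: mor_comp (inc_mor S) _; apply: mor_dfst
                     |apply: mor_comp (inc_mor S') _; apply: mor_dsnd].
Qed.
Lemma dsum_prj_mor : mor p.
Proof.
by apply: mor_dpair; [apply: mor_comp (prj_mor S) _; apply: mor_dfst
                     |apply: mor_comp (prj_mor S') _; apply: mor_dsnd].
Qed.
Lemma dsum_inj : injective i.
Proof.
move=> z z' h; move: (congr1 dfst h) (congr1 dsnd h).
rewrite /i !dfst_pair !dsnd_pair => /(inc_inj S) h1 /(inc_inj S') h2.
by rewrite -(dpair_eta z) h1 h2 dpair_eta.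
Qed.
Lemma dsum_surj x : exists e, p e = x.
Proof.
have [e he] := prj_surj S (dfst x); have [e' he'] := prj_surj S' (dsnd x).
by exists (dpair e e'); rewrite /p dfst_pair dsnd_pair he he' dpair_eta.
Qed.
Lemma dsum_exact e : p e = 0 <-> exists y, i y = e.
Proof.
have h1 := lin0 (mor_linear (mor_dfst X X')).
have h2 := lin0 (mor_linear (mor_dsnd X X')).
split=> [h|[y <-]]; last first.
  have /(ses_exact S) E1 : exists y0, inc S y0 = inc S (dfst y) by exists (dfst y).
  have /(ses_exact S') E2 : exists y0, inc S' y0 = inc S' (dsnd y) by exists (dsnd y).
  rewrite /p /i dfst_pair dsnd_pair E1 E2.
  by rewrite -[RHS]dpair_eta h1 h2.
move: (congr1 dfst h) (congr1 dsnd h); rewrite /p dfst_pair dsnd_pair h1 h2.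
move=> /(ses_exact S)[y hy] /(ses_exact S')[y' hy']; exists (dpair y y').
by rewrite /i dfst_pair dsnd_pair hy hy' dpair_eta.
Qed.
Definition dsum_ses : ses (dsum X X') (dsum Y Y') :=
  Ses dsum_inc_mor dsum_prj_mor dsum_inj dsum_surj dsum_exact.
End DsumSes.

Fixpoint split_splice (m : nat) (X Y : A) : splice m X Y :=
  match m with
  | 0 => split_ses X Y
  | m'.+1 => existT _ zob (split_ses zob Y, split_splice m' X zob)
  end.

Fixpoint dsum_splice (m : nat) (X Y X' Y' : A) :
    splice m X Y -> splice m X' Y' -> splice m (dsum X X') (dsum Y Y') :=
  match m return
    splice m X Y -> splice m X' Y' -> splice m (dsum X X') (dsum Y Y') with
  | 0 => @dsum_ses X Y X' Y'
  | m'.+1 => fun S S' =>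
      existT _ (dsum (projT1 S) (projT1 S'))
        (dsum_ses (projT2 S).1 (projT2 S').1,
         dsum_splice (projT2 S).2 (projT2 S').2)
  end.

Definition diag (X : A) (x : car X) : car (dsum X X) := dpair x x.
Definition codiag (X : A) (z : car (dsum X X)) : car X := dfst z + dsnd z.

(* Yoneda extensions of degree n >= 1 (the value at n = 0 is meaningless). *)
Definition yext (n : nat) (X Y : A) : Type := splice n.-1 X Y.

Definition yclass n (X Y : A) (E : yext n X Y) : yext n X Y -> Prop :=
  yequiv E.

Record Ext (n : nat) (X Y : A) := MkExt {
  ext_class :> yext n X Y -> Prop;
  ext_classP : exists E, ext_class = yclass E
}.

(* The vector space operations on classes of extensions: by Yoneda's calculus
   a morphism from F to E with f and g at the ends means that
   f_* F is equivalent to g^* E. *)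
Section Operations.
Variables (n : nat) (X Y : A).
Implicit Types P Q : yext n X Y -> Prop.

Definition ext_zero : yext n X Y -> Prop := yclass (split_splice n.-1 X Y).

(* The Baer sum codiag_* (diag^* (E1 (+) E2)). *)
Definition ext_add P Q : yext n X Y -> Prop := fun E =>
  exists E1 E2 (F : splice n.-1 X (dsum Y Y)) (E3 : yext n X Y),
    [/\ P E1, Q E2, splice_mor id (@diag X) F (dsum_splice E1 E2),
        splice_mor (@codiag Y) id F E3 & yequiv E3 E].

(* The pushforward along multiplication by a on Y. *)
Definition ext_scale (a : k) P : yext n X Y -> Prop := fun E =>
  exists E1 E2 : yext n X Y,
    [/\ P E1, splice_mor (fun y => a *: y) id E1 E2 & yequiv E2 E].

Definition ext_lincomb (m : nat) (c : 'I_m -> k) (x : 'I_m -> Ext n X Y) :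
    yext n X Y -> Prop :=
  \big[ext_add/ext_zero]_(i < m) ext_scale (c i) (x i).

Definition ext_basis (I : Type) (e : I -> Ext n X Y) : Prop :=
  (forall x : Ext n X Y, exists m (j : 'I_m -> I) (c : 'I_m -> k),
     ext_class x = ext_lincomb c (fun i => e (j i))) /\
  (forall m (j : 'I_m -> I) (c : 'I_m -> k), injective j ->
     ext_lincomb c (fun i => e (j i)) = ext_zero -> forall i, c i = 0).

End Operations.

(* The dimension of Ext n X Y is the cardinality of I.  A type is used since
   Ext n X Y is too large to be an lmodType: its elements are classes of
   sequences of arbitrary objects. *)
Definition ext_dim (n : nat) (X Y : A) (I : Type) : Prop :=
  exists e : I -> Ext n X Y, ext_basis e.

Definition ext_finite_dim (n : nat) (X Y : A) : Prop :=
  exists m : nat, ext_dim n X Y 'I_m.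

End Yoneda.

Arguments inc {k A X Y} S y : rename.
Arguments prj {k A X Y} S e : rename.
Arguments inc_mor {k A X Y} S : rename.
Arguments prj_mor {k A X Y} S : rename.
Arguments inc_inj {k A X Y} S [x1 x2] : rename.
Arguments prj_surj {k A X Y} S x : rename.
Arguments ses_exact {k A X Y} S e : rename.

Record exact_functor (k : fieldType) (A B : kcat k) := ExactFunctor {
  fob :> A -> B;
  fmap : forall X Y : A, (car X -> car Y) -> car (fob X) -> car (fob Y);
  fmap_mor : forall (X Y : A) (f : car X -> car Y), mor f -> mor (fmap f);
  fmap_id : forall X : A, fmap (fun x : car X => x) = id;
  fmap_comp : forall (X Y Z : A) (g : car Y -> car Z) (f : car X -> car Y),
    mor g -> mor f -> fmap (fun x => g (f x)) = fun x => fmap g (fmap f x);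
  fmap_lincomb : forall (X Y : A) (a : k) (f g : car X -> car Y),
    mor f -> mor g ->
    fmap (fun x => a *: f x + g x) = fun x => a *: fmap f x + fmap g x;
  fmap_inj : forall (X Y : A) (S : ses X Y), injective (fmap (inc S));
  fmap_surj : forall (X Y : A) (S : ses X Y) x, exists e, fmap (prj S) e = x;
  fmap_exact : forall (X Y : A) (S : ses X Y) e,
    fmap (prj S) e = 0 <-> exists y, fmap (inc S) y = e
}.

Arguments fmap {k A B} F {X Y} f x : rename.

Section InducedMap.
Variables (k : fieldType) (A B : kcat k) (F : exact_functor A B).

Definition fun_ses (X Y : A) (S : ses X Y) : ses (F X) (F Y) :=
  Ses (fmap_mor F (inc_mor S)) (fmap_mor F (prj_mor S))
      (@fmap_inj _ _ _ F _ _ S) (@fmap_surj _ _ _ F _ _ S)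
      (@fmap_exact _ _ _ F _ _ S).

Fixpoint fun_splice (m : nat) (X Y : A) :
    splice m X Y -> splice m (F X) (F Y) :=
  match m return splice m X Y -> splice m (F X) (F Y) with
  | 0 => @fun_ses X Y
  | m'.+1 => fun S =>
      existT _ (F (projT1 S))
        (fun_ses (projT2 S).1, fun_splice (projT2 S).2)
  end.

Lemma fun_ses_mor (X Y X' Y' : A) (f : car Y -> car Y') (g : car X -> car X')
    (S : ses X Y) (S' : ses X' Y') :
  mor f -> mor g -> ses_mor f g S S' ->
  ses_mor (fmap F f) (fmap F g) (fun_ses S) (fun_ses S').
Proof.
move=> hf hg [h [hm h1 h2]]; exists (fmap F h); split=> /=.
- exact: fmap_mor.
- move=> y; rewrite -[LHS]/((fun x => fmap F h (fmap F (inc S) x)) y).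
  rewrite -(fmap_comp F hm (inc_mor S)).
  rewrite -[RHS]/((fun x => fmap F (inc S') (fmap F f x)) y).
  rewrite -(fmap_comp F (inc_mor S') hf).
  by congr (fmap F _ y); apply: funext.
- move=> e; rewrite -[LHS]/((fun x => fmap F g (fmap F (prj S) x)) e).
  rewrite -(fmap_comp F hg (prj_mor S)).
  rewrite -[RHS]/((fun x => fmap F (prj S') (fmap F h x)) e).
  rewrite -(fmap_comp F (prj_mor S') hm).
  by congr (fmap F _ e); apply: funext.
Qed.

Lemma fun_splice_mor m (X Y X' Y' : A) (f : car Y -> car Y')
    (g : car X -> car X') (S : splice m X Y) (S' : splice m X' Y') :
  mor f -> mor g -> splice_mor f g S S' ->
  splice_mor (fmap F f) (fmap F g) (fun_splice S) (fun_splice S').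
Proof.
elim: m Y Y' f S S' => [|m IH] Y Y' f S S' hf hg /=; first exact: fun_ses_mor.
move=> [h [hm h1 h2]]; exists (fmap F h); split.
- exact: fmap_mor.
- exact: fun_ses_mor.
- exact: IH.
Qed.

Lemma fun_yequiv m (X Y : A) (S S' : splice m X Y) :
  yequiv S S' -> yequiv (fun_splice S) (fun_splice S').
Proof.
elim=> {S S'} [S S' h|S|S S' _ h|S S' S'' _ h1 _ h2].
- apply: rst_step.
  have := fun_splice_mor (mor_id Y) (mor_id X) h.
  by rewrite !fmap_id.
- exact: rst_refl.
- exact: rst_sym.
- exact: rst_trans h1 h2.
Qed.

Definition Ext_map_class (n : nat) (X Y : A) (x : Ext n X Y) :
    yext n (F X) (F Y) -> Prop :=
  fun G => exists2 E, ext_class x E & yequiv (fun_splice E) G.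

Lemma Ext_map_classP (n : nat) (X Y : A) (x : Ext n X Y) :
  exists E, Ext_map_class x = yclass E.
Proof.
have [E hE] := ext_classP x; exists (fun_splice E); apply/predeqP => G.
rewrite /Ext_map_class hE; split=> [[E' h1 h2]|h]; last by exists E => //; apply: rst_refl.
exact: rst_trans (fun_yequiv h1) h2.
Qed.

(* Sends the class of an extension E to the class of F(E). *)
Definition Ext_map (n : nat) (X Y : A) (x : Ext n X Y) : Ext n (F X) (F Y) :=
  MkExt (Ext_map_classP x).

End InducedMap.

Record comodule (k : fieldType) (C : coalgebra k) := Comodule {
  comod_car :> lmodType k;
  coact : comod_car -> tensor C comod_car;
  coact_linear : linear coact;
  coactA : forall m,
    tassoc (tmap (@comul _ C) id (coact m)) = tmap id coact (coact m);
  coact1 : forall m, tlift (fun (c : C) x => counit c *: x) (coact m) = m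
}.

Section ComoduleCategory.
Variables (k : fieldType) (C : coalgebra k).

Definition comod_hom (M N : comodule C) (f : M -> N) : Prop :=
  linear f /\ forall m, coact (f m) = tmap id f (coact m).

Lemma comod_hom_linear (M N : comodule C) (f : M -> N) :
  comod_hom f -> linear f.
Proof. by case. Qed.

Lemma tmap_id (V W : lmodType k) (x : tensor V W) : tmap id id x = x.
Proof.
move: x; apply: tens_ext => //; first exact: tmap_linear.
by move=> v w; rewrite tmapE.
Qed.

Lemma tmap_zero (V W W' : lmodType k) (x : tensor V W) :
  tmap id (fun _ : W => 0 : W') x = 0.
Proof.
have h0 := @lin_cst0 k W W'.
move: x; apply: tens_ext; [exact: tmap_linear|exact: lin_cst0|].
move=> v w; rewrite tmapE //.
exact: (lin0 ((@tens_bilin k V W').2 v)).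
Qed.

Lemma comod_hom_id (M : comodule C) : comod_hom (fun x : M => x).
Proof. by split=> // m; rewrite tmap_id. Qed.

Lemma comod_hom_comp (L M N : comodule C) (g : M -> N) (f : L -> M) :
  comod_hom g -> comod_hom f -> comod_hom (fun x => g (f x)).
Proof.
move=> [hg cg] [hf cf]; split=> [|m]; first exact: lin_comp.
by rewrite cg cf tmap_comp.
Qed.

Lemma comod_hom_zero (M N : comodule C) : comod_hom (fun _ : M => 0 : N).
Proof.
split=> [|m]; first exact: lin_cst0.
by rewrite (lin0 (@coact_linear _ _ N)) tmap_zero.
Qed.

Lemma comod_hom_lincomb (M N : comodule C) (a : k) (f g : M -> N) :
  comod_hom f -> comod_hom g -> comod_hom (fun x => a *: f x + g x).
Proof.
move=> [hf cf] [hg cg]; split=> [|m]; first exact: lin_comb.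
by rewrite coact_linear cf cg tmap_lincomb_r.
Qed.

Section ZeroComodule.
Let Z : lmodType k := 'rV[k]_0.
Let z (_ : Z) : tensor C Z := 0.
Lemma zcomod_linear : linear z. Proof. exact: lin_cst0. Qed.
Lemma zcomodA m : tassoc (tmap (@comul _ C) id (z m)) = tmap id z (z m).
Proof.
rewrite /z (lin0 (tmap_linear (@comul_linear _ C) (lin_id (U := Z)))).
rewrite (lin0 (@tassoc_linear _ _ _ _)).
by rewrite (lin0 (tmap_linear (lin_id (U := C)) zcomod_linear)).
Qed.
Lemma zcomod1 m : tlift (fun (c : C) x => counit c *: x) (z m) = m.
Proof. by rewrite [LHS]thinmx0 [RHS]thinmx0. Qed.
Definition zcomod : comodule C := Comodule zcomod_linear zcomodA zcomod1.
Lemma zcomod_eq0 (x : zcomod) : x = 0.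
Proof. exact: thinmx0. Qed.
End ZeroComodule.

Section DsumComodule.
Variables M N : comodule C.
Let S : lmodType k := (M * N)%type.
Let l (m : M) : S := (m, 0).
Let r (n : N) : S := (0, n).
Definition dsum_coact (x : M * N) : tensor C (M * N)%type :=
  tmap id l (coact x.1) + tmap id r (coact x.2).

Lemma dsum_l_linear : linear l.
Proof. by move=> a x y; rewrite /l; congr (_, _); rewrite /= scaler0 addr0. Qed.
Lemma dsum_r_linear : linear r.
Proof. by move=> a x y; rewrite /r; congr (_, _); rewrite /= scaler0 addr0. Qed.
Lemma dsum_fst_linear : linear (fst : S -> M). Proof. by []. Qed.
Lemma dsum_snd_linear : linear (snd : S -> N). Proof. by []. Qed.

Lemma dsum_coact_linear : linear dsum_coact.
Proof.
have hl := tmap_linear (lin_id (U := C)) dsum_l_linear.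
have hr := tmap_linear (lin_id (U := C)) dsum_r_linear.
move=> a x y; rewrite /dsum_coact /= !coact_linear hl hr.
by rewrite scalerDr addrACA.
Qed.

Lemma dsum_coact_l m : dsum_coact (l m) = tmap id l (coact m).
Proof.
rewrite /dsum_coact /= (lin0 (@coact_linear _ _ N)).
by rewrite (lin0 (tmap_linear (lin_id (U := C)) dsum_r_linear)) addr0.
Qed.
Lemma dsum_coact_r n : dsum_coact (r n) = tmap id r (coact n).
Proof.
rewrite /dsum_coact /= (lin0 (@coact_linear _ _ M)).
by rewrite (lin0 (tmap_linear (lin_id (U := C)) dsum_l_linear)) add0r.
Qed.

Lemma dsum_part_A (L : comodule C) (i : L -> S) : linear i ->
  (forall x, dsum_coact (i x) = tmap id i (coact x)) ->
  forall x, tassoc (tmap (@comul _ C) id (tmap id i (coact x))) =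
            tmap id dsum_coact (tmap id i (coact x)).
Proof.
move=> hi ci x; have hc := @comul_linear _ C; have hL := @coact_linear _ _ L.
have hd := dsum_coact_linear; have hid := lin_id (U := C).
rewrite !tmap_comp //.
have -> : (fun w => dsum_coact (i w)) = (fun w => tmap id i (coact w)).
  exact: funext.
have := tmap_comp hid hL hid (tmap_linear hid hi); rewrite /= => <-.
rewrite -coactA -tassoc_tmap //; congr tassoc.
rewrite tmap_comp //; last exact: tmap_linear.
by congr (tmap _ _ _); apply: funext => c; rewrite tmap_id.
Qed.

Lemma dsum_coactA x :
  tassoc (tmap (@comul _ C) id (dsum_coact x)) =
  tmap id dsum_coact (dsum_coact x).
Proof.
have hc := @comul_linear _ C; have hd := dsum_coact_linear.
rewrite [dsum_coact x]/dsum_coact.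
rewrite (linD (tmap_linear hc (lin_id (U := S)))) (linD (@tassoc_linear _ _ _ _)).
rewrite (linD (tmap_linear (lin_id (U := C)) hd)).
by congr (_ + _); apply: dsum_part_A; [exact: dsum_l_linear|
  exact: dsum_coact_l|exact: dsum_r_linear|exact: dsum_coact_r].
Qed.

Lemma dsum_part_1 (L : comodule C) (i : L -> S) : linear i ->
  forall x, tlift (fun (c : C) y => counit c *: y) (tmap id i (coact x)) = i x.
Proof.
move=> hi x; rewrite -[in RHS](coact1 x); move: (coact x).
have hb (V : lmodType k) := bil_scalel V (@counit_linear _ C).
apply: tens_ext.
- exact: (lin_comp (tlift_linear (hb _)) (tmap_linear (lin_id (U := C)) hi)).
- exact: (lin_comp hi (tlift_linear (hb _))).
- by move=> c y; rewrite tmapE // !(tliftE (hb _)) (linZ hi).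
Qed.

Lemma dsum_coact1 x : tlift (fun (c : C) y => counit c *: y) (dsum_coact x) = x.
Proof.
rewrite /dsum_coact (linD (tlift_linear (bil_scalel _ (@counit_linear _ C)))).
rewrite !dsum_part_1; [|exact: dsum_r_linear|exact: dsum_l_linear].
by case: x => m n; congr (_, _); rewrite /= ?addr0 ?add0r.
Qed.

Definition dsum_comod : comodule C :=
  Comodule dsum_coact_linear dsum_coactA dsum_coact1.

Lemma dsum_fst_hom : comod_hom (fst : dsum_comod -> M).
Proof.
split=> // -[m n] /=; have hid := lin_id (U := C).
have hl := dsum_l_linear; have hr := dsum_r_linear.
rewrite /coact /= /dsum_coact (linD (tmap_linear hid dsum_fst_linear)).
by rewrite !tmap_comp //= tmap_id tmap_zero addr0.
Qed.
Lemma dsum_snd_hom : comod_hom (snd : dsum_comod -> N).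
Proof.
split=> // -[m n] /=; have hid := lin_id (U := C).
have hl := dsum_l_linear; have hr := dsum_r_linear.
rewrite /coact /= /dsum_coact (linD (tmap_linear hid dsum_snd_linear)).
by rewrite !tmap_comp //= tmap_id tmap_zero add0r.
Qed.
Lemma dsum_pair_hom (T : comodule C) (f : T -> M) (g : T -> N) :
  comod_hom f -> comod_hom g ->
  comod_hom (fun t => (f t, g t) : dsum_comod).
Proof.
move=> [hf cf] [hg cg]; have hid := lin_id (U := C).
have hl := dsum_l_linear; have hr := dsum_r_linear.
split=> [a x y|t]; first by rewrite hf hg.
rewrite {1}/coact /= /dsum_coact /= cf cg !tmap_comp //.
have hlf : linear (fun w => l (f w)) by apply: lin_comp.
have hrg : linear (fun w => r (g w)) by apply: lin_comp.
have := tmap_lincomb_r 1 hid hlf hrg (coact t); rewrite scale1r => <-.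
congr (tmap _ _ _); apply: funext => w.
by rewrite scale1r; congr (_, _); rewrite /= ?addr0 ?add0r.
Qed.
End DsumComodule.

Definition comod_cat : kcat k :=
  @KCat k (comodule C) (fun M => M : lmodType k) comod_hom
    comod_hom_linear comod_hom_id comod_hom_comp comod_hom_zero
    comod_hom_lincomb zcomod zcomod_eq0 dsum_comod (fun _ _ m n => (m, n))
    (fun _ _ => fst) (fun _ _ => snd) dsum_fst_hom dsum_snd_hom
    (fun T M N => @dsum_pair_hom M N T) (fun _ _ _ _ => erefl) (fun _ _ _ _ => erefl)
    (fun M N z => esym (surjective_pairing z)).

End ComoduleCategory.

Section TrivialComodule.
Variables (k : fieldType) (C : coalgebra k) (g : coaugmentation C).

Definition triv_coact (a : k^o) : tensor C k^o := tens (g 1) a.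

Lemma triv_coact_linear : linear triv_coact.
Proof. exact: (@tens_bilin k C k^o).2. Qed.

Lemma triv_coactA a :
  tassoc (tmap (@comul _ C) id (triv_coact a)) =
  tmap id triv_coact (triv_coact a).
Proof.
have hg := coaug_linear g; have ht := triv_coact_linear.
have hc := @comul_linear _ C; have hid (V : lmodType k) := lin_id (U := V).
rewrite /triv_coact !tmapE //.
case: (coaug_hom g) => _ hm _; rewrite hm /= /kcomul tmapE //.
by rewrite tassocE.
Qed.

Lemma triv_coact1 a :
  tlift (fun (c : C) (x : k^o) => counit c *: x) (triv_coact a) = a.
Proof.
rewrite (tliftE (bil_scalel _ (@counit_linear _ C))).
by case: (coaug_hom g) => _ _ ->; rewrite scale1r.
Qed.

Definition triv_comod : comodule C :=
  Comodule triv_coact_linear triv_coactA triv_coact1.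
End TrivialComodule.

Record dual (k : fieldType) (C : coalgebra k) := Dual {
  dual_fun :> C -> k^o;
  dual_linear : linear dual_fun
}.

HB.instance Definition _ (k : fieldType) (C : coalgebra k) :=
  gen_eqMixin (dual C).
HB.instance Definition _ (k : fieldType) (C : coalgebra k) :=
  gen_choiceMixin (dual C).

Section DualAlgebra.
Variables (k : fieldType) (C : coalgebra k).
Implicit Types f g h : dual C.

Lemma dual_ext f g : f =1 g -> f = g.
Proof.
case: f g => f hf [g hg] /= /funext h; move: hf hg; rewrite h => hf hg.
by congr Dual; apply: Prop_irrelevance.
Qed.

Lemma dual_opp_linear f : linear (fun c => - f c).
Proof. by move=> a x y; rewrite (dual_linear f) opprD scalerN. Qed.
Lemma dual_add_linear f g : linear (fun c => f c + g c).
Proof.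
by move=> a x y; rewrite (dual_linear f) (dual_linear g) scalerDr addrACA.
Qed.

(* The factors are swapped: (fg)(c) = f(c_(2)) g(c_(1)). *)
Definition dual_pair f g (x y : C) : k^o := f y * g x.
Lemma dual_pair_bilin f g : bilin (dual_pair f g).
Proof.
split=> [y a x x'|x a y y']; rewrite /dual_pair.
  by rewrite (dual_linear g) mulrDr -[_ *: _]/(_ * _) mulrCA.
by rewrite (dual_linear f) mulrDl -[_ *: _]/(_ * _) -mulrA.
Qed.
Lemma dual_mul_linear f g : linear (fun c => tlift (dual_pair f g) (comul c)).
Proof.
exact: lin_comp (tlift_linear (dual_pair_bilin f g)) (@comul_linear _ C).
Qed.

Definition dual_zero : dual C := Dual (@lin_cst0 k C k^o).
Definition dual_opp f : dual C := Dual (dual_opp_linear f).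
Definition dual_add f g : dual C := Dual (dual_add_linear f g).
Definition dual_one : dual C := Dual (@counit_linear _ C).
Definition dual_mul f g : dual C := Dual (dual_mul_linear f g).

Lemma dual_addA : associative dual_add.
Proof. by move=> f g h; apply: dual_ext => c /=; rewrite addrA. Qed.
Lemma dual_addC : commutative dual_add.
Proof. by move=> f g; apply: dual_ext => c /=; rewrite addrC. Qed.
Lemma dual_add0 : left_id dual_zero dual_add.
Proof. by move=> f; apply: dual_ext => c /=; rewrite add0r. Qed.
Lemma dual_addN : left_inverse dual_zero dual_opp dual_add.
Proof. by move=> f; apply: dual_ext => c /=; rewrite addNr. Qed.
HB.instance Definition _ :=
  GRing.isZmodule.Build (dual C) dual_addA dual_addC dual_add0 dual_addN.

Lemma dual_mulr1 : right_id dual_one dual_mul.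
Proof.
move=> f; apply: dual_ext => c /=.
rewrite -[in RHS](counitl c); move: (comul c).
have hb := bil_scalel C (@counit_linear _ C).
apply: tens_ext.
- exact: tlift_linear (dual_pair_bilin _ _).
- exact: lin_comp (dual_linear f) (tlift_linear hb).
move=> x y; rewrite (tliftE (dual_pair_bilin _ _)) (tliftE hb).
by rewrite (linZ (dual_linear f)) /dual_pair mulrC.
Qed.

Lemma dual_mul1r : left_id dual_one dual_mul.
Proof.
move=> f; apply: dual_ext => c /=.
rewrite -[in RHS](counitr c); move: (comul c).
have hb := bil_scaler C (@counit_linear _ C).
apply: tens_ext.
- exact: tlift_linear (dual_pair_bilin _ _).
- exact: lin_comp (dual_linear f) (tlift_linear hb).
move=> x y; rewrite (tliftE (dual_pair_bilin _ _)) (tliftE hb).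
by rewrite (linZ (dual_linear f)).
Qed.

Lemma dual_mulDl : left_distributive dual_mul dual_add.
Proof.
move=> f g h; apply: dual_ext => c /=; move: (comul c).
have hb := dual_pair_bilin.
have hs : linear (fun x => tlift (dual_pair f h) x + tlift (dual_pair g h) x).
  have := lin_comb 1 (tlift_linear (hb f h)) (tlift_linear (hb g h)).
  by under eq_fun do rewrite scale1r.
apply: (tens_ext (tlift_linear (hb _ _)) hs) => x y.
by rewrite !(tliftE (hb _ _)) /dual_pair /= mulrDl.
Qed.

Lemma dual_mulDr : right_distributive dual_mul dual_add.
Proof.
move=> f g h; apply: dual_ext => c /=; move: (comul c).
have hb := dual_pair_bilin.
have hs : linear (fun x => tlift (dual_pair f g) x + tlift (dual_pair f h) x).
  have := lin_comb 1 (tlift_linear (hb f g)) (tlift_linear (hb f h)).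
  by under eq_fun do rewrite scale1r.
apply: (tens_ext (tlift_linear (hb _ _)) hs) => x y.
by rewrite !(tliftE (hb _ _)) /dual_pair /= mulrDr.
Qed.

Definition dual_act (M : lmodType k) f (x : tensor C M) : M :=
  tlift (fun (c : C) (m : M) => f c *: m) x.

Lemma dual_act_bilin (M : lmodType k) f :
  bilin (fun (c : C) (m : M) => f c *: m).
Proof. exact: bil_scalel (dual_linear f). Qed.

Lemma dual_act_linear (M : lmodType k) f : linear (dual_act f (M := M)).
Proof. exact: tlift_linear (dual_act_bilin M f). Qed.

Lemma dual_actE (M : lmodType k) f c (m : M) :
  dual_act f (tens c m) = f c *: m.
Proof. exact: tliftE (dual_act_bilin M f) _ _. Qed.

Lemma dual_act_tmap (M N : lmodType k) f (u : M -> N) (x : tensor C M) :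
  linear u -> dual_act f (tmap id u x) = u (dual_act f x).
Proof.
move=> hu; move: x; have hid := lin_id (U := C); apply: tens_ext.
- exact: lin_comp (@dual_act_linear N f) (tmap_linear hid hu).
- exact: lin_comp hu (@dual_act_linear M f).
by move=> c m; rewrite tmapE // !dual_actE (linZ hu).
Qed.

Lemma dual_act_mul (M : lmodType k) f g (x : tensor C M) :
  dual_act g (tmap id (dual_act f (M := M)) (tassoc (tmap (@comul _ C) id x))) =
  dual_act (dual_mul f g) x.
Proof.
have hid (V : lmodType k) := lin_id (U := V); have hc := @comul_linear _ C.
have hf := @dual_act_linear M f; have hg := @dual_act_linear M g.
have hL := lin_comp (lin_comp hg (tmap_linear (hid C) hf)) (@tassoc_linear k C C M).
move: x; apply: tens_ext.
- exact: (lin_comp hL (tmap_linear hc (hid M))).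
- exact: dual_act_linear.
move=> c m; rewrite tmapE // dual_actE /=; move: (comul c) => y.
have h1 := lin_comp hL ((@tens_bilin k (tensor C C) M).1 m).
have h2 : linear (fun y => tlift (dual_pair f g) y *: m).
  move=> a u v; rewrite (tlift_linear (dual_pair_bilin f g)).
  by rewrite scalerDl scalerA.
move: y; apply: (tens_ext h1 h2) => u v.
rewrite tassocE tmapE // !dual_actE (tliftE (dual_pair_bilin f g)).
by rewrite scalerA /dual_pair mulrC.
Qed.

(* f m = f(m_(-1)) m_(0) *)
Definition comod_dot (M : comodule C) f (m : M) : M := dual_act f (coact m).

Lemma comod_dot_mul (M : comodule C) f g (m : M) :
  comod_dot (dual_mul f g) m = comod_dot f (comod_dot g m).
Proof.
have hid (V : lmodType k) := lin_id (U := V).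
have hM := @coact_linear _ _ M; have hf := @dual_act_linear M f.
rewrite /comod_dot -dual_act_mul coactA tmap_comp //.
by rewrite dual_act_tmap //; apply: lin_comp.
Qed.

Definition reg_comod : comodule C :=
  Comodule (@comul_linear _ C) (@comulA _ C) (@counitl _ C).

Lemma dual_mulE f g c : dual_mul f g c = f (comod_dot (M := reg_comod) g c).
Proof.
have hf := dual_linear f; rewrite /comod_dot /= -dual_act_tmap //.
move: (comul c); apply: tens_ext.
- exact: tlift_linear (dual_pair_bilin _ _).
- apply: lin_comp; first exact: dual_act_linear.
  by apply: tmap_linear => //; apply: lin_id.
move=> x y; rewrite (tliftE (dual_pair_bilin _ _)) tmapE // dual_actE.
by rewrite /dual_pair mulrC.
Qed.

Lemma dual_mulA : associative dual_mul.
Proof.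
move=> f g h; apply: dual_ext => c.
by rewrite dual_mulE comod_dot_mul -2!dual_mulE.
Qed.

HB.instance Definition _ := GRing.Zmodule_isPzRing.Build (dual C)
  dual_mulA dual_mul1r dual_mulr1 dual_mulDl dual_mulDr.

Lemma dual_const_linear a : linear (fun c : C => a * counit c : k^o).
Proof.
move=> b x y; rewrite (@counit_linear _ C) mulrDr.
by rewrite -[_ *: _]/(_ * _) mulrCA.
Qed.

Definition dual_const (a : k) : dual C := Dual (dual_const_linear a).

Lemma dual_const_dot (M : comodule C) a (m : M) :
  comod_dot (dual_const a) m = a *: m.
Proof.
rewrite -[in RHS](coact1 m) /comod_dot; move: (coact m).
have hb := bil_scalel M (@counit_linear _ C).
apply: tens_ext; first exact: dual_act_linear.
  apply: lin_comp (tlift_linear hb) => b x y.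
  by rewrite scalerDr !scalerA mulrC.
by move=> c x; rewrite (tliftE hb) dual_actE /= scalerA.
Qed.

Lemma dual_constC a f : dual_const a * f = f * dual_const a.
Proof.
apply: dual_ext => c.
rewrite -[LHS]/(dual_mul _ _ c) -[RHS]/(dual_mul _ _ c) !dual_mulE.
rewrite (dual_const_dot (M := reg_comod)) (linZ (dual_linear f)) /=.
congr (a * _).
by rewrite -[LHS]/(dual_one _) -dual_mulE dual_mul1r.
Qed.

Lemma dual_constD a b : dual_const (a + b) = dual_const a + dual_const b.
Proof. by apply: dual_ext => c /=; rewrite mulrDl. Qed.
Lemma dual_const1 : dual_const 1 = 1.
Proof. by apply: dual_ext => c /=; rewrite mul1r. Qed.
Lemma dual_constM a b : dual_const (a * b) = dual_const a * dual_const b.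
Proof.
apply: dual_ext => c; rewrite -[RHS]/(dual_mul _ _ c) dual_mulE.
rewrite (dual_const_dot (M := reg_comod)) /= (linZ (@counit_linear _ C)).
by rewrite -mulrA.
Qed.

End DualAlgebra.

Section Restriction.
Variables (k : fieldType) (C : coalgebra k).

Definition restr (M : lmodType (dual C)) : Type := M.
HB.instance Definition _ M := GRing.Zmodule.copy (restr M) M.

Variable M : lmodType (dual C).
Definition restr_scale (a : k) (x : restr M) : restr M :=
  dual_const C a *: (x : M).
Lemma restr_scaleA a b x :
  restr_scale a (restr_scale b x) = restr_scale (a * b) x.
Proof. by rewrite /restr_scale scalerA dual_constM. Qed.
Lemma restr_scale1 : left_id 1 restr_scale.
Proof. by move=> x; rewrite /restr_scale dual_const1 scale1r. Qed.
Lemma restr_scaleDr : right_distributive restr_scale +%R.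
Proof. by move=> a x y; rewrite /restr_scale scalerDr. Qed.
Lemma restr_scaleDl x : {morph restr_scale^~ x : a b / a + b}.
Proof. by move=> a b; rewrite /restr_scale dual_constD scalerDl. Qed.
HB.instance Definition _ := GRing.Zmodule_isLmodule.Build k (restr M)
  restr_scaleA restr_scale1 restr_scaleDr restr_scaleDl.
End Restriction.

Section ModuleCategory.
Variables (k : fieldType) (C : coalgebra k).
Local Notation module := (lmodType (dual C)).

Definition mod_hom (M N : module) (f : restr M -> restr N) : Prop :=
  linear (f : M -> N).

Lemma mod_hom_linear (M N : module) (f : restr M -> restr N) :
  mod_hom f -> linear f.
Proof. by move=> hf a x y; apply: hf. Qed.
Lemma mod_hom_id (M : module) : mod_hom (fun x : restr M => x).
Proof. by []. Qed.
Lemma mod_hom_comp (L M N : module) (g : restr M -> restr N)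
    (f : restr L -> restr M) :
  mod_hom g -> mod_hom f -> mod_hom (fun x => g (f x)).
Proof. by move=> hg hf a x y; rewrite hf hg. Qed.
Lemma mod_hom_zero (M N : module) : mod_hom (fun _ : restr M => 0 : restr N).
Proof. by move=> a x y; rewrite scaler0 addr0. Qed.
Lemma mod_hom_lincomb (M N : module) (a : k) (f g : restr M -> restr N) :
  mod_hom f -> mod_hom g -> mod_hom (fun x => a *: f x + g x).
Proof.
move=> hf hg b x y; rewrite hf hg scalerDr.
rewrite -![a *: _]/(dual_const C a *: (_ : N)).
rewrite !scalerDr !scalerA dual_constC -!addrA; congr (_ + _).
by rewrite addrCA.
Qed.

Definition zero_mod : module := 'rV[dual C]_0.
Lemma zero_mod_eq0 (x : restr zero_mod) : x = 0.
Proof. exact: thinmx0. Qed.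

Definition dsum_mod (M N : module) : module := (M * N)%type.
Lemma dsum_fst_mod (M N : module) :
  mod_hom (fst : restr (dsum_mod M N) -> restr M).
Proof. by []. Qed.
Lemma dsum_snd_mod (M N : module) :
  mod_hom (snd : restr (dsum_mod M N) -> restr N).
Proof. by []. Qed.
Lemma dsum_pair_mod (T M N : module) (f : restr T -> restr M)
    (g : restr T -> restr N) :
  mod_hom f -> mod_hom g ->
  mod_hom (fun t => (f t, g t) : restr (dsum_mod M N)).
Proof. by move=> hf hg a x y; rewrite hf hg. Qed.

Definition mod_cat : kcat k :=
  @KCat k module (fun M => restr M : lmodType k) mod_hom
    mod_hom_linear mod_hom_id mod_hom_comp mod_hom_zero
    mod_hom_lincomb zero_mod zero_mod_eq0 dsum_mod (fun _ _ m n => (m, n))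
    (fun _ _ => fst) (fun _ _ => snd) dsum_fst_mod dsum_snd_mod
    dsum_pair_mod (fun _ _ _ _ => erefl) (fun _ _ _ _ => erefl)
    (fun M N z => esym (surjective_pairing z)).
End ModuleCategory.

Section Upsilon.
Variables (k : fieldType) (C : coalgebra k).

Definition ups (M : comodule C) : Type := M.
HB.instance Definition _ M := GRing.Zmodule.copy (ups M) M.

Section Object.
Variable M : comodule C.
Definition ups_scale (f : dual C) (x : ups M) : ups M := comod_dot f (x : M).
Lemma ups_scaleA f g x : ups_scale f (ups_scale g x) = ups_scale (f * g) x.
Proof. by rewrite /ups_scale -comod_dot_mul. Qed.
Lemma ups_scale1 : left_id 1 ups_scale.
Proof. by move=> x; rewrite /ups_scale -[RHS](coact1 (x : M)). Qed.
Lemma ups_scaleDr : right_distributive ups_scale +%R.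
Proof.
move=> f x y; rewrite /ups_scale /comod_dot.
by rewrite (linD (@coact_linear _ _ M)) (linD (@dual_act_linear _ _ M f)).
Qed.
Lemma ups_scaleDl x : {morph ups_scale^~ x : f g / f + g}.
Proof.
move=> f g; rewrite /ups_scale /comod_dot /=; move: (coact _).
have h := @dual_act_linear k C M.
have hs : linear (fun z => dual_act f z + dual_act g z : M).
  have := lin_comb 1 (h f) (h g); by under eq_fun do rewrite scale1r.
by apply: (tens_ext (h _) hs) => c m; rewrite !dual_actE scalerDl.
Qed.
HB.instance Definition _ := GRing.Zmodule_isLmodule.Build (dual C) (ups M)
  ups_scaleA ups_scale1 ups_scaleDr ups_scaleDl.
End Object.

Definition ups_obj (M : comodule C) : lmodType (dual C) := ups M.

Lemma ups_mor (M N : comodule C) (f : M -> N) :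
  comod_hom f -> mod_hom (f : restr (ups_obj M) -> restr (ups_obj N)).
Proof.
move=> [hf cf] a x y; rewrite (linD hf); congr (_ + _).
rewrite -[LHS]/(f (dual_act a (coact x))) -[RHS]/(dual_act a (coact (f x))).
by rewrite cf dual_act_tmap.
Qed.

Lemma ups_lincomb (M N : comodule C) (a : k) (f g : M -> N) :
  (fun x => a *: f x + g x) =
  (fun x : restr (ups_obj M) =>
     a *: (f x : restr (ups_obj N)) + (g x : restr (ups_obj N))).
Proof.
apply: funext => x; congr (_ + _).
by rewrite -[RHS]/(comod_dot (dual_const C a) (f x)) dual_const_dot.
Qed.

Definition Upsilon : exact_functor (comod_cat C) (mod_cat C) :=
  @ExactFunctor k (comod_cat C) (mod_cat C) ups_obj
    (fun M N f => f) ups_mor (fun _ => erefl) (fun _ _ _ _ _ _ _ => erefl)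
    (fun M N a f g _ _ => ups_lincomb a f g)
    (fun _ _ S => inc_inj S) (fun _ _ S => prj_surj S)
    (fun _ _ S => ses_exact S).

Lemma Upsilon_triv (g : coaugmentation C) (f : dual C)
    (x : Upsilon (triv_comod g)) :
  f *: x = (f (g 1) : k) * (x : k^o).
Proof. exact: dual_actE. Qed.

End Upsilon.

(* Main.v *)
(** The vector space k has a minimal coresolution by finite copowers of C, both as a
left and as a right comodule: the first n terms are finite because Ext^i(k, k) is
finite-dimensional for i < n.  Right comodules are treated as left comodules over
the coopposite coalgebra.  Let Z be the n-th cosyzygy of the left comodule k, so
that Ext^n over C is the socle of Z, and let D be the n-th cosyzygy of the right
comodule k.  The dual of the right coresolution is a resolution of the left
C^*-module k by finitely generated free modules, with n-th syzygy D^*, so that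
Ext^n over C^* is Hom(D^*, k).

For j < n the j-th syzygy D_j^* is finitely generated, hence every homomorphism
D_j^* -> C is the evaluation at an element of D_j and extends to the preceding free
module.  Comparing the two resolutions step by step therefore identifies the socle
of D with the socle of Z, in such a way that the map between the Ext spaces becomes
the evaluation map soc D -> Hom(D^*, k); in particular it is injective.

Let L index a basis of soc D.  Restriction D^* -> k^L is surjective and gives an
embedding of the dual of k^L into Hom(D^*, k).  Conversely, products of
functionals on C dual to a basis of the socle of C / k, followed by functionals
dual to the basis of soc D, form a separating and locally finite family on D of
cardinality |L|, so that |D^*| = |k^L|.  Together with the Erdos-Kaplansky theorem
this determines the dimension of Hom(D^*, k), and the map is not surjective for
cardinality reasons. *)

From HB Require Import structures.
From Stdlib Require List Relation_Operators.
Require Import Defs.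
From mathcomp Require Import all_boot all_algebra.
From mathcomp Require Import boolp classical_sets functions cardinality.

Set Implicit Arguments.
Unset Strict Implicit.
Unset Printing Implicit Defensive.
Import GRing.Theory.

(** The obstacle is that [Upsilon] need not preserve injective objects, so that the cofree
    coresolution of k does not by itself compute Ext over C^*. Projective modules come from the
    other side: the linear dual of a right comodule is a left C^*-module, and the dual of C is free
    of rank one. The two resolutions can be compared because C need not be injective among all
    modules; it is enough that maps into C extend along the dual resolution, and this is where
    finite generation of the earlier syzygies enters. Minimality makes both Ext spaces equal to Hom
    spaces, without passing to a quotient: the maps that would give trivial extensions are already
    zero. At degree n the socle of D is infinite-dimensional, so that a homomorphism D^* -> k need
    no longer be the evaluation at an element of soc D; this is the source of the failure of
    surjectivity. Cardinals are compared by injections between types, because the dimension of an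
    Ext space is given by an index type. *)

Local Notation "f |> x" := (comod_dot f x) (at level 35, right associativity).

(** * Cardinal arithmetic *)

Section Cardinals.
Local Open Scope classical_set_scope.
Local Open Scope card_scope.

Definition embeds (X Y : Type) : Prop := exists f : X -> Y, injective f.

Lemma embeds_refl X : embeds X X.
Proof. by exists id. Qed.

Lemma embeds_trans Y X Z : embeds X Y -> embeds Y Z -> embeds X Z.
Proof. by move=> [f fi] [h hi]; exists (h \o f); apply: inj_comp. Qed.

Lemma embedsP X Y : [set: X] #<= [set: Y] <-> embeds X Y.
Proof.
split=> [/card_leP[f]|[f fi]].
  exists (fun x => val (f (SigSub (mem_set (I : [set: X] x))))) => x y.
  by move=> /val_inj /('inj_f (mem_setT _) (mem_setT _)) /(congr1 val).
(* [pcard_injP] is about a pointed codomain; if [Y] is empty, so is [X]. *)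
elim/Ppointed: Y => Y in f fi *; last by apply/pcard_injP; exists f => x y _ _; apply: fi.
have -> : [set: X] = set0 by rewrite -subset0 => x _; have := I : [set: Y] (f x); rewrite empty_eq0.
exact: card_ge0.
Qed.

Lemma embeds_bij X Y : embeds X Y -> embeds Y X -> exists f : X -> Y, bijective f.
Proof.
move=> /embedsP h1 /embedsP h2; have /card_bijP[f [h fh hf]] := Cantor_Bernstein h1 h2.
pose i (x : X) : [set: X] := SigSub (mem_set (I : [set: X] x)).
pose j (x : Y) : [set: Y] := SigSub (mem_set (I : [set: Y] x)).
exists (fun x => val (f (i x))), (fun y => val (h (j y))) => x.
  by rewrite (_ : j _ = f (i x)) ?fh//; apply: val_inj.
by rewrite (_ : i _ = h (j x)) ?hf//; apply: val_inj.
Qed.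

Lemma embeds_surj (X Y : Type) (f : X -> Y) : (forall y, exists x, f x = y) -> embeds Y X.
Proof. by move=> /choice[h fh]; exists h => x y /(congr1 f); rewrite !fh. Qed.

Lemma embeds_prod X X' Y Y' : embeds X X' -> embeds Y Y' -> embeds (X * Y) (X' * Y').
Proof.
by move=> [f fi] [h hi]; exists (fun p => (f p.1, h p.2)) => -[a b] [c d] [] /fi -> /hi ->.
Qed.

Lemma embeds_seq X Y : embeds X Y -> embeds (seq X) (seq Y).
Proof. by move=> [f fi]; exists (map f); apply: inj_map. Qed.

(** A function on [X] is carried along the injection and given the default value [z] off its
    image. *)
Lemma embeds_fun_dom X Y Z : Z -> embeds X Y -> embeds (X -> Z) (Y -> Z).
Proof.
move=> z [f fi]; have h y : exists t : option X, forall x, f x = y -> t = Some x.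
  have [[x <-]|N] := pselect (exists x, f x = y); last by exists None => x e; case: N; exists x.
  by exists (Some x) => x' /fi ->.
have [p pP] := choice h.
exists (fun s y => if p y is Some x then s x else z) => s s' e.
by apply/funext => x; have := congr1 (@^~ (f x)) e; rewrite (pP _ x).
Qed.

(** Diagonal argument: for an injection [h], the function [d] has the value [b] at [h s] exactly
    when [s] has the value [a] there, and the value [a] otherwise; at [h d] this is absurd. *)
Lemma Cantor_embeds X Z (a b : Z) : a <> b -> ~ embeds (X -> Z) X.
Proof.
move=> ab [h hi].
have D x : exists z, (z = b <-> exists2 s, h s = x & s x = a) /\ (z = a \/ z = b).
  have [e|N] := pselect (exists2 s, h s = x & s x = a); first by exists b; split; [|right].
  by exists a; split; [split=> // /ab|left].
have [d dP] := choice D; have [[E1 E2] E3] := dP (h d).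
have Nb : d (h d) <> b.
  by move=> e; have [s /hi -> e'] := E1 e; apply: ab; rewrite -e'.
by case: E3 => [e|//]; apply: Nb; apply: E2; exists d.
Qed.

(** Zorn's lemma for graphs of partial injections: a maximal one that is neither total nor onto
    could be enlarged by one pair. *)
Lemma embeds_total X Y : embeds X Y \/ embeds Y X.
Proof.
pose P (G : set (X * Y)) := forall p q, G p -> G q -> p.1 = q.1 <-> p.2 = q.2.
have [|G [PG maxG]] := @Zorn_bigcup _ P.
  move=> F FP tot p q [G FG Gp] [H FH Hq].
  have [S|S] := tot _ _ FG FH; [apply: (FP _ FH)|apply: (FP _ FG)] => //; exact: S.
have [dom|/existsNP[x Nx]] := pselect (forall x, exists y, G (x, y)).
  left; have [f fP] := choice dom; exists f => x x' e.
  exact/(PG _ _ (fP x) (fP x')).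
have [ran|/existsNP[y Ny]] := pselect (forall y, exists x, G (x, y)).
  right; have [f fP] := choice ran; exists f => y y' e.
  exact/(PG _ _ (fP y) (fP y')).
case: (maxG (G `|` [set (x, y)])); last first.
  move=> [p1 p2] [q1 q2] [Gp|[-> ->]] [Gq|[-> ->]] //=; first exact: (PG _ _ Gp Gq).
    by split=> e; [case: Nx; exists p2; rewrite -e|case: Ny; exists p1; rewrite -e].
  by split=> e; [case: Nx; exists q2; rewrite e|case: Ny; exists q1; rewrite e].
split; first by move=> p Gp; left.
by move=> /(_ (x, y) (or_intror erefl)) Gxy; apply: Nx; exists y.
Qed.

Definition infinite (X : Type) : Prop := embeds nat X.

(** Doubles the domain of a squaring. The three new blocks all go to the right copy of [T], kept
    apart by the tags [e 0], [e 1], [e 2], so that [M] restricts to [m] on the left copy. *)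
Lemma infinite_sum_square (T : Type) (m : T * T -> T) (e : nat -> T) :
  injective m -> injective e ->
  exists2 M : (T + T) * (T + T) -> T + T, injective M &
    forall a b, M (inl a, inl b) = inl (m (a, b)).
Proof.
move=> mi ei.
pose M (p : (T + T) * (T + T)) : T + T := match p with
  | (inl a, inl b) => inl (m (a, b))
  | (inl a, inr b) => inr (m (e 0, m (a, b)))
  | (inr a, inl b) => inr (m (e 1, m (a, b)))
  | (inr a, inr b) => inr (m (e 2, m (a, b)))
  end.
exists M => // -[[a|a] [b|b]] [[c|c] [d|d]] //= [] /mi [] //.
all: try by move=> -> ->.
all: try by move=> /ei.
all: by move=> /mi [-> ->].
Qed.

(* A maximal partial squaring is defined on a set S such that the complement of
   S does not contain a copy of S, so that |A| <= |S| + |S|. *)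
Lemma embeds_square A : infinite A -> embeds (A * A) A.
Proof.
move=> [e ei]; have [c ci] : embeds (nat * nat) nat.
  by exists choice.pickle; apply: pcan_inj choice.pickleK.
pose T3 := (A * A * A)%type.
pose dom (G : set T3) x := exists z, G (x, x, z).
pose G0 : set T3 := fun t => exists i j, t = (e i, e j, e (c (i, j))).
(* [sq G] says that [G] is the graph of an injection of S x S into S, where S consists of the x such
   that (x, x) is in the domain of [G]. *)
pose sq (G : set T3) := [/\ forall p z z', G (p, z) -> G (p, z') -> z = z',
   forall p p' z, G (p, z) -> G (p', z) -> p = p',
   forall x y, dom G x -> dom G y -> exists z, G (x, y, z) &
   forall x y z, G (x, y, z) -> [/\ dom G x, dom G y & dom G z]].
have sq0 : sq G0.
  split=> [[x y] z z' [i [j [-> -> ->]]] [i' [j' [/ei -> /ei -> ->]]] //|||].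
  - move=> [x y] [x' y'] z [i [j [-> -> ->]]] [i' [j' [-> ->]]].
    by move=> /ei/ci[-> ->].
  - move=> x y [z [i [j [-> _ _]]]] [z' [i' [j' [-> _ _]]]].
    by exists (e (c (i, i'))), i, i'.
  have d i : dom G0 (e i) by exists (e (c (i, i))), i, i.
  by move=> x y z [i [j [-> -> ->]]].
have [|G [[G1 sG] maxG]] := @Zorn_bigcup _ (fun G => (G = set0 \/ G0 `<=` G) /\ sq G).
  move=> F FP tot.
  have two p q G H : F G -> F H -> G p -> H q -> exists K, [/\ F K, K p & K q].
    move=> FG FH Gp Hq; have [S|S] := tot _ _ FG FH; [exists H|exists G]; split=> //; exact: S.
  split.
    have [[G FG GG]|N] := pselect (exists2 G, F G & G0 `<=` G).
      by right=> t /GG Gt; exists G.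
    left; rewrite -subset0 => t [G FG Gt].
    by have [[E|S] _] := FP _ FG; [rewrite E in Gt|case: N; exists G].
  have up G x : F G -> dom G x -> dom (\bigcup_(X in F) X) x.
    by move=> FG [z Gz]; exists z, G.
  split.
  - move=> p z z' [G FG Gz] [H FH Hz]; have [K [FK Kp Kq]] := two _ _ _ _ FG FH Gz Hz.
    by have [_ [h _ _ _]] := FP _ FK; apply: h Kp Kq.
  - move=> p p' z [G FG Gz] [H FH Hz]; have [K [FK Kp Kq]] := two _ _ _ _ FG FH Gz Hz.
    by have [_ [_ h _ _]] := FP _ FK; apply: h Kp Kq.
  - move=> x y [z [G FG Gz]] [z' [H FH Hz]].
    have [K [FK Kp Kq]] := two _ _ _ _ FG FH Gz Hz.
    have [_ [_ _ h _]] := FP _ FK.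
    by have [t Kt] := h x y (ex_intro _ _ Kp) (ex_intro _ _ Kq); exists t, K.
  - move=> x y z [G FG Gz]; have [_ [_ _ _ h]] := FP _ FG.
    by have [? ? ?] := h _ _ _ Gz; split; apply: up FG _.
have {}G1 : G0 `<=` G.
  case: G1 => // E; case: (maxG G0); last by split; [right|].
  by rewrite E; split=> [//|/(_ (e 0, e 0, e (c (0, 0))))]; apply; exists 0, 0.
case: sG => Gfun Ginj Gtot Gdom.
pose S := {x | dom G x}.
have mP (p : S * S) : exists z : S, G (sval p.1, sval p.2, sval z).
  case: p => [[x dx] [y dy]] /=; have [z Gz] := Gtot x y dx dy.
  by have [_ _ dz] := Gdom _ _ _ Gz; exists (exist _ z dz).
have [m mE] := choice mP.
have vi (P : A -> Prop) : injective (@sval A P) by move=> [x hx] [y hy] /= E; apply: eq_exist.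
have mi : injective m.
  move=> [a b] [a' b'] E; have := mE (a, b); rewrite E.
  by move=> /Ginj/(_ (mE (a', b'))) [] /= /(@vi _ _ _) -> /(@vi _ _ _) ->.
have de i : dom G (e i) by exists (e (c (i, i))); apply: G1; exists i, i.
pose s i : S := exist _ (e i) (de i).
have si : injective s by move=> i j [] /ei.
(* If the complement embeds into [S], the tags [s 0] and [s 1] embed [A] into [S]. Otherwise [S] has
   a second copy in its complement, and [infinite_sum_square] extends the squaring to both copies,
   against maximality. *)
have [[j ji]|[j ji]] := embeds_total S {x | ~ dom G x}; last first.
  have AS : embeds A S.
    have aP x : exists z : S, (exists dx : dom G x, z = m (s 0, exist _ x dx)) \/
                            (exists nx : ~ dom G x, z = m (s 1, j (exist _ x nx))).
      have [dx|nx] := pselect (dom G x); first by exists (m (s 0, exist _ x dx)); left; exists dx.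
      by exists (m (s 1, j (exist _ x nx))); right; exists nx.
    have [f fP] := choice aP; exists f => x y E.
    move: (fP x) (fP y) E => [[dx ->]|[dx ->]] [[dy ->]|[dy ->]] /mi [] //.
    - by move=> /ei.
    - by move=> /ei.
    by move=> /ji [].
  apply: embeds_trans (embeds_prod AS AS) _.
  by exists (@sval _ _ \o m); apply: inj_comp (@vi _) mi.
have [M Mi ME] := infinite_sum_square mi si.
pose f (t : S + S) : A := match t with inl a => sval a | inr a => sval (j a) end.
have fi : injective f.
  move=> [a|a] [b|b] /= E.
  - by congr inl; apply: vi.
  - by case: (svalP (j b)); rewrite -E; apply: svalP.
  - by case: (svalP (j a)); rewrite E; apply: svalP.
  - by congr inr; apply: ji; apply: vi.
pose G' : set T3 := fun t => exists p q, t = (f p, f q, f (M (p, q))).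
have GG' : G `<=` G'.
  move=> [[x y] z] Gz; have [dx dy dz] := Gdom _ _ _ Gz.
  exists (inl (exist _ x dx)), (inl (exist _ y dy)); rewrite ME /=.
  by congr (_, _); apply: Gfun Gz (mE (exist _ x dx, exist _ y dy)).
case: (maxG G').
  split=> // h; have : G (f (inr (s 0)), f (inr (s 0)), f (M (inr (s 0), inr (s 0)))).
    by apply: h; exists (inr (s 0)), (inr (s 0)).
  by case/Gdom=> /= d _ _; apply: (svalP (j (s 0))).
split; first by right; apply: subset_trans G1 GG'.
split.
- by move=> [x y] z z' [p [q [-> -> ->]]] [p' [q' [/fi -> /fi -> ->]]].
- by move=> [x y] [x' y'] z [p [q [-> -> ->]]] [p' [q' [-> -> /fi/Mi[-> ->]]]].
- move=> x y [z [p [q [-> _ _]]]] [z' [p' [q' [-> _ _]]]].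
  by exists (f (M (p, p'))), p, p'.
- have d p : dom G' (f p) by exists (f (M (p, p))), p, p.
  by move=> x y z [p [q [-> -> ->]]].
Qed.

(** The code of a list includes its length, since the iterated pairing of the entries does not show
    where the list ends. *)
Lemma embeds_seq_infinite A : infinite A -> embeds (seq A) A.
Proof.
move=> iA; have [p pi] := embeds_square iA; have [e ei] := iA.
exists (fun s => p (e (size s), foldr (fun x y => p (x, y)) (e 0) s)) => s t /pi [] /ei.
elim: s t => [|x s IH] [|y t] //= [] /IH h /pi [-> /h ->] //.
Qed.

Lemma embeds_seq_prod X Y A : infinite A -> embeds X A -> embeds Y A ->
  embeds (seq (X * Y)) A.
Proof.
move=> iA XA YA; apply: embeds_trans (embeds_seq_infinite iA); apply: embeds_seq.
exact: embeds_trans (embeds_prod XA YA) (embeds_square iA).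
Qed.

Lemma finite_or_infinite X : infinite X \/ exists m (f : 'I_m -> X), bijective f.
Proof.
have [iX|fX] := pselect (infinite_set [set: X]); first by left; apply/embedsP/infiniteP.
right; move/contrapT: fX => /finite_setP[m /card_esym/card_bijP[f [h fh hf]]].
pose i (x : X) : [set: X] := SigSub (mem_set (I : [set: X] x)).
exists m, (fun o : 'I_m => val (f (SigSub (mem_set (ltn_ord o : `I_m o))))).
exists (fun x => Ordinal (set_mem (valP (h (i x))) : (val (h (i x)) < m)%N)) => x.
  apply: val_inj => /=; rewrite (_ : i _ = f (SigSub (mem_set (ltn_ord x : `I_m x)))) ?fh //.
  exact: val_inj.
rewrite (_ : SigSub _ = h (i x)) ?hf//; exact: val_inj.
Qed.

End Cardinals.

(** * Linear algebra *)

Section LinearExtension.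
Local Open Scope ring_scope.
Local Open Scope classical_set_scope.
Variables (k : fieldType) (V W : lmodType k).

Definition subspace (U : lmodType k) (S : U -> Prop) : Prop :=
  S 0 /\ forall a x y, S x -> S y -> S (a *: x + y).

Lemma subspaceD (U : lmodType k) (S : U -> Prop) x y :
  subspace S -> S x -> S y -> S (x + y).
Proof. by move=> [S0 SL] Sx Sy; rewrite -[x]scale1r; apply: SL. Qed.

Lemma subspaceZ (U : lmodType k) (S : U -> Prop) a x : subspace S -> S x -> S (a *: x).
Proof. by move=> [S0 SL] Sx; rewrite -[_ *: _]addr0; apply: SL. Qed.

(** A partial linear map is given by its graph, so that one use of Zorn's lemma serves for extension
    along injections, separation by functionals, maps prescribed on a free family, and factorization
    through a surjection. *)
Lemma linear_relation_extend (G : V * W -> Prop) :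
  subspace G -> (forall w, G (0, w) -> w = 0) ->
  exists2 F : V -> W, linear F & forall v w, G (v, w) -> F v = w.
Proof.
(* Only the union of [G] and [H] is constrained, not [H], so that the union of the empty chain is
   admissible. *)
move=> [G0 GL] Gf; pose P (H : set (V * W)) :=
  (forall a p q, (G `|` H) p -> (G `|` H) q -> (G `|` H) (a *: p + q)) /\
  (forall w, (G `|` H) (0, w) -> w = 0).
have P0 : P set0 by rewrite /P setU0.
have [|H [[HL Hf] maxH]] := @Zorn_bigcup _ P.
  move=> F FP tot; have two p q : (G `|` \bigcup_(X in F) X) p -> (G `|` \bigcup_(X in F) X) q ->
      exists K, [/\ P K, (G `|` K) p, (G `|` K) q & K `<=` \bigcup_(X in F) X].
    move=> [Gp|[X FX Xp]] [Gq|[Y FY Yq]].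
    - by exists set0; split=> //; left.
    - by exists Y; split; [apply: FP|left|right|move=> t Yt; exists Y].
    - by exists X; split; [apply: FP|right|left|move=> t Xt; exists X].
    have [S|S] := tot _ _ FX FY; [exists Y|exists X].
      by split; [apply: FP|right; apply: S|right|move=> t Yt; exists Y].
    by split; [apply: FP|right|right; apply: S|move=> t Xt; exists X].
  split=> [a p q hp hq|w hw].
    have [K [[KL _] Kp Kq KF]] := two _ _ hp hq.
    by case: (KL a p q Kp Kq) => h; [left|right; apply: KF].
  by have [K [[_ Kf] Kp _ _]] := two _ _ hw hw; apply: Kf.
set R := G `|` H in HL Hf.
have R0 : R 0 by left.
have RZ a p : R p -> R (a *: p) by move=> Rp; rewrite -[_ *: _]addr0; apply: HL.
have dom x : exists w, R (x, w).
  apply: contrapT => Nx; pose R' : set (V * W) := fun p => exists q a, R q /\ p = a *: (x, 0) + q.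
  have RR' : R `<=` R' by move=> p Rp; exists p, 0; rewrite scale0r add0r.
  case: (maxH R').
    split; first by move=> p Hp; apply: RR'; right.
    move=> h; apply: Nx; exists 0; right; apply: h; exists 0, 1; split=> //.
    by rewrite scale1r addr0.
  have GR' : G `|` R' = R' by apply/seteqP; split=> [p [Gp|//]|p]; [apply: RR'; left|right].
  rewrite /P GR'; split=> [a p q [p1 [b [Rp ->]]] [q1 [c [Rq ->]]]|w [[q1 q2] [a [Rq []]]]].
    exists (a *: p1 + q1), (a * b + c); split; first exact: HL.
    by rewrite scalerDr scalerDl scalerA addrACA.
  rewrite scaler0 add0r => e1 ->; have [a0|a0] := eqVneq a 0.
    by apply: Hf; rewrite e1 a0 scale0r add0r.
  case: Nx; exists (- a^-1 *: q2); have := RZ (- a^-1) _ Rq.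
  congr R; congr (_, _); move/esym/eqP: e1; rewrite addr_eq0 => /eqP e1.
  by rewrite -[q1]opprK -e1 scaleNr scalerN opprK scalerA mulVf ?scale1r.
have [F FR] := choice dom; have Funiq v w : R (v, w) -> F v = w.
  move=> Rw; apply/eqP; rewrite -subr_eq0; apply/eqP; apply: Hf.
  have := HL (-1) _ _ Rw (FR v); congr R.
  by rewrite scaleN1r; congr (_, _); rewrite /= (addNr, addrC).
exists F => [a x y|v w Gw]; last by apply: Funiq; left.
by apply: Funiq; apply: HL (FR x) (FR y).
Qed.

End LinearExtension.

Section Functionals.
Local Open Scope ring_scope.
Variable k : fieldType.

Lemma linear_extend (U V W : lmodType k) (i : U -> V) (f : U -> W) :
  linear i -> injective i -> linear f ->
  exists2 F : V -> W, linear F & forall u, F (i u) = f u.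
Proof.
move=> hi ii hf; have [||F hF FE] :=
    @linear_relation_extend k V W (fun p => exists u, p = (i u, f u)).
- split; first by exists 0; rewrite (lin0 hi) (lin0 hf).
  by move=> a _ _ [u ->] [v ->]; exists (a *: u + v); rewrite hi hf.
- by move=> w [u [e ->]]; have -> : u = 0; [apply: ii; rewrite -e (lin0 hi)|rewrite (lin0 hf)].
by exists F => // u; apply: FE; exists u.
Qed.

(** The relation to be extended is the graph of the functional on S + kx that is 0 on [S] and 1 at
    [x]; it is single-valued because [x] is not in [S]. *)
Lemma functional_off (V : lmodType k) (S : V -> Prop) x : subspace S -> ~ S x ->
  exists2 f : V -> k^o, linear f & (forall y, S y -> f y = 0) /\ f x = 1.
Proof.
move=> sS Nx; have [S0 SL] := sS.
have [||F hF FE] :=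
    @linear_relation_extend k V k^o (fun p => S (p.1 - (p.2 : k) *: x)).
- split=> [|a [u b] [v c] /= Su Sv]; first by rewrite /= scale0r subrr.
  have -> : a *: u + v - (a * b + c) *: x = a *: (u - b *: x) + (v - c *: x).
    by rewrite scalerBr scalerDl scalerA opprD addrACA.
  exact: SL.
- move=> a /= Sa; have [//|a0] := eqVneq a 0; case: Nx.
  have := subspaceZ (- a^-1) sS Sa.
  by rewrite sub0r scalerN scaleNr opprK scalerA mulVf // scale1r.
exists F => //; split=> [y Sy|]; apply: FE => /=; first by rewrite scale0r subr0.
by rewrite scale1r subrr.
Qed.

Lemma functional_sep (V : lmodType k) (x : V) :
  (forall f : V -> k^o, linear f -> f x = 0) -> x = 0.
Proof.
move=> h; apply: contrapT => x0; have [||f hf [_ f1]] := @functional_off V (fun y => y = 0) x.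
- by split=> // a _ _ -> ->; rewrite scaler0 addr0.
- by [].
by have := h f hf; rewrite f1 => /eqP; rewrite oner_eq0.
Qed.

Lemma functional_eq (V : lmodType k) (x y : V) :
  (forall f : V -> k^o, linear f -> f x = f y) -> x = y.
Proof.
move=> h; apply/eqP; rewrite -subr_eq0; apply/eqP; apply: functional_sep => f hf.
by rewrite (linB hf) h // subrr.
Qed.

Definition contract (V W : lmodType k) (f : V -> k^o) : tensor V W -> W :=
  tlift (fun v w => (f v : k) *: w).

Section Contract.
Variables V W : lmodType k.

Lemma contract_linear (f : V -> k^o) : linear f -> linear (contract (W := W) f).
Proof. by move=> hf; apply: tlift_linear (bil_scalel W hf). Qed.

Lemma contractE (f : V -> k^o) v (w : W) : linear f -> contract f (tens v w) = (f v : k) *: w.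
Proof. by move=> hf; apply: tliftE (bil_scalel W hf) _ _. Qed.

(** Induction on the number of pure tensors. If the first left factor is a combination of the
    others, its term is absorbed by them; otherwise a functional with value 1 there and 0 on the
    others shows that the first right factor vanishes. *)
Lemma tens_sep (z : tensor V W) :
  (forall f : V -> k^o, linear f -> contract f z = 0) -> z = 0.
Proof.
elim/tens_ind1: z => s; rewrite tclsE.
suff gen n (v : nat -> V) (w : nat -> W) :
    (forall f : V -> k^o, linear f -> contract f (\sum_(i < n) tens (v i) (w i)) = 0) ->
    \sum_(i < n) tens (v i) (w i) = 0.
  have -> : \sum_(p <- s) tens p.1 p.2 = \sum_(i < size s) tens (nth 0 s i).1 (nth 0 s i).2.
    by rewrite (big_nth 0) big_mkord.
  exact: (gen (size s) (fun i => (nth 0 s i).1) (fun i => (nth 0 s i).2)).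
elim: n v w => [|n IH] v w h; first by rewrite big_ord0.
pose S x := exists c : nat -> k, x = \sum_(i < n) c i *: v i.+1.
have sS : subspace S.
  split; first by exists (fun=> 0); rewrite big1 // => i _; rewrite scale0r.
  move=> a _ _ [b ->] [c ->]; exists (fun i => a * b i + c i).
  by rewrite scaler_sumr -big_split; apply: eq_bigr => i _; rewrite scalerDl scalerA.
have [[c vc]|/(functional_off sS)[f hf [f0 f1]]] := pselect (S (v 0)).
  have E : \sum_(i < n.+1) tens (v i) (w i) =
      \sum_(i < n) tens (v i.+1) (c i *: w 0 + w i.+1).
    rewrite big_ord_recl /= vc (linS ((@tens_bilin k V W).1 (w 0))) -big_split.
    by apply: eq_bigr => i _ /=; rewrite tensDr tensZl tensZr.
  rewrite E; apply: (IH (fun i => v i.+1) (fun i => c i *: w 0 + w i.+1)) => f hf.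
  by rewrite -E; apply: h.
have w0 : w 0 = 0.
  have := h f hf; rewrite (linS (contract_linear hf)) big_ord_recl contractE // f1 scale1r.
  rewrite big1 ?addr0 // => i _; rewrite contractE // f0 ?scale0r //.
  exists (fun j => (j == i :> nat)%:R); rewrite (bigD1 i) //= eqxx scale1r.
  rewrite big1 ?addr0 // => j /negPf.
  by rewrite -val_eqE /= => ->; rewrite scale0r.
move: h; rewrite big_ord_recl w0 (lin0 ((@tens_bilin k V W).2 _)) add0r => h.
exact: (IH (fun i => v i.+1) (fun i => w i.+1)).
Qed.

Lemma tens_eq (z z' : tensor V W) :
  (forall f : V -> k^o, linear f -> contract f z = contract f z') -> z = z'.
Proof.
move=> h; apply/eqP; rewrite -subr_eq0; apply/eqP; apply: tens_sep => f hf.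
by rewrite (linB (contract_linear hf)) h // subrr.
Qed.

End Contract.

Lemma contract_tmap (V W V' W' : lmodType k) (f : V' -> k^o) (g : V -> V') (h : W -> W') z :
  linear f -> linear g -> linear h ->
  contract f (tmap g h z) = h (contract (fun v => f (g v)) z).
Proof.
move=> hf hg hh; move: z; have hfg := lin_comp hf hg; apply: tens_ext.
- exact: lin_comp (contract_linear hf) (tmap_linear hg hh).
- exact: lin_comp hh (contract_linear hfg).
by move=> v w; rewrite tmapE // !contractE // (linZ hh).
Qed.


End Functionals.

Section Families.
Local Open Scope ring_scope.
Local Open Scope classical_set_scope.
Variable k : fieldType.

Definition comb (I : Type) (V : lmodType k) (e : I -> V) (s : seq (k * I)) : V :=
  \sum_(p <- s) p.1 *: e p.2.

(** Lists may repeat indices, so that they are added by concatenation without normalization; hence a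
    coefficient is a sum over occurrences. *)
Definition coef (I : Type) (s : seq (k * I)) (i : I) : k :=
  \sum_(p <- s | `[< p.2 = i >]) p.1.

Definition free_family (I : Type) (V : lmodType k) (e : I -> V) : Prop :=
  forall s, comb e s = 0 -> forall i, coef s i = 0.

Definition spans (I : Type) (V : lmodType k) (e : I -> V) (S : V -> Prop) : Prop :=
  forall x, S x -> exists s, x = comb e s.

Section Comb.
Variables (I : Type) (V : lmodType k).
Implicit Types (e : I -> V) (s : seq (k * I)).

Lemma comb_cat e s t : comb e (s ++ t) = comb e s + comb e t.
Proof. exact: big_cat. Qed.

Lemma comb_scale e a s : comb e [seq (a * p.1, p.2) | p <- s] = a *: comb e s.
Proof.
by rewrite /comb big_map scaler_sumr; apply: eq_bigr => p _; rewrite scalerA.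
Qed.

Lemma comb1 e a i : comb e [:: (a, i)] = a *: e i.
Proof. exact: big_seq1. Qed.

Lemma comb_linear (W : lmodType k) (f : V -> W) e s :
  linear f -> f (comb e s) = comb (fun i => f (e i)) s.
Proof.
by move=> hf; rewrite (linS hf); apply: eq_bigr => p _; rewrite (linZ hf).
Qed.

Lemma combD e s i : comb e s =
  coef s i *: e i + comb e [seq p <- s | ~~ `[< p.2 = i >]].
Proof.
rewrite /comb (bigID (fun p => `[< p.2 = i >])) /= big_filter scaler_suml.
by congr (_ + _); apply: eq_bigr => p /asboolP ->.
Qed.

Lemma coef_filter (P : pred I) s i :
  coef [seq p <- s | P p.2] i = if P i then coef s i else 0.
Proof.
rewrite /coef big_filter_cond; case: ifP => Pi.
  apply: eq_bigl => p; rewrite andb_idl // => /asboolP ->; exact: Pi.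
by rewrite big1 // => p /andP[Pp /asboolP e]; rewrite -e Pp in Pi.
Qed.

Lemma comb_coef0 e s : (forall i, coef s i = 0) -> comb e s = 0.
Proof.
have [n] := ubnP (size s); elim: n s => // n IH [|[a i] s] hs h; first by rewrite /comb big_nil.
rewrite (combD e _ i) h scale0r add0r; apply: IH => [|j].
  rewrite /= asboolT //= size_filter; apply: leq_ltn_trans (count_size _ _) _.
  by rewrite -ltnS.
by rewrite (coef_filter (fun j => ~~ `[< j = i >])) h if_same.
Qed.

Lemma span_subspace e : subspace (fun x => exists s, x = comb e s).
Proof.
split; first by exists [::]; rewrite /comb big_nil.
move=> a _ _ [s ->] [t ->]; exists ([seq (a * p.1, p.2) | p <- s] ++ t).
by rewrite comb_cat comb_scale.
Qed.

End Comb.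

Section Free.
Variables (I : Type) (V : lmodType k).
Implicit Types (e : I -> V) (s : seq (k * I)).

Lemma free_extend (W : lmodType k) e (g : I -> W) : free_family e ->
  exists2 f : V -> W, linear f & forall i, f (e i) = g i.
Proof.
move=> fe; have [||F hF FE] := @linear_relation_extend k V W
   (fun p => exists s, p = (comb e s, comb g s)).
- split; first by exists [::]; rewrite /comb !big_nil.
  move=> a _ _ [s ->] [t ->]; exists ([seq (a * p.1, p.2) | p <- s] ++ t).
  by congr (_, _); rewrite comb_cat comb_scale.
- by move=> w [s [/esym/fe h ->]]; apply: comb_coef0.
by exists F => // i; apply: FE; exists [:: (1, i)]; rewrite !comb1 !scale1r.
Qed.

Lemma free_coord e : free_family e -> exists f : I -> V -> k^o,
  [/\ forall i, linear (f i), forall i j, f i (e j) = (`[< j = i >])%:R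
    & forall i s, f i (comb e s) = coef s i].
Proof.
move=> fe; have /choice[f fP] i : exists f : V -> k^o,
    linear f /\ forall j, f (e j) = (`[< j = i >])%:R.
  by have [f hf fE] := free_extend (fun j => (`[< j = i >])%:R : k^o) fe; exists f.
exists f; split=> [i|i|i s]; [by case: (fP i)|by case: (fP i)|].
have [hf fE] := fP i; rewrite (comb_linear _ _ hf) /comb /coef [RHS]big_mkcond.
by apply: eq_bigr => p _; rewrite fE -[_ *: _]/(_ * _); case: asboolP; rewrite (mulr1, mulr0).
Qed.

Lemma free_dual e (f : I -> V -> k^o) : (forall i, linear (f i)) ->
  (forall i j, f i (e j) = (`[< j = i >])%:R) -> free_family e.
Proof.
move=> hf fE s h i; have <- : comb (fun j => f i (e j)) s = 0.
  by rewrite -(comb_linear e s (hf i)) h (lin0 (hf i)).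
rewrite /comb /coef [LHS]big_mkcond.
by apply: eq_bigr => p _; rewrite fE -[_ *: _]/(_ * _); case: asboolP; rewrite (mulr1, mulr0).
Qed.

Lemma free_inj e i j : free_family e -> e i = e j -> i = j.
Proof.
move=> /free_coord[f [_ fE _]] E; have := fE i i; rewrite E fE [in RHS]asboolT //.
by case: asboolP => [-> //|_ /eqP]; rewrite eq_sym oner_eq0.
Qed.

End Free.

(** Zorn's lemma is applied to sets of vectors added to the image of [e0]. The resulting set is its
    own index type, and [I0] embeds into it because a free family is injective. *)
Lemma basis_extend (V : lmodType k) (S : V -> Prop) (I0 : Type) (e0 : I0 -> V) :
  subspace S -> free_family e0 -> (forall i, S (e0 i)) ->
  exists (I : Type) (e : I -> V),
    [/\ free_family e, forall i, S (e i), spans e S & embeds I0 I].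
Proof.
move=> sS fe0 Se0; pose A : set V := fun x => exists i, e0 i = x.
pose fr (B : set V) := forall s, (forall p, List.In p s -> B p.2) ->
  comb id s = 0 -> forall v, coef s v = 0.
have frA : fr A.
  move=> s sA h v; have [t st] : exists t, s = [seq (p.1, e0 p.2) | p <- t].
    elim: s sA {h} => [|[a x] s IH] sA; first by exists [::].
    have [|t ->] := IH; first by move=> p ps; apply: sA; right.
    by have [i /= <-] := sA (a, x) (or_introl erefl); exists ((a, i) :: t).
  have [iv|N] := pselect (exists i, e0 i = v).
    have h' : forall i, coef t i = 0 by apply: fe0; rewrite -[RHS]h st /comb big_map.
    have [i <-] := iv; rewrite -(h' i) /coef st big_map; apply: eq_bigl => p.
    by apply/asboolP/asboolP => [/(free_inj fe0)|->].
  rewrite /coef st big_map big1 // => p /asboolP e; case: N; by exists p.2.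
pose P (B : set V) := fr (A `|` B) /\ B `<=` S.
have [|B [[frB BS] maxB]] := @Zorn_bigcup _ P.
  move=> F FP tot; split=> [s sB|x [X FX Xx]]; last by have [_ h] := FP _ FX; apply: h.
  suff [X [frX sX]] : exists X, fr (A `|` X) /\ (forall p, List.In p s -> (A `|` X) p.2).
    exact: frX.
  have [[X0 FX0]|F0] := pselect (exists X, F X); last first.
    exists set0; split; first by rewrite setU0.
    by move=> p /sB[|[X FX]]; [left|case: F0; exists X].
  suff [X FX sX] : exists2 X, F X & forall p, List.In p s -> (A `|` X) p.2.
    by exists X; split=> //; have [] := FP _ FX.
  elim: s sB => [|p s IH] sB; first by exists X0.
  have [|X FX sX] := IH; first by move=> q qs; apply: sB; right.
  have [Ap|[Y FY Yp]] := sB p (or_introl erefl).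
    by exists X => // q [<-|/sX //]; left.
  have [XY|YX] := tot _ _ FX FY.
    by exists Y => // q [<-|/sX[|/XY]]; [right|left|right].
  by exists X => // q [<-|/sX //]; right; apply: YX.
exists {x | (A `|` B) x}, sval; split.
- move=> s h i; have := frB [seq (p.1, sval p.2) | p <- s].
  rewrite /comb big_map => h'.
  have {}h' := h' _ h (sval i).
  rewrite -h' => [|p]; last first.
    elim: s {h h'} => [//|[a [y Ay]] s IH] /= [<- //|/IH //].
  rewrite /coef big_map; apply: eq_bigl => p.
  apply/asboolP/asboolP => [->//|]; case: (p.2) i {h'} => [x hx] [y hy] /= e; exact: eq_exist.
- by move=> [x /= [[i ix]|/BS //]]; rewrite -ix.
- move=> x Sx; apply: contrapT => Nx; case: (maxB (B `|` [set x])).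
    split; first by move=> y By; left.
    move=> /(_ x (or_intror erefl)) Bx; apply: Nx.
    by exists [:: (1, exist _ x (or_intror Bx))]; rewrite comb1 scale1r.
  split; last by move=> y [/BS|->].
  move=> s sB h; have h' := h; rewrite (combD _ _ x) in h'.
  set t := [seq _ <- s | _] in h'.
  have tB p : List.In p t -> (A `|` B) p.2.
    move=> /List.filter_In[/sB ps /asboolP px].
    by case: ps => [|[|//]]; [left|right].
  have [c0|c0] := eqVneq (coef s x) 0; last first.
    have [u tu] : exists u : seq (k * {x | (A `|` B) x}), t = [seq (p.1, sval p.2) | p <- u].
      elim: (t) tB => [|[a y] r IH] rB; first by exists [::].
      have [|u ->] := IH; first by move=> p pr; apply: rB; right.
      by exists ((a, exist _ y (rB (a, y) (or_introl erefl))) :: u).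
    case: Nx; have [_ L] := @span_subspace _ _ (@sval V (A `|` B)).
    exists [seq (- (coef s x)^-1 * p.1, p.2) | p <- u].
    rewrite comb_scale; have -> : comb (@sval V (A `|` B)) u = comb id t.
      by rewrite tu /comb big_map.
    move/eqP: h'; rewrite addrC addr_eq0 => /eqP ->.
    by rewrite scalerN scaleNr opprK scalerA mulVf ?scale1r.
  move: h'; rewrite c0 scale0r add0r => /(frB t tB) ht v.
  have [-> //|vx] := pselect (v = x).
  have := ht v; rewrite /t (coef_filter (fun j => ~~ `[< j = x >])).
  by case: ifP => //; rewrite asboolF.
exists (fun i => exist (A `|` B) (e0 i) (or_introl (ex_intro _ i erefl))) => i j [].
exact: free_inj.
Qed.

Lemma subspace_basis (V : lmodType k) (S : V -> Prop) : subspace S ->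
  exists (I : Type) (e : I -> V), [/\ free_family e, forall i, S (e i) & spans e S].
Proof.
move=> sS; pose e0 (x : void) : V := match x with end.
have [||I [e [? ? ? _]]] := @basis_extend V S void e0 sS; [|by case|by exists I, e].
by move=> s _ [].
Qed.

Lemma embeds_span (V : lmodType k) (S : V -> Prop) (I : Type) (e : I -> V) :
  spans e S -> embeds {x | S x} (seq (k * I)).
Proof.
move=> sp; have /choice[f fP] (x : {x | S x}) := sp _ (svalP x).
exists f => x y /(congr1 (comb e)); rewrite -!fP.
by case: x y => [x hx] [y hy] /= E; apply: eq_exist.
Qed.

(* Locally finite functionals psi_t separating the points embed V into the
   finitely supported functions on T, so that functionals on V extend to
   functionals on them. *)
Lemma embeds_functionals (V : lmodType k) (T : Type) (psi : T -> V -> k^o) :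
  (forall t, linear (psi t)) ->
  (forall x, exists r : seq T, forall t, psi t x <> 0 -> List.In t r) ->
  (forall x, (forall t, psi t x = 0) -> x = 0) ->
  embeds {f : V -> k^o | linear f} (T -> k).
Proof.
move=> hpsi lf sep.
have ext (f : {f : V -> k^o | linear f}) : exists2 F : (T -> k^o) -> k^o,
    linear F & forall x, F (fun t => psi t x) = sval f x.
  case: f => f hf /=; apply: (@linear_extend k V) => //.
    by move=> a x y; apply/funext => t; rewrite hpsi.
  move=> x y e; apply/eqP; rewrite -subr_eq0; apply/eqP; apply: sep => t.
  by rewrite (linB (hpsi t)); have := congr1 (@^~ t) e => /= ->; rewrite subrr.
have /choice[F FP] (f : {f : V -> k^o | linear f}) : exists F : (T -> k^o) -> k^o,
    linear F /\ forall x, F (fun t => psi t x) = sval f x.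
  by have [F] := ext f; exists F.
pose d t : T -> k^o := fun t' => (`[< t' = t >])%:R.
(* The values on the [d t] do not determine the functional [F f], but they determine [f]: each
   function [fun t => psi t x] is a finite combination of the [d t]. *)
exists (fun f t => F f (d t)) => f g E.
have {}E t : F f (d t) = F g (d t) by exact: (congr1 (@^~ t) E).
case: f g E (FP f) (FP g) => [f hf] [g hg] E [hF FE] [hG GE]; apply: eq_exist.
apply/funext => x; rewrite -[LHS]FE -[RHS]GE.
have [r rP] := lf x.
suff -> : (fun t => psi t x) = comb d [seq (psi t x, t) | t <- undup (r : seq {classic T})].
  by rewrite !(comb_linear, comb_linear _ _ hG) /comb //; apply: eq_bigr => p _; rewrite E.
apply/funext => t; set u := undup _; transitivity (\sum_(t' <- u) psi t' x * d t' t); last first.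
  by rewrite /comb big_map fct_sumE.
have [tr|tr] := boolP ((t : {classic T}) \in u).
  rewrite (bigD1_seq _ tr) ?undup_uniq //= /d asboolT // mulr1 big1 ?addr0 // => t' tt'.
  by rewrite asboolF ?mulr0 // => e; rewrite e eqxx in tt'.
rewrite big1_seq => [|t' /= tr']; last first.
  by rewrite /d asboolF ?mulr0 // => e; rewrite e tr' in tr.
apply: contrapT => /rP; move/negP: tr; rewrite mem_undup; apply: contra_not.
elim: (r) => //= y s IH [->|/IH]; rewrite inE ?eqxx // => ->; exact: orbT.
Qed.

End Families.

(** * Yoneda extensions *)

Section YonedaCalculus.
Local Open Scope ring_scope.
Variables (k : fieldType) (A : kcat k).

Lemma prj_inc (X Y : A) (S : ses X Y) y : prj S (inc S y) = 0.
Proof. by apply/ses_exact; exists y. Qed.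

Lemma inc_lin (X Y : A) (S : ses X Y) : linear (inc S).
Proof. exact: mor_linear (inc_mor S). Qed.

Lemma prj_lin (X Y : A) (S : ses X Y) : linear (prj S).
Proof. exact: mor_linear (prj_mor S). Qed.

Arguments inc_lin {X Y} S.
Arguments prj_lin {X Y} S.

Lemma mor_sub (X Y : A) (f f' : car X -> car Y) :
  mor f -> mor f' -> mor (fun x => f x - f' x).
Proof.
move=> hf hf'; have := mor_lincomb (-1) hf' hf; congr mor; apply/funext => x.
by rewrite scaleN1r addrC.
Qed.

Lemma mor_add (X Y : A) (f f' : car X -> car Y) :
  mor f -> mor f' -> mor (fun x => f x + f' x).
Proof.
move=> hf hf'; have := mor_lincomb 1 hf hf'; congr mor; apply/funext => x.
by rewrite scale1r.
Qed.

Lemma mor_scale (X Y : A) a (f : car X -> car Y) : mor f -> mor (fun x => a *: f x).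
Proof.
move=> hf; have := mor_lincomb a hf (mor_zero X Y); congr mor; apply/funext => x.
by rewrite addr0.
Qed.

Lemma ses_mor_id (X Y : A) (S : ses X Y) : ses_mor id id S S.
Proof. by exists id; split=> //; apply: mor_id. Qed.

Lemma splice_mor_id m (X Y : A) (S : splice m X Y) : splice_mor id id S S.
Proof.
elim: m Y S => [|m IH] Y S /=; first exact: ses_mor_id.
by exists id; split; [apply: mor_id|apply: ses_mor_id|apply: IH].
Qed.

Arguments ses_mor_id {X Y} S.
Arguments splice_mor_id {m X Y} S.

Lemma ses_mor_comp (X Y X' Y' X2 Y2 : A) (f : car Y -> car Y') (g : car X -> car X')
    (f' : car Y' -> car Y2) (g' : car X' -> car X2)
    (S : ses X Y) (S' : ses X' Y') (S2 : ses X2 Y2) :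
  ses_mor f g S S' -> ses_mor f' g' S' S2 ->
  ses_mor (fun y => f' (f y)) (fun x => g' (g x)) S S2.
Proof.
move=> [h [hm h1 h2]] [h' [hm' h1' h2']]; exists (fun e => h' (h e)).
by split=> [|y|e]; [apply: mor_comp|rewrite h1 h1'|rewrite h2 h2'].
Qed.

Lemma splice_mor_comp m (X Y X' Y' X2 Y2 : A) (f : car Y -> car Y') (g : car X -> car X')
    (f' : car Y' -> car Y2) (g' : car X' -> car X2)
    (S : splice m X Y) (S' : splice m X' Y') (S2 : splice m X2 Y2) :
  splice_mor f g S S' -> splice_mor f' g' S' S2 ->
  splice_mor (fun y => f' (f y)) (fun x => g' (g x)) S S2.
Proof.
elim: m Y Y' Y2 f f' S S' S2 => [|m IH] Y Y' Y2 f f' S S' S2 /=; first exact: ses_mor_comp.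
move=> [h [hm h1 h2]] [h' [hm' h1' h2']]; exists (fun e => h' (h e)); split.
- exact: mor_comp.
- exact: ses_mor_comp h1 h1'.
- exact: IH h2 h2'.
Qed.

Lemma ses_mor_lincomb (X Y X' Y' : A) a (f f' : car Y -> car Y') (g g' : car X -> car X')
    (S : ses X Y) (S' : ses X' Y') :
  ses_mor f g S S' -> ses_mor f' g' S S' ->
  ses_mor (fun y => a *: f y + f' y) (fun x => a *: g x + g' x) S S'.
Proof.
move=> [h [hm h1 h2]] [h' [hm' h1' h2']]; exists (fun e => a *: h e + h' e).
by split=> [|y|e]; [apply: mor_lincomb|rewrite h1 h1' inc_lin|rewrite h2 h2' prj_lin].
Qed.

Lemma splice_mor_lincomb m (X Y X' Y' : A) a (f f' : car Y -> car Y')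
    (g g' : car X -> car X') (S : splice m X Y) (S' : splice m X' Y') :
  splice_mor f g S S' -> splice_mor f' g' S S' ->
  splice_mor (fun y => a *: f y + f' y) (fun x => a *: g x + g' x) S S'.
Proof.
elim: m Y Y' f f' S S' => [|m IH] Y Y' f f' S S' /=; first exact: ses_mor_lincomb.
move=> [h [hm h1 h2]] [h' [hm' h1' h2']]; exists (fun e => a *: h e + h' e); split.
- exact: mor_lincomb.
- exact: ses_mor_lincomb.
- exact: IH.
Qed.

Lemma ses_mor_zero (X Y X' Y' : A) (S : ses X Y) (S' : ses X' Y') :
  ses_mor (fun=> 0) (fun=> 0) S S'.
Proof.
exists (fun=> 0); split=> [|y|e]; first exact: mor_zero.
  by rewrite (lin0 (inc_lin S')).
by rewrite (lin0 (prj_lin S')).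
Qed.

Lemma splice_mor_zero m (X Y X' Y' : A) (S : splice m X Y) (S' : splice m X' Y') :
  splice_mor (fun=> 0) (fun=> 0) S S'.
Proof.
elim: m Y Y' S S' => [|m IH] Y Y' S S' /=; first exact: ses_mor_zero.
by exists (fun=> 0); split; [apply: mor_zero|apply: ses_mor_zero|apply: IH].
Qed.

Lemma splice_mor_add m (X Y X' Y' : A) (f f' : car Y -> car Y')
    (g g' : car X -> car X') (S : splice m X Y) (S' : splice m X' Y') :
  splice_mor f g S S' -> splice_mor f' g' S S' ->
  splice_mor (fun y => f y + f' y) (fun x => g x + g' x) S S'.
Proof.
move=> h h'; have := splice_mor_lincomb 1 h h'; congr splice_mor;
  by apply/funext => x; rewrite scale1r.
Qed.

Lemma splice_mor_sub m (X Y X' Y' : A) (f f' : car Y -> car Y')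
    (g g' : car X -> car X') (S : splice m X Y) (S' : splice m X' Y') :
  splice_mor f g S S' -> splice_mor f' g' S S' ->
  splice_mor (fun y => f y - f' y) (fun x => g x - g' x) S S'.
Proof.
move=> h h'; have := splice_mor_lincomb (-1) h' h; congr splice_mor;
  by apply/funext => x; rewrite scaleN1r addrC.
Qed.

Lemma splice_mor_scale m (X Y X' Y' : A) a (f : car Y -> car Y')
    (g : car X -> car X') (S : splice m X Y) (S' : splice m X' Y') :
  splice_mor f g S S' -> splice_mor (fun y => a *: f y) (fun x => a *: g x) S S'.
Proof.
move=> h; have := splice_mor_lincomb a h (splice_mor_zero S S'); congr splice_mor;
  by apply/funext => x; rewrite addr0.
Qed.

Lemma ses_mor_dpair (X Y X1 Y1 X2 Y2 : A) (f1 : car Y -> car Y1) (g1 : car X -> car X1)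
    (f2 : car Y -> car Y2) (g2 : car X -> car X2)
    (S : ses X Y) (S1 : ses X1 Y1) (S2 : ses X2 Y2) :
  ses_mor f1 g1 S S1 -> ses_mor f2 g2 S S2 ->
  ses_mor (fun y => dpair (f1 y) (f2 y)) (fun x => dpair (g1 x) (g2 x)) S (dsum_ses S1 S2).
Proof.
move=> [h [hm h1 h2]] [h' [hm' h1' h2']]; exists (fun e => dpair (h e) (h' e)); split=> /=.
- exact: mor_dpair.
- by move=> y; rewrite dfst_pair dsnd_pair h1 h1'.
- by move=> e; rewrite dfst_pair dsnd_pair h2 h2'.
Qed.

Lemma splice_mor_dpair m (X Y X1 Y1 X2 Y2 : A) (f1 : car Y -> car Y1) (g1 : car X -> car X1)
    (f2 : car Y -> car Y2) (g2 : car X -> car X2)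
    (S : splice m X Y) (S1 : splice m X1 Y1) (S2 : splice m X2 Y2) :
  splice_mor f1 g1 S S1 -> splice_mor f2 g2 S S2 ->
  splice_mor (fun y => dpair (f1 y) (f2 y)) (fun x => dpair (g1 x) (g2 x)) S
    (dsum_splice S1 S2).
Proof.
elim: m Y Y1 Y2 f1 f2 S S1 S2 => [|m IH] Y Y1 Y2 f1 f2 S S1 S2 /=; first exact: ses_mor_dpair.
move=> [h [hm h1 h2]] [h' [hm' h1' h2']]; exists (fun e => dpair (h e) (h' e)); split.
- exact: mor_dpair.
- exact: ses_mor_dpair.
- exact: IH.
Qed.

Lemma splice_mor_dfst m (X1 Y1 X2 Y2 : A) (S1 : splice m X1 Y1) (S2 : splice m X2 Y2) :
  splice_mor dfst dfst (dsum_splice S1 S2) S1.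
Proof.
have base (X Y X' Y' : A) (S : ses X Y) (S' : ses X' Y') : ses_mor dfst dfst (dsum_ses S S') S.
  by exists dfst; split=> [|y|e] /=; rewrite ?dfst_pair //; apply: mor_dfst.
elim: m Y1 Y2 S1 S2 => [|m IH] Y1 Y2 S1 S2 /=; first exact: base.
by exists dfst; split; [apply: mor_dfst|apply: base|apply: IH].
Qed.

Lemma splice_mor_dsnd m (X1 Y1 X2 Y2 : A) (S1 : splice m X1 Y1) (S2 : splice m X2 Y2) :
  splice_mor dsnd dsnd (dsum_splice S1 S2) S2.
Proof.
have base (X Y X' Y' : A) (S : ses X Y) (S' : ses X' Y') : ses_mor dsnd dsnd (dsum_ses S S') S'.
  by exists dsnd; split=> [|y|e] /=; rewrite ?dsnd_pair //; apply: mor_dsnd.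
elim: m Y1 Y2 S1 S2 => [|m IH] Y1 Y2 S1 S2 /=; first exact: base.
by exists dsnd; split; [apply: mor_dsnd|apply: base|apply: IH].
Qed.

Lemma splice_mor_to_split m (X Y X' Y' : A) (g : car X -> car X') (R : splice m X Y) :
  mor g -> splice_mor (fun=> 0) g R (split_splice m X' Y').
Proof.
move=> hg; have base (Z W Z' W' : A) (h : car Z -> car Z') (S : ses Z W) : mor h ->
    ses_mor (fun=> 0) h S (split_ses Z' W').
  move=> hh; exists (fun e => dpair 0 (h (prj S e))); split=> /= [|y|e].
  - by apply: mor_dpair; [apply: mor_zero|apply: mor_comp hh (prj_mor S)].
  - by rewrite prj_inc (lin0 (mor_linear hh)).
  - by rewrite dsnd_pair.
elim: m Y Y' R => [|m IH] Y Y' R /=; first exact: base.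
exists (fun=> 0); split; [exact: mor_zero|exact: base (mor_zero _ _)|exact: IH].
Qed.

Lemma splice_mor_of_split m (X Y X' Y' : A) (f : car Y' -> car Y) (R : splice m X Y) :
  mor f -> splice_mor f (fun=> 0) (split_splice m X' Y') R.
Proof.
have base (Z W Z' W' : A) (h : car W' -> car W) (S : ses Z W) : mor h ->
    ses_mor h (fun=> 0) (split_ses Z' W') S.
  move=> hh; exists (fun e => inc S (h (dfst e))); split=> /= [|y|e].
  - by apply: mor_comp (inc_mor S) _; apply: mor_comp hh _; apply: mor_dfst.
  - by rewrite dfst_pair.
  - by rewrite prj_inc.
elim: m Y Y' f R => [|m IH] Y Y' f R hf /=; first exact: base.
exists (fun=> 0); split; [exact: mor_zero|exact: base|exact: IH (mor_zero _ _)].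
Qed.

Lemma yequiv_mor m (X Y : A) (E E' : splice m X Y) : splice_mor id id E E' -> yequiv E E'.
Proof. exact: Relation_Operators.rst_step. Qed.

(* In a concrete category [mor] need not be stable under factoring through
   injections and surjections; the categories of comodules and modules are. *)
Definition factorizing : Prop :=
  (forall (X Y T : A) (S : ses X Y) (f : car T -> car Y), mor (fun t => inc S (f t)) -> mor f) /\
  (forall (X Y T : A) (S : ses X Y) (f : car X -> car T), mor (fun e => f (prj S e)) -> mor f).

Hypothesis fact : factorizing.

Lemma ker_factor (X Y T : A) (S : ses X Y) (h : car T -> car (mid S)) :
  mor h -> (forall t, prj S (h t) = 0) ->
  exists2 f : car T -> car Y, mor f & forall t, inc S (f t) = h t.
Proof.
move=> hm h0; have /choice[f fP] t : exists y, inc S y = h t by apply/ses_exact.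
exists f => //; apply: (fact.1 _ _ _ S); have -> // : (fun t => inc S (f t)) = h.
exact: funext.
Qed.

Lemma coker_factor (X Y T : A) (S : ses X Y) (h : car (mid S) -> car T) :
  mor h -> (forall y, h (inc S y) = 0) ->
  exists2 f : car X -> car T, mor f & forall e, f (prj S e) = h e.
Proof.
move=> hm h0; have /choice[s sP] x : exists e, prj S e = x by apply: prj_surj.
have E e : h (s (prj S e)) = h e.
  apply/eqP; rewrite -subr_eq0 -(linB (mor_linear hm)); apply/eqP.
  have /(ses_exact S)[y <-] : prj S (s (prj S e) - e) = 0.
    by rewrite (linB (prj_lin S)) sP subrr.
  exact: h0.
exists (fun x => h (s x)) => //; apply: (fact.2 _ _ _ S).
by have -> // : (fun e => h (s (prj S e))) = h by exact: funext.
Qed.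

Fixpoint mids_in (P : A -> Prop) m (X Y : A) : splice m X Y -> Prop :=
  match m return splice m X Y -> Prop with
  | 0 => fun S => P (mid S)
  | m'.+1 => fun S => P (mid (projT2 S).1) /\ mids_in P (projT2 S).2
  end.

Definition head_ses m (X Y : A) : splice m X Y -> {Z : A & ses Z Y} :=
  match m return splice m X Y -> {Z : A & ses Z Y} with
  | 0 => fun S => existT _ X S
  | m'.+1 => fun S => existT _ (projT1 S) (projT2 S).1
  end.

Fixpoint last_ses m (X Y : A) : splice m X Y -> {Z : A & ses X Z} :=
  match m return splice m X Y -> {Z : A & ses X Z} with
  | 0 => fun S => existT _ Y S
  | m'.+1 => fun S => last_ses (projT2 S).2
  end.

(** A splice is built from its left end. A resolution grows there by the constructor itself, whereas
    a coresolution grows at the right end. *)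
Fixpoint snoc m (X Y W : A) : splice m X Y -> ses W X -> splice m.+1 W Y :=
  match m return splice m X Y -> ses W X -> splice m.+1 W Y with
  | 0 => fun R S => existT _ X (R, S)
  | m'.+1 => fun R S => existT _ (projT1 R) ((projT2 R).1, snoc (projT2 R).2 S)
  end.

Lemma last_snoc m (X Y W : A) (R : splice m X Y) (S : ses W X) :
  last_ses (snoc R S) = existT _ X S.
Proof. by elim: m Y R => [|m IH] Y R //=; rewrite -(IH _ (projT2 R).2). Qed.

Lemma mids_in_snoc P m (X Y W : A) (R : splice m X Y) (S : ses W X) :
  mids_in P R -> P (mid S) -> mids_in P (snoc R S).
Proof.
by elim: m Y R => [|m IH] Y R //= [h1 h2] h3; split=> //; apply: IH.
Qed.

Lemma mids_in_impl (P Q : A -> Prop) m (X Y : A) (R : splice m X Y) :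
  (forall Z, P Z -> Q Z) -> mids_in P R -> mids_in Q R.
Proof.
move=> PQ; elim: m Y R => [|m IH] Y R /=; first exact: PQ.
by move=> [/PQ h1 /IH h2].
Qed.

Lemma mids_in_head P m (X Y : A) (R : splice m X Y) :
  mids_in P R -> P (mid (projT2 (head_ses R))).
Proof. by case: m R => [|m] R //= []. Qed.

Definition extends (X Y T : A) (S : ses X Y) (f : car Y -> car T) : Prop :=
  exists2 s : car (mid S) -> car T, mor s & forall y, s (inc S y) = f y.

Definition lifts (X Y T : A) (S : ses X Y) (g : car T -> car X) : Prop :=
  exists2 s : car T -> car (mid S), mor s & forall t, prj S (s t) = g t.

Definition projective_ob (P : A) : Prop :=
  forall (X Y : A) (S : ses X Y) (g : car P -> car X), mor g -> lifts S g.

Definition injective_ob (J : A) : Prop :=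
  forall (X Y : A) (S : ses X Y) (f : car Y -> car J), mor f -> extends S f.

Lemma ses_mor_lift (X Y X' Y' : A) (S : ses X Y) (S' : ses X' Y')
    (g : car X -> car X') :
  lifts S' (fun e => g (prj S e)) -> exists2 f : car Y -> car Y', mor f & ses_mor f g S S'.
Proof.
move=> [s sm sE]; have [||f fm fE] := @ker_factor _ _ _ S' (fun y => s (inc S y)).
- exact: mor_comp sm (inc_mor S).
- move=> y; rewrite sE prj_inc.
  by have := sE 0; rewrite (lin0 (mor_linear sm)) !(lin0 (prj_lin _)).
by exists f => //; exists s; split.
Qed.

Lemma ses_mor_extend (X Y X' Y' : A) (S : ses X Y) (S' : ses X' Y')
    (f : car Y -> car Y') : mor f ->
  extends S (fun y => inc S' (f y)) -> exists2 g : car X -> car X', mor g & ses_mor f g S S'.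
Proof.
move=> fm [s sm sE]; have [||g gm gE] := @coker_factor _ _ _ S (fun e => prj S' (s e)).
- exact: mor_comp (prj_mor S') sm.
- by move=> y; rewrite sE prj_inc.
by exists g => //; exists s; split.
Qed.

Lemma proj_lift m (X K X' Y : A) (R : splice m X K) (E : splice m X' Y)
    (g : car X -> car X') : mids_in projective_ob R -> mor g ->
  exists2 f : car K -> car Y, mor f & splice_mor f g R E.
Proof.
elim: m K Y R E => [|m IH] K Y R E /= pR gm.
  by apply: ses_mor_lift; apply: pR; apply: mor_comp gm (prj_mor R).
have [pS pR'] := pR; have [h hm hE] := IH _ _ (projT2 R).2 (projT2 E).2 pR' gm.
have [|f fm fE] := @ses_mor_lift _ _ _ _ (projT2 R).1 (projT2 E).1 h.
  by apply: pS; apply: mor_comp hm (prj_mor _).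
by exists f => //; exists h; split.
Qed.

(** A morphism of sequences that is zero at the right end is null-homotopic; of the homotopy only
    the leftmost component is kept, which extends [f] to the middle of the head. *)
Lemma proj_homotopy m (X K X' Y : A) (R : splice m X K) (E : splice m X' Y)
    (f : car K -> car Y) : mids_in projective_ob R ->
  splice_mor f (fun=> 0) R E -> extends (projT2 (head_ses R)) f.
Proof.
elim: m K Y R E f => [|m IH] K Y R E f /= pR.
  move=> [h [hm h1 h2]]; have [|s sm sE] := ker_factor hm; first by move=> e; rewrite -h2.
  by exists s => // y; apply: (inc_inj E); rewrite sE h1.
have [pS pR'] := pR; move=> [h [hm [e [em e1 e2]] hE]].
have [s sm sE] := IH _ _ _ _ _ pR' hE.
have [t tm tE] := mids_in_head pR' _ _ (projT2 E).1 _ sm.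
set S' := projT2 (head_ses (projT2 R).2) in s sm sE t tm tE.
pose e' x := e x - t (inc S' (prj (projT2 R).1 x)).
have [||r rm rE] := @ker_factor _ _ _ (projT2 E).1 e'.
- apply: mor_sub em _; apply: mor_comp tm _; apply: mor_comp (inc_mor _) (prj_mor _).
- by move=> x; rewrite /e' (linB (prj_lin _)) -e2 tE sE subrr.
exists r => // y; apply: (inc_inj (projT2 E).1); rewrite rE /e' prj_inc.
by rewrite (lin0 (inc_lin _)) (lin0 (mor_linear tm)) subr0 e1.
Qed.

(** Injectivity of the objects in [P], tested only along the given sequence. It is automatic for
    injective objects, but for the images of cofree comodules under [Upsilon] it has to be proved
    for one particular resolution. *)
Fixpoint all_ext (P : A -> Prop) m (X Y : A) : splice m X Y -> Prop :=
  match m return splice m X Y -> Prop with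
  | 0 => fun S => forall J, P J -> forall f : car Y -> car J, mor f -> extends S f
  | m'.+1 => fun S =>
     (forall J, P J -> forall f : car Y -> car J, mor f -> extends (projT2 S).1 f) /\
     all_ext P (projT2 S).2
  end.

(** The head is exempt: there the comparison lemmas ask for the extension of a single map, and at
    the last syzygy arbitrary maps into C need not extend. *)
Definition tail_ext (P : A -> Prop) m (X Y : A) : splice m X Y -> Prop :=
  match m return splice m X Y -> Prop with
  | 0 => fun S => True
  | m'.+1 => fun S => all_ext P (projT2 S).2
  end.

Lemma all_ext_head P m (X Y : A) (S : splice m X Y) : all_ext P S ->
  forall J, P J -> forall f : car Y -> car J, mor f -> extends (projT2 (head_ses S)) f.
Proof. by case: m S => [|m] S //= []. Qed.

Lemma all_ext_tail P m (X Y : A) (S : splice m X Y) : all_ext P S -> tail_ext P S.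
Proof. by case: m S => [|m] S //= []. Qed.

Lemma all_ext_injective m (X Y : A) (S : splice m X Y) : all_ext injective_ob S.
Proof.
elim: m Y S => [|m IH] Y S /=; first by move=> J iJ f fm; apply: iJ.
by split=> [J iJ f fm|]; [apply: iJ|apply: IH].
Qed.

Lemma ext_lift P m (X' Y' X Y : A) (E : splice m X' Y') (R : splice m X Y)
    (f : car Y' -> car Y) : tail_ext P E -> mids_in P R -> mor f ->
  extends (projT2 (head_ses E)) (fun y => inc (projT2 (head_ses R)) (f y)) ->
  exists2 g : car X' -> car X, mor g & splice_mor f g E R.
Proof.
elim: m Y' Y E R f => [|m IH] Y' Y E R f /= tE mR fm ex; first exact: ses_mor_extend.
have [h hm hE] := ses_mor_extend fm ex; have [_ mR'] := mR.
have [|g gm gE] := IH _ _ (projT2 E).2 (projT2 R).2 h (all_ext_tail tE) mR' hm.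
  by apply: (all_ext_head tE); [apply: mids_in_head|apply: mor_comp (inc_mor _) hm].
by exists g => //; exists h; split.
Qed.

(** Dual to [proj_homotopy]: an extension of [f] to the head starts a homotopy, which is continued
    to the right; its last component is the required lift. *)
Lemma ext_homotopy P m (X' Y' X Y : A) (E : splice m X' Y') (R : splice m X Y)
    (f : car Y' -> car Y) (g : car X' -> car X) :
  tail_ext P E -> mids_in P R -> splice_mor f g E R ->
  extends (projT2 (head_ses E)) f -> lifts (projT2 (last_ses R)) g.
Proof.
elim: m Y' Y E R f => [|m IH] Y' Y E R f /= tE mR.
  move=> [h [hm h1 h2]] [s sm sE].
  have [||t tm tP] := @coker_factor _ _ _ E (fun e => h e - inc R (s e)).
  - by apply: mor_sub hm _; apply: mor_comp (inc_mor R) sm.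
  - by move=> y; rewrite sE h1 subrr.
  exists t => // x; have [e <-] := prj_surj E x.
  by rewrite tP (linB (prj_lin R)) prj_inc subr0 h2.
move=> [h [hm [e [em e1 e2]] hE]] [s sm sE]; have [mS mR'] := mR.
have [||t tm tP] := @coker_factor _ _ _ (projT2 E).1 (fun x => e x - inc (projT2 R).1 (s x)).
- by apply: mor_sub em _; apply: mor_comp (inc_mor _) sm.
- by move=> y; rewrite sE e1 subrr.
have [t' tm' tP'] := all_ext_head tE mS tm.
apply: IH (all_ext_tail tE) mR' hE _; exists (fun x => prj (projT2 R).1 (t' x)).
  exact: mor_comp (prj_mor _) tm'.
move=> y; rewrite tP'; have [x <-] := prj_surj (projT2 E).1 y.
by rewrite tP (linB (prj_lin _)) prj_inc subr0 e2.
Qed.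

(** The universal property makes two extensions with the same classifying map equivalent, since both
    receive a morphism from the pushout that is the identity at the ends. *)
Definition has_pushouts : Prop :=
  forall (X Y Y' : A) (f : car Y -> car Y') (S : ses X Y), mor f ->
  exists2 S' : ses X Y', ses_mor f id S S' &
    forall (X2 Y2 : A) (f2 : car Y' -> car Y2) (g2 : car X -> car X2) (T : ses X2 Y2),
      mor f2 -> mor g2 -> ses_mor (fun y => f2 (f y)) g2 S T -> ses_mor f2 g2 S' T.

Definition has_pullbacks : Prop :=
  forall (X X' Y : A) (g : car X' -> car X) (S : ses X Y), mor g ->
  exists2 S' : ses X' Y, ses_mor id g S' S &
    forall (X2 Y2 : A) (f2 : car Y2 -> car Y) (g2 : car X2 -> car X') (T : ses X2 Y2),
      mor f2 -> mor g2 -> ses_mor f2 (fun x => g (g2 x)) T S -> ses_mor f2 g2 T S'.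

Lemma splice_push m (X Y Y' : A) (f : car Y -> car Y') (R : splice m X Y) :
  has_pushouts -> mor f ->
  exists2 R' : splice m X Y', splice_mor f id R R' &
    forall (X2 Y2 : A) (f2 : car Y' -> car Y2) (g2 : car X -> car X2) (T : splice m X2 Y2),
      mor f2 -> mor g2 -> splice_mor (fun y => f2 (f y)) g2 R T -> splice_mor f2 g2 R' T.
Proof.
move=> po fm; case: m R => [|m] R /=; first exact: po.
have [S' fS uS] := po _ _ _ f (projT2 R).1 fm.
exists (existT _ (projT1 R) (S', (projT2 R).2)).
  by exists id; split; [apply: mor_id| |apply: splice_mor_id].
move=> X2 Y2 f2 g2 T fm2 gm2 [h [hm h1 h2]]; exists h; split=> //=; exact: uS.
Qed.

Lemma splice_pull m (X X' Y : A) (g : car X' -> car X) (R : splice m X Y) :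
  has_pullbacks -> mor g ->
  exists2 R' : splice m X' Y, splice_mor id g R' R &
    forall (X2 Y2 : A) (f2 : car Y2 -> car Y) (g2 : car X2 -> car X') (T : splice m X2 Y2),
      mor f2 -> mor g2 -> splice_mor f2 (fun x => g (g2 x)) T R -> splice_mor f2 g2 T R'.
Proof.
move=> pb gm; elim: m Y R => [|m IH] Y R /=; first exact: pb.
have [R' fR uR] := IH _ (projT2 R).2.
exists (existT _ (projT1 R) ((projT2 R).1, R')).
  by exists id; split; [apply: mor_id|apply: ses_mor_id|].
move=> X2 Y2 f2 g2 T fm2 gm2 [h [hm h1 h2]]; exists h; split=> //=; exact: uR.
Qed.

End YonedaCalculus.

Arguments inc_lin {k A X Y} S.
Arguments prj_lin {k A X Y} S.
Arguments ses_mor_id {k A X Y} S.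
Arguments splice_mor_id {k A m X Y} S.

(** * Ext groups from resolutions *)

Section Coef.
Local Open Scope ring_scope.
Variable k : fieldType.

Lemma coef_cat (I : Type) (s t : seq (k * I)) i : coef (s ++ t) i = coef s i + coef t i.
Proof. exact: big_cat. Qed.

Lemma coef_scale (I : Type) a (s : seq (k * I)) i :
  coef [seq (a * p.1, p.2) | p <- s] i = a * coef s i.
Proof. by rewrite /coef big_map mulr_sumr. Qed.

Lemma coef_notin (I : Type) (s : seq (k * I)) i :
  (i : {classic I}) \notin [seq (p.2 : {classic I}) | p <- s] -> coef s i = 0.
Proof.
elim: s => [|[a j] s IH] /=; first by rewrite /coef big_nil.
rewrite inE negb_or => /andP[ij /IH h].
by rewrite /coef big_cons asboolF //= => e; rewrite e eqxx in ij.
Qed.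

Lemma coef_uniq (I : Type) (u : seq {classic I}) (c : I -> k) i :
  uniq u -> i \in u -> coef [seq (c j, j : I) | j <- u] i = c i.
Proof.
move=> uu iu; rewrite /coef big_map big_mkcond (bigD1_seq i) //= asboolT // big1 ?addr0 //.
by move=> j ji; case: asboolP => // e; rewrite e eqxx in ji.
Qed.

Lemma comb_undup (I : Type) (V : lmodType k) (e : I -> V) (s : seq (k * I)) :
  comb e s = \sum_(i <- undup [seq (p.2 : {classic I}) | p <- s]) coef s i *: e i.
Proof.
set u := undup _; apply/eqP; rewrite -subr_eq0; apply/eqP.
have -> : \sum_(i <- u) coef s i *: e i = comb e [seq (coef s j, j : I) | j <- u].
  by rewrite /comb big_map.
rewrite -scaleN1r -comb_scale -comb_cat; apply: comb_coef0 => i.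
rewrite coef_cat coef_scale mulN1r; apply/eqP; rewrite subr_eq0; apply/eqP.
have [iu|iu] := boolP ((i : {classic I}) \in u).
  by rewrite coef_uniq // /u undup_uniq.
rewrite coef_notin ?coef_notin //; last by move: iu; rewrite mem_undup.
by rewrite -map_comp map_id.
Qed.

Lemma coef_ord (I : Type) m (j : 'I_m -> I) (c : 'I_m -> k) i : injective j ->
  coef [seq (c i, j i) | i <- enum 'I_m] (j i) = c i.
Proof.
move=> ji; rewrite /coef big_map big_enum_cond /= (bigD1 i) ?asboolT //= big1 ?addr0 //.
by move=> i' /andP[/asboolP/ji -> ]; rewrite eqxx.
Qed.

Lemma comb_ord (I : Type) (V : lmodType k) (e : I -> V) m (j : 'I_m -> I) (c : 'I_m -> k) :
  comb e [seq (c i, j i) | i <- enum 'I_m] = \sum_(i < m) c i *: e (j i).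
Proof. by rewrite /comb big_map big_enum. Qed.

End Coef.

Section ExtRepresentation.
Local Open Scope ring_scope.
Variables (k : fieldType) (A : kcat k) (n : nat) (X Y : A).
Variables (V : lmodType k) (H : V -> Prop) (rho : V -> yext n X Y -> Prop).

(** The subspace [H] serves as a model of Ext: [rho h E] says that [h] classifies [E]. Since the
    operations on classes are defined by relations between extensions, each of them needs two
    fields, one for the class of the result and one for the existence of a result. *)
Record ext_repr : Prop := ExtRepr {
  er_sub : subspace H;
  er_dom : forall h E, rho h E -> H h;
  er_tot : forall E, exists h, rho h E;
  er_surj : forall h, H h -> exists E, rho h E;
  er_inj : forall h h' E, rho h E -> rho h' E -> h = h';
  er_equiv : forall h E E', rho h E -> rho h E' -> yequiv E E';
  er_step : forall h (E E' : yext n X Y), rho h E -> splice_mor id id E E' -> rho h E';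
  er_zero : rho 0 (split_splice n.-1 X Y);
  er_add : forall h1 h2 E1 E2 (F : splice n.-1 X (dsum Y Y)) (E3 : yext n X Y),
    rho h1 E1 -> rho h2 E2 -> splice_mor id (@diag _ _ X) F (dsum_splice E1 E2) ->
    splice_mor (@codiag _ _ Y) id F E3 -> rho (h1 + h2) E3;
  er_add_ex : forall h1 h2, H h1 -> H h2 ->
    exists E1 E2 (F : splice n.-1 X (dsum Y Y)) (E3 : yext n X Y),
    [/\ rho h1 E1, rho h2 E2, splice_mor id (@diag _ _ X) F (dsum_splice E1 E2)
      & splice_mor (@codiag _ _ Y) id F E3];
  er_scale : forall a h (E1 E2 : yext n X Y),
    rho h E1 -> splice_mor (fun y => a *: y) id E1 E2 -> rho (a *: h) E2;
  er_scale_ex : forall a h, H h -> exists E1 E2 : yext n X Y,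
    rho h E1 /\ splice_mor (fun y => a *: y) id E1 E2
}.

Hypothesis R : ext_repr.

(** Invariance is assumed only along the direction of a morphism. Backwards, [E] has some class by
    [er_tot]; this class passes to [E'] and therefore equals [h]. *)
Lemma er_yequiv h E E' : yequiv E E' -> rho h E <-> rho h E'.
Proof.
move=> e; elim: e h => {E E'} [E E' s|E|E E' _ IH|E E' E2 _ IH1 _ IH2] h.
- split=> r; first exact: er_step r s.
  by have [h' r'] := er_tot R E; rewrite (er_inj R r (er_step R r' s)).
- by [].
- exact: iff_sym (IH h).
- exact: iff_trans (IH1 h) (IH2 h).
Qed.

Definition represents (P : yext n X Y -> Prop) (h : V) : Prop :=
  H h /\ forall E, P E <-> rho h E.

Lemma represents_class h E : rho h E -> represents (yclass E) h.
Proof.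
move=> r; split=> [|E']; first exact: er_dom r.
by split=> [e|r']; [apply/(er_yequiv h e)|apply: er_equiv r r'].
Qed.

Lemma represents_zero : represents (@ext_zero _ _ n X Y) 0.
Proof. exact: represents_class (er_zero R). Qed.

Lemma represents_add P Q h h' :
  represents P h -> represents Q h' -> represents (ext_add P Q) (h + h').
Proof.
move=> [Hh hP] [Hh' hQ]; split=> [|E]; first exact: subspaceD (er_sub R) Hh Hh'.
split=> [[E1 [E2 [F [E3 [/hP r1 /hQ r2 s1 s2 e]]]]]|r].
  by apply/(er_yequiv _ e); apply: er_add r1 r2 s1 s2.
have [E1 [E2 [F [E3 [r1 r2 s1 s2]]]]] := er_add_ex R Hh Hh'.
exists E1, E2, F, E3; split=> //; [exact/hP|exact/hQ|].
exact: (er_equiv R (er_add R r1 r2 s1 s2) r).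
Qed.

Lemma represents_scale a P h : represents P h -> represents (ext_scale a P) (a *: h).
Proof.
move=> [Hh hP]; split=> [|E]; first exact: subspaceZ (er_sub R) Hh.
split=> [[E1 [E2 [/hP r1 s e]]]|r].
  by apply/(er_yequiv _ e); apply: er_scale r1 s.
have [E1 [E2 [r1 s]]] := er_scale_ex R a Hh; exists E1, E2; split=> //; first exact/hP.
exact: (er_equiv R (er_scale R r1 s) r).
Qed.

Lemma represents_uniq P Q h : represents P h -> represents Q h -> P = Q.
Proof.
by move=> [_ hP] [_ hQ]; apply/predeqP => E; apply: iff_trans (hP E) (iff_sym (hQ E)).
Qed.

Lemma represents_inj P h h' : represents P h -> represents P h' -> h = h'.
Proof.
move=> [Hh hP] [_ hP']; have [E r] := er_surj R Hh; apply: (er_inj R r).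
by apply/hP'/hP.
Qed.

Lemma Ext_ext (x y : Ext n X Y) : ext_class x = ext_class y -> x = y.
Proof.
case: x y => [P hP] [Q hQ] /= e; move: hP hQ; rewrite e => hP hQ.
by congr MkExt; apply: Prop_irrelevance.
Qed.

Lemma ext_repr_coord : exists eta : Ext n X Y -> V,
  [/\ forall x, represents (ext_class x) (eta x), injective eta
    & forall h, H h -> exists x, eta x = h].
Proof.
have /choice[eta etaP] (x : Ext n X Y) : exists h, represents (ext_class x) h.
  have [E ->] := ext_classP x; have [h r] := er_tot R E.
  by exists h; apply: represents_class.
exists eta; split=> // [x y e|h Hh].
  by apply: Ext_ext; apply: represents_uniq (etaP x) _; rewrite e.
have [E r] := er_surj R Hh; exists (MkExt (ex_intro _ E erefl)).
exact: represents_inj (etaP (MkExt (ex_intro _ E erefl))) (represents_class r).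
Qed.

Variable eta : Ext n X Y -> V.
Hypothesis etaP : forall x, represents (ext_class x) (eta x).
Hypothesis eta_surj : forall h, H h -> exists x, eta x = h.

Lemma represents_lincomb m (c : 'I_m -> k) (x : 'I_m -> Ext n X Y) :
  represents (ext_lincomb c x) (\sum_(i < m) c i *: eta (x i)).
Proof.
apply: (big_ind2 (fun P h => represents P h)) => [|P h Q h' hP hQ|i _].
- exact: represents_zero.
- exact: represents_add.
- exact: represents_scale.
Qed.

Lemma ext_basis_repr (I : Type) (e : I -> Ext n X Y) :
  ext_basis e <-> free_family (fun i => eta (e i)) /\ spans (fun i => eta (e i)) H.
Proof.
split=> [[sp fr]|[fr sp]]; split.
(* Independence of Ext classes is stated for distinct indices, and that of a free family for lists
   with repetitions; [undup] mediates between the two. *)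
- move=> s h i; set u := undup [seq (p.2 : {classic I}) | p <- s].
  have [iu|iu] := boolP ((i : {classic I}) \in u); last first.
    by apply: coef_notin; move: iu; rewrite mem_undup.
  pose j (t : 'I_(size u)) : I := nth i u t.
  have ji : injective j.
    move=> a b ab; apply: val_inj; apply/eqP.
    by rewrite -(nth_uniq (i : {classic I}) (ltn_ord a) (ltn_ord b) (undup_uniq _)); apply/eqP.
  have io : (index (i : {classic I}) u < size u)%N by rewrite index_mem.
  have ij : i = j (Ordinal io) by rewrite /j /= (nth_index (i : {classic I}) iu).
  rewrite ij; apply: (fr _ j (fun t => coef s (j t)) ji).
  apply: represents_uniq (represents_lincomb _ _) _; have -> : 
      \sum_(t < size u) coef s (j t) *: eta (e (j t)) = 0.
    rewrite -[RHS]h comb_undup -/u (big_nth (i : {classic I})) big_mkord.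
    by apply: eq_bigr.
  exact: represents_zero.
- move=> h /eta_surj[x <-]; have [m [j [c xE]]] := sp x.
  exists [seq (c i, j i) | i <- enum 'I_m]; rewrite comb_ord.
  by apply: represents_inj (etaP x) _; rewrite xE; apply: represents_lincomb.
- move=> x; have [Hx _] := etaP x; have [s sE] := sp _ Hx.
  exists (size s), (fun t => (tnth (in_tuple s) t).2), (fun t => (tnth (in_tuple s) t).1).
  apply: represents_uniq (etaP x) _; rewrite sE.
  by rewrite /comb (big_tnth _ _ s); apply: represents_lincomb.
- move=> m j c ji h i; rewrite -(coef_ord c i ji); apply: fr; rewrite comb_ord.
  apply: represents_inj (represents_lincomb c (fun i => e (j i))) _.
  by rewrite h; apply: represents_zero.
Qed.

Lemma ext_dim_repr (I : Type) :
  ext_dim n X Y I <-> exists e : I -> V, [/\ free_family e, forall i, H (e i) & spans e H].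
Proof.
split=> [[e /ext_basis_repr[fr sp]]|[e [fr He sp]]].
  by exists (fun i => eta (e i)); split=> // i; case: (etaP (e i)).
have /choice[x xE] i : exists x, eta x = e i by exact: eta_surj.
exists x; apply/ext_basis_repr; have -> // : (fun i => eta (x i)) = e by exact: funext.
Qed.

End ExtRepresentation.

Section ResolutionRepresentation.
Local Open Scope ring_scope.
Variables (k : fieldType) (A : kcat k).
Hypothesis fact : factorizing A.

Lemma mor_subspace (X Y : A) : subspace (@mor k A X Y : (car X -> car Y) -> Prop).
Proof. by split=> [|a f f']; [apply: mor_zero|apply: mor_lincomb]. Qed.

Lemma mor_diag (X : A) : mor (@diag _ _ X).
Proof. by apply: mor_dpair; apply: mor_id. Qed.

Lemma mor_codiag (X : A) : mor (@codiag _ _ X).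
Proof. by apply: mor_add; [apply: mor_dfst|apply: mor_dsnd]. Qed.

Lemma splice_mor_codiag m (X1 Y1 X2 Y2 X Y : A) (f1 : car Y1 -> car Y) (f2 : car Y2 -> car Y)
    (g1 : car X1 -> car X) (g2 : car X2 -> car X)
    (E1 : splice m X1 Y1) (E2 : splice m X2 Y2) (R : splice m X Y) :
  splice_mor f1 g1 E1 R -> splice_mor f2 g2 E2 R ->
  splice_mor (fun y => f1 (dfst y) + f2 (dsnd y)) (fun x => g1 (dfst x) + g2 (dsnd x))
    (dsum_splice E1 E2) R.
Proof.
move=> h1 h2; apply: splice_mor_add.
  exact: splice_mor_comp (splice_mor_dfst E1 E2) h1.
exact: splice_mor_comp (splice_mor_dsnd E1 E2) h2.
Qed.

(** Ext is Hom(K, Y) modulo the maps that extend to the middle of the head, and by the third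
    hypothesis these are zero. An extension is classified by the left end of a comparison morphism
    from the resolution, and it is recovered by pushout. *)
Lemma proj_ext_repr n (X K Y : A) (R : splice n.-1 X K) :
  has_pushouts A -> mids_in (@projective_ob _ A) R ->
  (forall f : car K -> car Y, extends (projT2 (head_ses R)) f -> f = fun=> 0) ->
  ext_repr (@mor k A K Y : (car K -> car Y) -> Prop)
    (fun f (E : yext n X Y) => mor f /\ splice_mor f id R E).
Proof.
move=> po pR mR.
have zero T (E : splice n.-1 T Y) f : splice_mor f (fun=> 0) R E -> f = fun=> 0.
  by move=> /(proj_homotopy fact pR)/mR.
have inj f f' (E : splice n.-1 X Y) : splice_mor f id R E -> splice_mor f' id R E -> f = f'.
  move=> h h'; have := splice_mor_sub h h'.
  have -> : (fun x : car X => x - x) = fun=> 0 by apply/funext => x; rewrite subrr.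
  move=> /zero e; apply/funext => y; have /eqP := congr1 (@^~ y) e.
  by rewrite subr_eq0 => /eqP.
have push f : mor f -> exists2 R' : splice n.-1 X Y, splice_mor f id R R' &
    forall (X2 Y2 : A) (f2 : car Y -> car Y2) (g2 : car X -> car X2) (T : splice n.-1 X2 Y2),
      mor f2 -> mor g2 -> splice_mor (fun y => f2 (f y)) g2 R T -> splice_mor f2 g2 R' T.
  exact: splice_push.
have surj f : mor f -> exists E : splice n.-1 X Y, splice_mor f id R E.
  by move=> /push[E sE _]; exists E.
split.
- exact: mor_subspace.
- by move=> f E [].
- by move=> E; have [f fm fE] := proj_lift fact E pR (mor_id X); exists f.
- by move=> f fm; have [E sE] := surj f fm; exists E.
- by move=> f f' E [_ h] [_ h']; apply: inj h h'.
- move=> f E E' [fm h] [_ h']; have [P sP uP] := push f fm.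
  apply: Relation_Operators.rst_trans (_ : yequiv E P) _.
    by apply: Relation_Operators.rst_sym; apply: yequiv_mor; apply: uP h; apply: mor_id.
  by apply: yequiv_mor; apply: uP h'; apply: mor_id.
- by move=> f E E' [fm h] s; split=> //; apply: splice_mor_comp h s.
- by split; [apply: mor_zero|apply: splice_mor_to_split; apply: mor_id].
- move=> f1 f2 E1 E2 F E3 [m1 r1] [m2 r2] s1 s2; split; first exact: mor_add.
  have [f fm sf] := proj_lift fact F pR (mor_id X).
  have sd := splice_mor_comp sf s1.
  have := splice_mor_comp sd (splice_mor_dfst E1 E2).
  have -> : (fun x : car X => dfst (diag x)) = id by apply/funext => x; rewrite /diag dfst_pair.
  move=> /(inj _ _ _ r1) e1.
  have := splice_mor_comp sd (splice_mor_dsnd E1 E2).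
  have -> : (fun x : car X => dsnd (diag x)) = id by apply/funext => x; rewrite /diag dsnd_pair.
  move=> /(inj _ _ _ r2) e2.
  by rewrite e1 e2; apply: splice_mor_comp sf s2.
- move=> f1 f2 m1 m2; have [E1 s1] := surj _ m1; have [E2 s2] := surj _ m2.
  have fm := mor_dpair m1 m2; have [F sF uF] := splice_push R po fm.
  have [E3 s3 _] := splice_push F po (mor_codiag Y).
  exists E1, E2, F, E3; split=> //; apply: uF; [exact: mor_id|exact: mor_diag|].
  exact: splice_mor_dpair s1 s2.
- move=> a f E1 E2 [fm s1] s2; split; first exact: mor_scale.
  exact: splice_mor_comp s1 s2.
- move=> a f fm; have [E1 s1] := surj _ fm.
  have [E2 s2 _] := splice_push E1 po (mor_scale a (mor_id Y)).
  by exists E1, E2; split.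
Qed.

(** Dual to [proj_ext_repr]: the maps that lift to the last middle term are zero, so that Ext is
    Hom(X, Z), and extensions are recovered by pullback. *)
Lemma inj_ext_repr n (X Z Y : A) (R : splice n.-1 Z Y) :
  has_pullbacks A -> mids_in (@injective_ob _ A) R ->
  (forall g : car X -> car Z, lifts (projT2 (last_ses R)) g -> g = fun=> 0) ->
  ext_repr (@mor k A X Z : (car X -> car Z) -> Prop)
    (fun g (E : yext n X Y) => mor g /\ splice_mor id g E R).
Proof.
move=> pb iR mR.
have lift T W (f : car T -> car Y) (E : splice n.-1 W T) : mor f ->
    exists2 g : car W -> car Z, mor g & splice_mor f g E R.
  move=> fm; have aE := all_ext_injective E.
  have := ext_lift fact (all_ext_tail aE) iR fm; apply.
  by apply: (all_ext_head aE) (mids_in_head iR) _ _; apply: mor_comp (inc_mor _) fm.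
have inj T f g g' (E : splice n.-1 X T) : mor f ->
    splice_mor f g E R -> splice_mor f g' E R -> g = g'.
  move=> fm h h'; have := splice_mor_sub h h'.
  move=> /(ext_homotopy fact (all_ext_tail (all_ext_injective E)) iR).
  case=> [|s sm sE]; first by exists (fun=> 0); [apply: mor_zero|move=> y; rewrite subrr].
  have /mR e : lifts (projT2 (last_ses R)) (fun x => g x - g' x) by exists s.
  by apply/funext => x; have /eqP := congr1 (@^~ x) e; rewrite subr_eq0 => /eqP.
have pull g : mor g -> exists2 R' : splice n.-1 X Y, splice_mor id g R' R &
    forall (X2 Y2 : A) (f2 : car Y2 -> car Y) (g2 : car X2 -> car X) (T : splice n.-1 X2 Y2),
      mor f2 -> mor g2 -> splice_mor f2 (fun x => g (g2 x)) T R -> splice_mor f2 g2 T R'.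
  exact: splice_pull.
split.
- exact: mor_subspace.
- by move=> g E [].
- by move=> E; have [g gm gE] := lift _ _ _ E (mor_id Y); exists g.
- by move=> g gm; have [E sE _] := pull g gm; exists E.
- by move=> g g' E [_ h] [_ h']; apply: inj (mor_id Y) h h'.
- move=> g E E' [gm h] [_ h']; have [P sP uP] := pull g gm.
  apply: Relation_Operators.rst_trans (_ : yequiv E P) _.
    by apply: yequiv_mor; apply: uP h; apply: mor_id.
  by apply: Relation_Operators.rst_sym; apply: yequiv_mor; apply: uP h'; apply: mor_id.
- move=> g E E' [gm h] s; split=> //; have [g' gm' h'] := lift _ _ _ E' (mor_id Y).
  by rewrite (inj _ _ _ _ _ (mor_id Y) h (splice_mor_comp s h')).
- by split; [apply: mor_zero|apply: splice_mor_of_split; apply: mor_id].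
- move=> g1 g2 E1 E2 F E3 [m1 r1] [m2 r2] s1 s2; split; first exact: mor_add.
  have [g gm h] := lift _ _ _ E3 (mor_id Y).
  have := splice_mor_comp s1 (splice_mor_codiag r1 r2).
  have -> : (fun x : car X => g1 (dfst (diag x)) + g2 (dsnd (diag x))) = (g1 + g2).
    by apply/funext => x; rewrite /diag dfst_pair dsnd_pair.
  by move=> h'; rewrite (inj _ _ _ _ _ (mor_codiag Y) h' (splice_mor_comp s2 h)).
- move=> g1 g2 m1 m2; have [E1 s1 _] := pull _ m1; have [E2 s2 _] := pull _ m2.
  have [F sF _] := splice_pull (dsum_splice E1 E2) pb (mor_diag X).
  have [E3 s3 u3] := pull _ (mor_add m1 m2).
  exists E1, E2, F, E3; split=> //; apply: u3; [exact: mor_codiag|exact: mor_id|].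
  have := splice_mor_comp sF (splice_mor_codiag s1 s2); congr splice_mor.
  by apply/funext => x; rewrite /diag dfst_pair dsnd_pair.
- move=> a g E1 E2 [gm s1] s2; split; first exact: mor_scale.
  have [g' gm' h'] := lift _ _ _ E2 (mor_id Y).
  have am := mor_scale a (mor_id Y).
  have e := inj _ _ _ _ _ am (splice_mor_scale a s1) (splice_mor_comp s2 h').
  by rewrite -[a *: g]/(fun x => a *: g x) e.
- move=> a g gm; have [E1 s1 _] := pull _ gm; have [E2 s2 u2] := pull _ (mor_scale a gm).
  exists E1, E2; split=> //; apply: u2; [exact: mor_scale (mor_id Y)|exact: mor_id|].
  by have := splice_mor_scale a s1.
Qed.

End ResolutionRepresentation.

(** * Comodules *)

Section SubspaceType.
Local Open Scope ring_scope.
Variables (k : fieldType) (V : lmodType k) (S : V -> Prop) (hS : subspace S).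

Definition subspace_pred of subspace S : {pred V} := fun x => `[< S x >].

Lemma subspace_pred_closed : submod_closed (subspace_pred hS).
Proof.
split; first by apply/asboolP; case: hS.
by move=> a x y /asboolP Sx /asboolP Sy; apply/asboolP; apply: hS.2.
Qed.

HB.instance Definition _ := GRing.isSubmodClosed.Build k V (subspace_pred hS)
  subspace_pred_closed.

Record subspace_type := SubspaceElt { subspace_val : V; _ : subspace_val \in subspace_pred hS }.

HB.instance Definition _ := [isSub for subspace_val].
HB.instance Definition _ := [Choice of subspace_type by <:].
HB.instance Definition _ := [SubChoice_isSubLmodule of subspace_type by <:].

Lemma subspace_valP (x : subspace_type) : S (subspace_val x).
Proof. by case: x => x /= /asboolP. Qed.

Definition subspace_elt x (Sx : S x) : subspace_type := SubspaceElt (asboolT Sx).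

Lemma subspace_val_linear : linear subspace_val.
Proof. by []. Qed.

End SubspaceType.

Section ComoduleActions.
Local Open Scope ring_scope.
Variables (k : fieldType) (B : coalgebra k).
Implicit Types (f g : dual B) (M N : comodule B).

Lemma dual_sep (c c' : B) : (forall f, f c = f c') -> c = c'.
Proof. by move=> h; apply: functional_eq => f hf; apply: (h (Dual hf)). Qed.

(** Lets comodule axioms and comodule homomorphisms be checked on the action of the dual algebra
    instead of inside tensor products. *)
Lemma dual_act_sep (V : lmodType k) (z z' : tensor B V) :
  (forall f, dual_act f z = dual_act f z') -> z = z'.
Proof. by move=> h; apply: tens_eq => f hf; apply: (h (Dual hf)). Qed.

Lemma comod_dot_linear M f : linear (comod_dot (M := M) f).
Proof. exact: lin_comp (dual_act_linear f) (@coact_linear _ _ M). Qed.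

Lemma comod_dot1 M (x : M) : dual_one B |> x = x.
Proof. exact: coact1. Qed.

Lemma comod_dotDl M f g (x : M) : (f + g) |> x = f |> x + g |> x.
Proof.
rewrite /comod_dot; move: (coact x) => z.
have h := @dual_act_linear k B M.
have hs : linear (fun z => dual_act f z + dual_act g z : M).
  by move=> a u v; rewrite !h scalerDr addrACA.
by move: z; apply: (tens_ext (h _) hs) => c m; rewrite !dual_actE scalerDl.
Qed.

Lemma comod_homE M N (h : M -> N) f x : comod_hom h -> h (f |> x) = f |> h x.
Proof. by move=> [hl hc]; rewrite /comod_dot hc dual_act_tmap. Qed.

Lemma comod_homP M N (h : M -> N) :
  linear h -> (forall f x, h (f |> x) = f |> h x) -> comod_hom h.
Proof.
move=> hl hf; split=> // x; apply: dual_act_sep => f.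
by rewrite dual_act_tmap // -/(comod_dot f x) hf.
Qed.

Section Builder.
Variables (V : lmodType k) (rho : V -> tensor B V).
Hypothesis rho_linear : linear rho.
Hypothesis rho_mul : forall f g x,
  dual_act (dual_mul f g) (rho x) = dual_act f (rho (dual_act g (rho x))).
Hypothesis rho_one : forall x, dual_act (dual_one B) (rho x) = x.

Lemma comodule_of_coassoc x : tassoc (tmap (@comul _ B) id (rho x)) = tmap id rho (rho x).
Proof.
apply: dual_act_sep => g; rewrite dual_act_tmap //; apply: dual_act_sep => f.
by rewrite -rho_mul -dual_act_mul dual_act_tmap //; apply: dual_act_linear.
Qed.

Definition comodule_of : comodule B := Comodule rho_linear comodule_of_coassoc rho_one.

End Builder.

Section Subcomodule.
Variables (M : comodule B) (S : M -> Prop) (hS : subspace S).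
Hypothesis Sdot : forall f x, S x -> S (f |> x).

Local Notation i := (@subspace_val k M S hS).

(** Over a field, a linear retraction onto [S] carries the coaction from B (x) M to B (x) S, so that
    B (x) S need not be identified with a subspace of B (x) M. *)
Lemma subcomod_retraction : {r : M -> subspace_type hS | linear r & forall x, r (i x) = x}.
Proof.
apply: cid2; apply: (@linear_extend k _ _ _ i id) => //; exact: val_inj.
Qed.

Definition subcomod_retr : M -> subspace_type hS := s2val subcomod_retraction.
Local Notation r := subcomod_retr.

Lemma subcomod_retr_linear : linear r.
Proof. exact: s2valP. Qed.

Lemma subcomod_retrE x : r (i x) = x.
Proof. exact: (s2valP' subcomod_retraction). Qed.

Definition subcomod_coact (x : subspace_type hS) : tensor B (subspace_type hS) :=
  tmap id r (coact (i x)).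

Lemma subcomod_coact_linear : linear subcomod_coact.
Proof.
apply: lin_comp; first exact: tmap_linear (lin_id (U := B)) subcomod_retr_linear.
exact: lin_comp (@coact_linear _ _ M) (@subspace_val_linear _ _ _ hS).
Qed.

Lemma subcomod_dot f x : i (dual_act f (subcomod_coact x)) = f |> i x.
Proof.
rewrite /subcomod_coact dual_act_tmap; last exact: subcomod_retr_linear.
rewrite -/(comod_dot f (i x)).
have Sx : S (f |> i x) by apply: Sdot; apply: subspace_valP.
by rewrite -[f |> i x]/(i (subspace_elt hS Sx)) subcomod_retrE.
Qed.

Lemma subcomod_mul f g x : dual_act (dual_mul f g) (subcomod_coact x) =
  dual_act f (subcomod_coact (dual_act g (subcomod_coact x))).
Proof. by apply: val_inj; rewrite /= !subcomod_dot comod_dot_mul. Qed.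

Lemma subcomod_one x : dual_act (dual_one B) (subcomod_coact x) = x.
Proof. by apply: val_inj; rewrite /= subcomod_dot comod_dot1. Qed.

Definition subcomod : comodule B :=
  comodule_of subcomod_coact_linear subcomod_mul subcomod_one.

Lemma subcomod_val_hom : comod_hom (i : subcomod -> M).
Proof. by apply: comod_homP => // f x; apply: subcomod_dot. Qed.

End Subcomodule.

Section CokernelComodule.
Variables (M N : comodule B) (h : M -> N).
Hypothesis hh : comod_hom h.
Local Notation hl := (proj1 hh).
Local Notation pi := (cokpi hl).

Definition coker_coact (q : coker hl) : tensor B (coker hl) :=
  tmap id pi (coact (cokrep q)).

Lemma coker_coact_pre_linear : linear (fun x : N => tmap id pi (coact x)).
Proof.
exact: lin_comp (tmap_linear (lin_id (U := B)) (cokpi_linear hl)) (@coact_linear _ _ N).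
Qed.

Lemma coker_coact_pre0 x : tmap id pi (coact (h x)) = 0.
Proof.
apply: dual_act_sep => f; rewrite dual_act_tmap; last exact: cokpi_linear.
by rewrite -/(comod_dot f (h x)) -comod_homE // [LHS]cokpi0 (lin0 (dual_act_linear f)).
Qed.

Lemma coker_coactE x : coker_coact (pi x) = tmap id pi (coact x).
Proof. exact: (cokrepE hl coker_coact_pre_linear coker_coact_pre0). Qed.

Lemma coker_coact_linear : linear coker_coact.
Proof. exact: (cokrep_linear (hf := hl) coker_coact_pre_linear coker_coact_pre0). Qed.

Lemma coker_dot f x : dual_act f (coker_coact (pi x)) = pi (f |> x).
Proof. by rewrite coker_coactE dual_act_tmap //; apply: cokpi_linear. Qed.

Lemma coker_mul f g q : dual_act (dual_mul f g) (coker_coact q) =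
  dual_act f (coker_coact (dual_act g (coker_coact q))).
Proof. by elim/coker_ind1: q => x; rewrite !coker_dot comod_dot_mul. Qed.

Lemma coker_one q : dual_act (dual_one B) (coker_coact q) = q.
Proof. by elim/coker_ind1: q => x; rewrite coker_dot comod_dot1. Qed.

Definition coker_comod : comodule B := comodule_of coker_coact_linear coker_mul coker_one.

Lemma coker_pi_hom : comod_hom (pi : N -> coker_comod).
Proof.
by apply: comod_homP; [apply: cokpi_linear|move=> f x; rewrite -[RHS]/(dual_act _ _) coker_dot].
Qed.

Hypothesis hi : injective h.

Lemma coker_surj (q : coker_comod) : exists x, pi x = q.
Proof. by exists (cokrep q); apply: cokrepK. Qed.

Lemma coker_exact (x : N) : (pi x : coker_comod) = 0 <-> exists y, h y = x.
Proof.
split=> [/(cokpiP hl)[y yE]|[y <-]]; last exact: cokpi0.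
by exists y; rewrite yE subr0.
Qed.

Definition coker_ses : ses (coker_comod : comod_cat B) (M : comod_cat B) :=
  @Ses k (comod_cat B) coker_comod M N h pi hh coker_pi_hom hi coker_surj coker_exact.

End CokernelComodule.

Section Coefficients.
Variables (M : comodule B) (p : M -> k^o).
Hypothesis pl : linear p.

(** The matrix coefficients of [p]: this is the homomorphism M -> B that corresponds to the
    functional [p] by cofreeness of B. *)
Definition coeff (x : M) : B := tlift (fun (b : B) (m : M) => (p m : k) *: b) (coact x).

Lemma coeff_linear : linear coeff.
Proof. exact: lin_comp (tlift_linear (bil_scaler B pl)) (@coact_linear _ _ M). Qed.

Lemma dual_coeff f x : f (coeff x) = p (f |> x).
Proof.
rewrite /coeff /comod_dot; move: (coact x); apply: tens_ext.
- exact: lin_comp (dual_linear f) (tlift_linear (bil_scaler B pl)).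
- exact: lin_comp pl (dual_act_linear f).
move=> b m; rewrite (tliftE (bil_scaler B pl)) dual_actE (linZ (dual_linear f)) (linZ pl).
exact: mulrC.
Qed.

Lemma coeff_hom : comod_hom (coeff : M -> reg_comod B).
Proof.
apply: comod_homP => [|f x]; first exact: coeff_linear.
apply: dual_sep => g; rewrite dual_coeff -comod_dot_mul -dual_coeff.
exact: dual_mulE.
Qed.

Lemma counit_coeff x : counit (coeff x) = p x.
Proof. by rewrite -[LHS]/(dual_one B _) dual_coeff comod_dot1. Qed.

End Coefficients.

Lemma comod_factorizing : factorizing (comod_cat B).
Proof.
split=> [X Y T S f [fl fc]|X Y T S f [fl fc]].
  have il := inc_lin S; have ih : comod_hom (inc S) := inc_mor S.
  apply: comod_homP => [a x y|g x]; apply: (inc_inj S); first by rewrite fl il.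
  by rewrite (comod_homE g (f x) ih) -(@comod_homE _ _ (fun t => inc S (f t))).
have pl := prj_lin S; have ph : comod_hom (prj S) := prj_mor S.
apply: comod_homP => [a x y|g x].
  have [e <-] := prj_surj S x; have [e' <-] := prj_surj S y.
  by rewrite -pl fl.
have [e <-] := prj_surj S x.
by rewrite -(comod_homE g e ph) (@comod_homE _ _ (fun t => f (prj S t))).
Qed.

Lemma comod_has_pullbacks : has_pullbacks (comod_cat B).
Proof.
move=> X X' Y g S gm; have gl : linear g := mor_linear gm.
have gh : comod_hom g := gm; have ph : comod_hom (prj S) := prj_mor S.
pose D : comodule B := dsum_comod (mid S) X'.
have fh : comod_hom (fst : D -> (mid S : comodule B)) by exact: dsum_fst_hom.
have sh : comod_hom (snd : D -> (X' : comodule B)) by exact: dsum_snd_hom.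
pose P (z : D) := prj S z.1 = g z.2.
have sP : subspace P.
  rewrite /P; split=> [|a x y Px Py] /=; first by rewrite (lin0 (prj_lin S)) (lin0 gl).
  by rewrite prj_lin gl Px Py.
have dP f z : P z -> P (f |> z).
  rewrite /P (comod_homE f z fh) (comod_homE f z sh) (comod_homE f _ ph) => ->.
  by rewrite (comod_homE f _ gh).
pose Q := subcomod sP dP; pose i : Q -> D := @subspace_val k D P sP.
have ih : comod_hom i := subcomod_val_hom sP dP.
have iP z : P (i z) := subspace_valP z.
have yP y : P (inc S y, 0) by rewrite /P /= prj_inc (lin0 gl).
pose inc' (y : car Y) : Q := subspace_elt sP (yP y).
have into (T : comodule B) (h : T -> D) (hP : forall t, P (h t)) : comod_hom h ->
    comod_hom (fun t => subspace_elt sP (hP t) : Q).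
  move=> hh; have hl := hh.1; have il := ih.1.
  have ii : injective i by exact: val_inj.
  apply: comod_homP => [a x y|f x]; apply: ii; first by rewrite il; apply: hl.
  by rewrite (comod_homE f _ ih); apply: (comod_homE f x hh).
have inc_hom : comod_hom inc'.
  apply: (into Y (fun y => (inc S y, 0) : D)).
  exact: (dsum_pair_hom (inc_mor S) (comod_hom_zero Y X')).
pose prj' (z : Q) : car X' := (i z).2.
have prj_hom : comod_hom prj' by apply: comod_hom_comp sh ih.
have inc_i : injective inc' by move=> y y' /(congr1 i) [] /(inc_inj S).
have prj_s x : exists z, prj' z = x.
  have [e eE] := prj_surj S (g x); have Pz : P (e, x) by [].
  by exists (subspace_elt sP Pz).
have ex z : prj' z = 0 <-> exists y, inc' y = z.
  split=> [z0|[y <-]] //; have := iP z; rewrite /P -/(prj' z) z0 (lin0 gl).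
  move=> /(ses_exact S)[y yE]; exists y; apply: val_inj.
  by rewrite [RHS]surjective_pairing -yE; congr (_, _); apply: esym z0.
exists (@Ses k (comod_cat B) X' Y Q inc' prj' inc_hom prj_hom inc_i prj_s ex).
  exists (fun z => (i z).1); split=> //; first exact: comod_hom_comp fh ih.
  by move=> z; apply: esym (iP z).
move=> X2 Y2 f2 g2 T f2m g2m [h [hm h1 h2]].
have hP e : P (h e, g2 (prj T e)) by rewrite /P /= h2.
exists (fun e => subspace_elt sP (hP e) : Q); split=> //=.
- apply: (into (mid T) (fun e => (h e, g2 (prj T e)) : D)).
  by apply: dsum_pair_hom => //; apply: comod_hom_comp g2m (prj_mor T).
- move=> y; apply: val_inj; rewrite /= h1 prj_inc; congr (_, _).
  exact: lin0 (mor_linear g2m).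
Qed.

End ComoduleActions.

(** * Conilpotent coalgebras *)

Section Augmentation.
Local Open Scope ring_scope.
Variables (k : fieldType) (B : coalgebra k) (g : coaugmentation B).
Implicit Types (f h : dual B) (M N : comodule B) (s : seq (dual B)).

Local Notation u := (g 1).

Definition aug f : Prop := f u = 0.
Definition augs s : bool := all (fun f => `[< aug f >]) s.

Lemma augs_rcons s f : augs (rcons s f) = `[< aug f >] && augs s.
Proof. exact: all_rcons. Qed.

Lemma counit_u : counit u = 1.
Proof. by case: (coaug_hom g) => _ _ ->. Qed.

Lemma comul_u : comul u = tens u u.
Proof. by case: (coaug_hom g) => _ -> _; rewrite /= /kcomul tmapE //; apply: coaug_linear. Qed.

Lemma dual_mul_u f h : dual_mul f h u = (f u : k) * h u.
Proof. by rewrite /= comul_u (tliftE (dual_pair_bilin f h)). Qed.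

Lemma aug_mulr f h : aug f -> aug (dual_mul f h).
Proof. by rewrite /aug dual_mul_u => ->; rewrite mul0r. Qed.

Lemma augs_prod s : augs s -> (0 < size s)%N -> aug (\prod_(f <- s) f).
Proof.
case: s => // f s /= /andP[/asboolP af _] _; rewrite big_cons.
exact: (aug_mulr _ af).
Qed.

Lemma aug_split f : f = dual_const B (f u) + (f - dual_const B (f u)).
Proof. by rewrite addrC subrK. Qed.

Lemma aug_sub f : aug (f - dual_const B (f u)).
Proof. by rewrite /aug /= counit_u mulr1 subrr. Qed.

Lemma reg_span_u (c : B) : (forall f, aug f -> f c = 0) -> c = (counit c : k) *: u.
Proof.
move=> h; apply: dual_sep => f; rewrite (linZ (dual_linear f)) {1}[f]aug_split /=.
by rewrite -[LHS]/(_ * _ + (f - dual_const B (f u)) c) h ?addr0; [apply: mulrC|apply: aug_sub].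
Qed.

(** Topological nilpotency of the augmentation ideal of the dual algebra. In this form conilpotency
    passes easily to the coopposite coalgebra and to comodules. *)
Definition locally_nilpotent : Prop :=
  forall c : B, exists N : nat, forall s, augs s -> (N <= size s)%N -> (\prod_(f <- s) f) c = 0.

Lemma iter_ncomul_linear (D : ncoalgebra k) m : linear (iter_ncomul (D := D) m).
Proof.
elim: m => [|m IH] //=.
exact: lin_comp (tmap_linear (lin_id (U := D)) IH) (@ncomul_linear _ D).
Qed.

(** The last factor of a product vanishes at [u], hence descends to B / ku; contracting the iterated
    comultiplication with it lowers [m] by one. For [m] = 0 the element is a multiple of [u], and
    one factor is still needed, whence [m.+1]. *)
Lemma conilpotent_locally_nilpotent : conilpotent g -> locally_nilpotent.
Proof.
move=> cn c; have [m _ mP] := cn (quot_pi g c); exists m.+1.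
elim: m c mP => [|m IH] c /= mP s.
  move=> sa s0; have /(cokpiP (coaug_linear g))[a] : quot_pi g c = quot_pi g 0.
    by rewrite mP (lin0 (@quot_pi_linear _ _ _)).
  rewrite subr0 => <-; have -> : g a = (a : k) *: u.
    by rewrite -(linZ (coaug_linear g)) -[_ *: _]/(_ * _) mulr1.
  have -> := linZ (dual_linear (\prod_(f <- s) f)).
  by have -> : (\prod_(f <- s) f) u = 0 := augs_prod sa s0; rewrite scaler0.
case/lastP: s => // s f; rewrite augs_rcons size_rcons ltnS.
move=> /andP[/asboolP af sa] ms; rewrite -cats1 big_cat big_seq1.
have -> : ((\prod_(i <- s) i) * f : dual B) c =
    (\prod_(i <- s) i) (comod_dot (M := reg_comod B) f c).
  exact: dual_mulE.
apply: IH sa ms.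
have f0 a : f (g a) = 0.
  rewrite -[a]mulr1 -[a * 1]/(a *: (1 : k^o)) (linZ (coaug_linear g)) (linZ (dual_linear f)).
  by rewrite [f _]af scaler0.
have fl := cokrep_linear (hf := coaug_linear g) (dual_linear f) f0.
have il := @iter_ncomul_linear (quot_coalg g) m.
have pl := @quot_pi_linear _ _ g.
have := congr1 (contract (fun q => f (cokrep q))) mP.
rewrite (lin0 (contract_linear fl)) quot_comulE contract_tmap // contract_tmap //.
have -> // : (fun c => f (cokrep (quot_pi g c))) = f.
by apply/funext => d; apply: (cokrepE (coaug_linear g) (dual_linear f) f0).
Qed.

(** By [soc_mor] and [mor_soc], these elements are the values at 1 of the homomorphisms k -> M. *)
Definition soc M (x : M) : Prop := forall f, aug f -> f |> x = 0.

Lemma socE M (x : M) f : soc x -> f |> x = (f u : k) *: x.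
Proof.
by move=> sx; rewrite {1}[f]aug_split comod_dotDl dual_const_dot sx ?addr0 //; apply: aug_sub.
Qed.

Lemma socP M (x : M) : (forall f, f |> x = (f u : k) *: x) -> soc x.
Proof. by move=> h f af; rewrite h [f u]af scale0r. Qed.

Lemma soc_subspace M : subspace (@soc M).
Proof.
split=> [f af|a x y sx sy f af]; first exact: lin0 (comod_dot_linear f).
by rewrite comod_dot_linear sx // sy // scaler0 addr0.
Qed.

Lemma soc_hom M N (h : M -> N) x : comod_hom h -> soc x -> soc (h x).
Proof.
by move=> hh sx f af; rewrite -comod_homE // sx // (lin0 hh.1).
Qed.

(** The counit of [f |> c] is [f c], so that the augmentation ideal vanishes at an element of the
    socle. *)
Lemma soc_reg (c : reg_comod B) : soc c -> c = (counit c : k) *: u.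
Proof.
move=> sc; apply: reg_span_u => f af.
have := dual_mulE (dual_one B) f c; rewrite sc // (lin0 (dual_linear _)).
by rewrite dual_mul1r.
Qed.

Lemma soc_unit : soc (u : reg_comod B).
Proof. by apply: socP => f; rewrite /comod_dot /= comul_u dual_actE. Qed.

Lemma soc_triv (a : triv_comod g) : soc a.
Proof. by apply: socP => f; apply: dual_actE. Qed.

Lemma soc_mor M (x : M) : soc x ->
  comod_hom (fun a : triv_comod g => (a : k) *: x).
Proof.
move=> sx; have l : linear (fun a : triv_comod g => (a : k) *: x).
  by move=> a b c; rewrite scalerDl -scalerA.
apply: comod_homP => // f a; rewrite (linZ (comod_dot_linear f)) (socE f sx).
transitivity (((f u : k) * a) *: x); last by rewrite scalerA mulrC.
by congr (_ *: x); apply: (dual_actE f u (a : k^o)).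
Qed.

Lemma mor_soc M (h : triv_comod g -> M) a : comod_hom h -> soc (h a).
Proof. by move=> hh; apply: soc_hom hh _; apply: soc_triv. Qed.

Definition act M s (x : M) : M := foldr (fun f y => f |> y) x s.

Lemma act_prod M s (x : M) : act s x = (\prod_(f <- s) f) |> x.
Proof.
elim: s => [|f s IH] /=; first by rewrite big_nil comod_dot1.
by rewrite big_cons IH -comod_dot_mul.
Qed.

Lemma act_linear M s : linear (act s : M -> M).
Proof.
by elim: s => [|f s IH] //; apply: lin_comp (comod_dot_linear f) IH.
Qed.

Lemma act_rcons M s f (x : M) : act (rcons s f) x = act s (f |> x).
Proof. by rewrite /act -cats1 foldr_cat. Qed.

Lemma act_cat M s t (x : M) : act (s ++ t) x = act s (act t x).
Proof. exact: foldr_cat. Qed.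

Lemma act_hom M N (h : M -> N) s x : comod_hom h -> h (act s x) = act s (h x).
Proof. by move=> hh; elim: s => [|f s IH] //=; rewrite comod_homE // IH. Qed.

Hypothesis ln : locally_nilpotent.

(** The coaction of [x] involves finitely many elements of B, and the maximum of their bounds
    works. *)
Lemma comod_nilpotent M (x : M) :
  exists N : nat, forall s, augs s -> (N <= size s)%N -> act s x = 0.
Proof.
suff [N NP] : exists N : nat, forall s, augs s -> (N <= size s)%N ->
    dual_act (\prod_(f <- s) f) (coact x) = 0.
  by exists N => s sa Ns; rewrite act_prod; apply: NP.
elim/tens_ind1: (coact x) => r; rewrite tclsE; elim: r => [|[b m] r [N IH]].
  by exists 0%N => s _ _; rewrite big_nil (lin0 (dual_act_linear _)).
have [N' N'P] := ln b; exists (maxn N N') => s sa; rewrite geq_max => /andP[h h'].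
rewrite big_cons (linD (dual_act_linear _)) dual_actE IH // addr0.
by rewrite N'P // scale0r.
Qed.

(** The socle is essential: elements of the augmentation ideal are applied as long as the result
    stays nonzero, which ends by nilpotency. *)
Lemma soc_neq0 M (x : M) : x <> 0 -> exists s, [/\ augs s, act s x <> 0 & soc (act s x)].
Proof.
have [N] := comod_nilpotent x; elim: N x => [|N IH] x NP x0.
  by case: x0; apply: (NP [::]).
have [sx|nsx] := pselect (soc x); first by exists [::].
have [f [af fx]] : exists f, aug f /\ f |> x <> 0.
  apply: contrapT => nf; apply: nsx => f af; apply: contrapT => fx.
  by apply: nf; exists f.
have [|s [sa s0 ss]] := IH _ _ fx.
  move=> s sa Ns; rewrite -act_rcons; apply: NP; last by rewrite size_rcons.
  by rewrite augs_rcons sa andbT; apply/asboolP.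
exists (rcons s f); rewrite act_rcons; split=> //.
by rewrite augs_rcons sa andbT; apply/asboolP.
Qed.

Fixpoint cofree r : comodule B :=
  if r is r'.+1 then dsum_comod (reg_comod B) (cofree r') else zcomod B.

Fixpoint cofree_map M r (p : nat -> M -> k^o) : M -> cofree r :=
  match r return M -> cofree r with
  | 0 => fun=> 0
  | r'.+1 => fun x => (coeff (p 0) x, cofree_map r' (fun i => p i.+1) x)
  end.

Lemma cofree_map_hom M r (p : nat -> M -> k^o) : (forall i, linear (p i)) ->
  comod_hom (cofree_map r p).
Proof.
elim: r p => [|r IH] p pl /=; first exact: comod_hom_zero.
by apply: dsum_pair_hom; [apply: coeff_hom|apply: IH].
Qed.

Lemma cofree_map0 M r (p : nat -> M -> k^o) x : (forall i, linear (p i)) ->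
  cofree_map r p x = 0 -> forall i, (i < r)%N -> p i x = 0.
Proof.
elim: r p => [|r IH] p pl //= [h1 h2] [_|i ir]; last first.
  by apply: (IH (fun i => p i.+1)).
by rewrite -counit_coeff // h1 (lin0 (@counit_linear _ _)).
Qed.

(** The socle of B^r is k^r by [soc_reg], so that an element of it is determined by its counits
    [a i]. *)
Lemma cofree_map_soc M r (p : nat -> M -> k^o) (y : cofree r) : (forall i, linear (p i)) ->
  soc y -> exists a : nat -> k, forall x : M, soc x ->
    (forall i, (i < r)%N -> p i x = a i) -> cofree_map r p x = y.
Proof.
elim: r p y => [|r IH] p y pl sy; first by exists (fun=> 0) => x _ _; rewrite [RHS]zcomod_eq0.
have [|a aP] := IH (fun i => p i.+1) y.2 (fun i => pl _).
  by have := soc_hom (dsum_snd_hom _ _) sy.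
have /soc_reg e : soc (y.1 : reg_comod B) by have := soc_hom (dsum_fst_hom _ _) sy.
exists (fun i => if i is i'.+1 then a i' else counit y.1) => x sx px.
rewrite [y]surjective_pairing -(aP x sx) => [|i ir]; last by rewrite px.
congr (_, _); rewrite [RHS]e; have s1 := soc_hom (coeff_hom (pl 0)) sx.
by rewrite [LHS](soc_reg s1) counit_coeff // px.
Qed.

(** The injective envelope of M: coordinates on the socle, extended to M, define the map. It is
    injective on the socle, hence injective by essentiality; surjectivity on socles is the
    minimality of the envelope. *)
Lemma comod_embed M r (e : 'I_r -> M) :
  free_family e -> (forall i, soc (e i)) -> spans e (@soc M) ->
  exists h : M -> cofree r, [/\ comod_hom h, injective h
    & forall y, soc y -> exists2 x, soc x & h x = y].
Proof.
move=> fe se sp; have [p [pl pe pc]] := free_coord fe.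
pose p' i : M -> k^o := if insub i is Some j then p j else fun=> 0.
have p'l i : linear (p' i) by rewrite /p'; case: insub => [j|] //; apply: lin_cst0.
have p'E (i : 'I_r) : p' i = p i by rewrite /p' valK.
have hh := cofree_map_hom r p'l; set h := cofree_map r p' in hh.
have s0 x : soc x -> h x = 0 -> x = 0.
  move=> /sp[s ->] /(cofree_map0 p'l) h0; apply: comb_coef0 => i.
  by rewrite -pc -p'E h0.
exists h; split=> // [x y xy|y sy].
  apply: contrapT => nxy; have [|s [sa sn ss]] := @soc_neq0 _ (x - y).
    by move=> /eqP; rewrite subr_eq0 => /eqP.
  apply: sn; apply: s0 ss _; rewrite act_hom // (linB hh.1) xy subrr.
  exact: lin0 (act_linear s).
have [a aP] := cofree_map_soc p'l sy; exists (\sum_(i < r) a i *: e i).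
  apply: (big_ind (fun x => soc x)) => [|x x'|i _]; first by case: (soc_subspace M).
    exact: subspaceD (soc_subspace M).
  exact: subspaceZ (soc_subspace M) _.
apply: aP => [|i ir].
  apply: (big_ind (fun x => soc x)) => [|x x'|j _]; first by case: (soc_subspace M).
    exact: subspaceD (soc_subspace M).
  exact: subspaceZ (soc_subspace M) _.
have := comb_ord e (fun j => j) (fun i : 'I_r => a i) => <-.
rewrite (p'E (Ordinal ir)) pc.
by have := coef_ord (fun i : 'I_r => a i) (Ordinal ir) (fun _ _ => id).
Qed.

End Augmentation.

Arguments soc_unit {k B} g.
Arguments soc_triv {k B} g a.

Section CofreeInjective.
Local Open Scope ring_scope.
Variables (k : fieldType) (B : coalgebra k).

(** A homomorphism into B amounts to a functional by cofreeness, and functionals extend. *)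
Lemma reg_injective : injective_ob (reg_comod B : comod_cat B).
Proof.
move=> X Y S f fh; have fl := mor_linear fh.
have [F Fl FE] := linear_extend (inc_lin S) (@inc_inj _ _ _ _ S)
  (lin_comp (@counit_linear _ B) fl).
exists (coeff (F : (mid S : comodule B) -> k^o)); first exact: coeff_hom.
move=> y; apply: dual_sep => h; rewrite dual_coeff //.
have ih : comod_hom (inc S) := inc_mor S.
rewrite -(comod_homE h y ih) FE (comod_homE h y (fh : comod_hom f)).
by rewrite -[RHS]/(h (f y)) -[in RHS](dual_mul1r h) dual_mulE.
Qed.

Lemma dsum_injective (J1 J2 : comod_cat B) : injective_ob J1 -> injective_ob J2 ->
  injective_ob (dsum J1 J2).
Proof.
move=> i1 i2 X Y S f fm.
have [s1 m1 e1] := i1 X Y S _ (mor_comp (mor_dfst J1 J2) fm).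
have [s2 m2 e2] := i2 X Y S _ (mor_comp (mor_dsnd J1 J2) fm).
exists (fun e => dpair (s1 e) (s2 e)); first exact: mor_dpair.
by move=> y; rewrite e1 e2 dpair_eta.
Qed.

Lemma cofree_injective r : injective_ob (cofree B r : comod_cat B).
Proof.
elim: r => [|r IH]; last exact: dsum_injective reg_injective IH.
move=> X Y S f fm; exists (fun=> 0); first exact: mor_zero.
by move=> y; rewrite [RHS]zcomod_eq0.
Qed.

End CofreeInjective.

Section Coopposite.
Local Open Scope ring_scope.
Variables (k : fieldType) (C : coalgebra k).

Definition tswap (V W : lmodType k) : tensor V W -> tensor W V :=
  tlift (fun v w => tens w v).

Lemma tswap_bilin (V W : lmodType k) : bilin (fun (v : V) (w : W) => tens w v).
Proof. by split=> [w|v]; [apply: (@tens_bilin k W V).2|apply: (@tens_bilin k W V).1]. Qed.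

Lemma tswap_linear (V W : lmodType k) : linear (@tswap V W).
Proof. exact: tlift_linear (tswap_bilin V W). Qed.

Lemma tswapE (V W : lmodType k) (v : V) (w : W) : tswap (tens v w) = tens w v.
Proof. exact: tliftE (tswap_bilin V W) _ _. Qed.

Definition cop_comul (c : C) : tensor C C := tswap (comul c).

Lemma cop_comul_linear : linear cop_comul.
Proof. exact: lin_comp (@tswap_linear C C) (@comul_linear _ C). Qed.

Lemma contract_cop (f h : dual C) c : h (contract f (cop_comul c)) = dual_mul f h c.
Proof.
rewrite /cop_comul /=; move: (comul c); apply: tens_ext.
- apply: lin_comp (dual_linear h) _; apply: lin_comp (@tswap_linear C C).
  exact: contract_linear (dual_linear f).
- exact: tlift_linear (dual_pair_bilin f h).
move=> x y; rewrite tswapE contractE; last exact: dual_linear.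
by rewrite (linZ (dual_linear h)) (tliftE (dual_pair_bilin f h)).
Qed.

Lemma contract_assoc (f h : dual C) (y : tensor C C) (b : C) :
  contract h (contract f (tassoc (tens y b))) = (h (contract f y) : k) *: b.
Proof.
have fl W := @contract_linear k C W f (dual_linear f).
have hl W := @contract_linear k C W h (dual_linear h).
have L1 : linear (fun y : tensor C C => contract h (contract f (tassoc (tens y b)))).
  apply: lin_comp (hl C) _; apply: lin_comp (fl (tensor C C)) _.
  by apply: lin_comp (@tassoc_linear _ C C C) _; apply: (@tens_bilin k _ C).1.
have L2 : linear (fun y : tensor C C => (h (contract f y) : k) *: b).
  by move=> a x z; rewrite fl (dual_linear h) scalerDl scalerA.
move: y; apply: (tens_ext L1 L2) => v w.
rewrite tassocE !contractE; try exact: dual_linear.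
rewrite (linZ (hl C)) contractE; last exact: dual_linear.
by rewrite (linZ (dual_linear h)) scalerA.
Qed.

(** Paired with three functionals, the two sides become the two bracketings of a product in the dual
    algebra of C, so that [dual_mulA] applies; such pairings separate points. *)
Lemma cop_comulA c :
  tassoc (tmap cop_comul id (cop_comul c)) = tmap id cop_comul (cop_comul c).
Proof.
have cl := cop_comul_linear; have idl := lin_id (U := C).
apply: tens_eq => f fl; apply: tens_eq => h hl; apply: functional_eq => e el.
pose f' := Dual fl; pose h' := Dual hl; pose e' := Dual el.
rewrite (contract_tmap (cop_comul c) fl idl cl).
have -> : e (contract h (cop_comul (contract f (cop_comul c)))) =
    dual_mul f' (dual_mul h' e') c.
  by rewrite -contract_cop -[RHS](contract_cop h' e').
rewrite dual_mulA -(contract_cop (dual_mul f' h') e').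
congr (e _); move: (cop_comul c); apply: tens_ext.
- apply: lin_comp (contract_linear hl) _; apply: lin_comp (contract_linear fl) _.
  by apply: lin_comp (@tassoc_linear _ C C C) _; apply: tmap_linear.
- exact: contract_linear (dual_linear _).
move=> x y; rewrite tmapE // (contract_assoc f' h') contract_cop contractE //.
exact: dual_linear.
Qed.

Lemma cop_counitl c : tlift (fun x y : C => (counit x : k) *: y) (cop_comul c) = c.
Proof.
rewrite -[RHS]counitr /cop_comul; move: (comul c).
have b1 := bil_scalel C (@counit_linear _ C); have b2 := bil_scaler C (@counit_linear _ C).
apply: tens_ext.
- exact: lin_comp (tlift_linear b1) (@tswap_linear C C).
- exact: tlift_linear b2.
by move=> x y; rewrite tswapE (tliftE b1) (tliftE b2).
Qed.

Lemma cop_counitr c : tlift (fun x y : C => (counit y : k) *: x) (cop_comul c) = c.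
Proof.
rewrite -[RHS]counitl /cop_comul; move: (comul c).
have b1 := bil_scalel C (@counit_linear _ C); have b2 := bil_scaler C (@counit_linear _ C).
apply: tens_ext.
- exact: lin_comp (tlift_linear b2) (@tswap_linear C C).
- exact: tlift_linear b1.
by move=> x y; rewrite tswapE (tliftE b1) (tliftE b2).
Qed.

Definition cop : coalgebra k :=
  Coalgebra cop_comul_linear (@counit_linear _ C) cop_comulA cop_counitl cop_counitr.

Definition to_cop (f : dual C) : dual cop := @Dual k cop f (dual_linear f).
Definition of_cop (f : dual cop) : dual C := @Dual k C f (dual_linear f).

Lemma of_copK : cancel of_cop to_cop.
Proof. by move=> f; apply: dual_ext. Qed.

Lemma to_cop_mul f h : dual_mul (to_cop f) (to_cop h) = to_cop (dual_mul h f).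
Proof.
apply: dual_ext => c.
rewrite -[LHS]/(tlift (dual_pair (to_cop f) (to_cop h)) (tswap (@comul k C c))).
rewrite -[RHS]/(tlift (dual_pair h f) (@comul k C c)).
move: (@comul k C c); apply: tens_ext.
- exact: (@lin_comp k (tensor C C) (tensor C C) k^o _ _
    (tlift_linear (dual_pair_bilin (to_cop f) (to_cop h))) (@tswap_linear C C)).
- exact: tlift_linear (dual_pair_bilin h f).
move=> x y; rewrite tswapE (tliftE (dual_pair_bilin (to_cop f) (to_cop h))).
by rewrite (tliftE (dual_pair_bilin h f)) /dual_pair mulrC.
Qed.

Variable g : coaugmentation C.

Lemma cop_coaug_hom : coalg_hom (C := kcoalg k) (D := cop) g.
Proof.
have gl := coaug_linear g; case: (coaug_hom g) => _ h1 h2; split=> // c.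
rewrite -[LHS]/(tswap (comul (g c))) h1 /= /kcomul !tmapE // tswapE.
have -> : g c = (c : k) *: g 1 by rewrite -(linZ gl) -[_ *: _]/(_ * _) mulr1.
by rewrite tensZl tensZr.
Qed.

Definition cop_coaug : coaugmentation cop := Coaugmentation cop_coaug_hom.

Lemma cop_locally_nilpotent : locally_nilpotent g -> locally_nilpotent cop_coaug.
Proof.
move=> ln c; have [N NP] := ln c; exists N => s sa Ns.
(* Passing to the coopposite coalgebra reverses products, and the bound [N] concerns only their
   length. *)
have E t : \prod_(f <- t) f = to_cop (\prod_(f <- rev (map of_cop t)) f).
  elim: t => [|f t IH] /=; first by rewrite !big_nil; apply: dual_ext.
  rewrite big_cons rev_cons -cats1 big_cat big_seq1 /= IH -[X in X * _]of_copK.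
  exact: to_cop_mul.
rewrite E; apply: NP; last by rewrite size_rev size_map.
by rewrite /augs all_rev all_map.
Qed.

End Coopposite.

(** * Modules over the dual algebra *)

Section QuotientModule.
Local Open Scope ring_scope.
Variables (k : fieldType) (C : coalgebra k) (U V : lmodType (dual C)) (h : U -> V).
Hypothesis hh : linear h.

Let hk : linear (h : restr U -> restr V).
Proof. exact: (@mod_hom_linear k C U V h hh). Qed.

(** Cokernels are available for vector spaces, so the quotient is formed after restriction of
    scalars to k, and the action of the dual algebra is added to it. *)
Definition qmod : Type := coker hk.
HB.instance Definition _ := GRing.Zmodule.copy qmod (coker hk).

Definition qpi (x : V) : qmod := cokpi hk (x : restr V).
Definition qmod_scale (f : dual C) (q : qmod) : qmod := qpi (f *: (cokrep q : V)).

Lemma qpiP x y : qpi x = qpi y <-> exists u, h u = x - y.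
Proof. exact: cokpiP. Qed.

Lemma qpi_surj q : exists x, qpi x = q.
Proof. by exists (cokrep q); apply: cokrepK. Qed.

Lemma qpiD x y : qpi (x + y) = qpi x + qpi y.
Proof. exact: (linD (cokpi_linear hk)). Qed.

Lemma qmod_scaleE f x : qmod_scale f (qpi x) = qpi (f *: x).
Proof.
apply/qpiP; have [u hu] := cokrep_rel hk (x : restr V).
by exists (f *: u); rewrite (linZ hh) -scalerBr; congr (_ *: _).
Qed.

Lemma qmod_scaleA f f' q : qmod_scale f (qmod_scale f' q) = qmod_scale (f * f') q.
Proof. by have [x <-] := qpi_surj q; rewrite !qmod_scaleE scalerA. Qed.
Lemma qmod_scale1 : left_id 1 qmod_scale.
Proof. by move=> q; have [x <-] := qpi_surj q; rewrite qmod_scaleE scale1r. Qed.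
Lemma qmod_scaleDr : right_distributive qmod_scale +%R.
Proof.
move=> f q q'; have [x <-] := qpi_surj q; have [y <-] := qpi_surj q'.
by rewrite -qpiD !qmod_scaleE scalerDr qpiD.
Qed.
Lemma qmod_scaleDl q : {morph qmod_scale^~ q : f f' / f + f'}.
Proof. by move=> f f'; have [x <-] := qpi_surj q; rewrite !qmod_scaleE scalerDl qpiD. Qed.
HB.instance Definition _ := GRing.Zmodule_isLmodule.Build (dual C) qmod
  qmod_scaleA qmod_scale1 qmod_scaleDr qmod_scaleDl.

Lemma qpi_linear : linear qpi.
Proof. by move=> f x y; rewrite qpiD; congr (_ + _); apply: esym (qmod_scaleE f x). Qed.

Lemma qmod_factor (W : lmodType (dual C)) (t : V -> W) :
  linear t -> (forall u, t (h u) = 0) ->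
  exists2 t' : qmod -> W, linear t' & forall x, t' (qpi x) = t x.
Proof.
move=> tl t0; have E x : t (cokrep (qpi x) : restr V) = t x.
  have [u hu] := cokrep_rel hk (x : restr V).
  have hu' : h u = (cokrep (qpi x) : V) - x by [].
  by apply/eqP; rewrite -subr_eq0 -(linB tl) -hu' t0.
exists (fun q : qmod => t (cokrep q : restr V)) => // f q q'.
have [x <-] := qpi_surj q; have [y <-] := qpi_surj q'.
by rewrite -qpi_linear !E tl.
Qed.

End QuotientModule.

Section ModuleCategoryProperties.
Local Open Scope ring_scope.
Variables (k : fieldType) (C : coalgebra k).

Lemma mod_factorizing : factorizing (mod_cat C).
Proof.
split=> [X Y T S f fl|X Y T S f fl].
  move=> a x y; apply: (inc_inj S); rewrite (inc_mor S a (f x) (f y)).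
  exact: (fl a x y).
move=> a x y; have [e <-] := prj_surj S x; have [e' <-] := prj_surj S y.
have -> : a *: (prj S e : (X : lmodType (dual C))) + prj S e' = prj S (a *: (e : mid S) + e').
  by rewrite (prj_mor S a e e').
exact: (fl a e e').
Qed.

Lemma mod_has_pushouts : has_pushouts (mod_cat C).
Proof.
move=> X Y Y' f S fm; pose V : lmodType (dual C) := ((Y' : lmodType (dual C)) * mid S)%type.
pose h (y : (Y : lmodType (dual C))) : V := (f y, - (inc S y : mid S)).
have il : linear (inc S : (Y : lmodType (dual C)) -> mid S) := inc_mor S.
have pl : linear (prj S : (mid S : lmodType (dual C)) -> X) := prj_mor S.
have fl : linear (f : (Y : lmodType (dual C)) -> Y') := fm.
have hh : linear h.
  by move=> a x y; rewrite /h fl il opprD -scalerN.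
pose Q : mod_cat C := qmod hh.
pose inc' (y : car Y') : car Q := qpi hh (y, 0).
have inc'm : mor inc'.
  move=> a x y; rewrite /inc' -[RHS](qpi_linear hh); congr (qpi hh (_, _)).
  by rewrite /= scaler0 addr0.
have [||prj' prj'm prj'E] := @qmod_factor _ _ _ _ h hh X (fun z : V => prj S z.2).
- by move=> a x y /=; rewrite pl.
- by move=> y; rewrite /= -scaleN1r (linZ pl) prj_inc; apply: scaler0.
have inc'i : injective inc'.
  move=> y y' /(qpiP hh)[u [e1 e2]]; apply/eqP; rewrite -subr_eq0 -e1.
  suff -> : u = 0 by rewrite (lin0 fl).
  apply: (inc_inj S); rewrite (lin0 (inc_lin S)); apply/eqP.
  by rewrite -oppr_eq0; apply/eqP; rewrite [LHS]e2 subrr.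
have prj's x : exists z, prj' z = x.
  by have [e <-] := prj_surj S x; exists (qpi hh (0, e)); rewrite prj'E.
have ex z : prj' z = 0 <-> exists y, inc' y = z.
  split=> [|[y <-]]; last by rewrite prj'E (lin0 (prj_lin S)).
  have [[y e] <-] := qpi_surj z; rewrite prj'E /= => /(ses_exact S)[u <-].
  exists (f u + y : car Y'); apply/(qpiP hh); exists u.
  by rewrite /h; congr (_, _); rewrite /= ?addrK ?sub0r.
exists (@Ses k (mod_cat C) X Y' Q inc' prj' inc'm prj'm inc'i prj's ex).
  exists (fun e => qpi hh (0, e)); split=> /=.
  - move=> a x y; rewrite -[RHS](qpi_linear hh); congr (qpi hh (_, _)).
    by rewrite /= scaler0 addr0.
  - move=> y; apply/(qpiP hh); exists (- (y : (Y : lmodType (dual C)))).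
    rewrite /h -!scaleN1r (linZ fl) (linZ il) !scaleN1r opprK.
    by congr (_, _); rewrite /= ?sub0r ?subr0.
  - by move=> e; rewrite prj'E.
move=> X2 Y2 f2 g2 T f2m g2m [t [tm t1 t2]].
have il2 : linear (inc T : (Y2 : lmodType (dual C)) -> mid T) := inc_mor T.
have tl : linear (t : (mid S : lmodType (dual C)) -> mid T) := tm.
have f2l : linear (f2 : (Y' : lmodType (dual C)) -> Y2) := f2m.
have [||t' t'm t'E] := @qmod_factor _ _ _ _ h hh (mid T)
    (fun z : V => inc T (f2 z.1) + t z.2).
- by move=> a x y /=; rewrite f2l il2 tl scalerDr addrACA.
- by move=> y; rewrite /= -t1 -scaleN1r (linZ tl) scaleN1r; apply: subrr.
exists t'; split=> //= [y|z].
  by rewrite t'E /= (lin0 tl); apply: addr0.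
have [[y e] <-] := qpi_surj z; rewrite prj'E t'E /= t2.
by rewrite (linD (prj_lin T)) prj_inc add0r.
Qed.

End ModuleCategoryProperties.

Section DualModule.
Local Open Scope ring_scope.
Variables (k : fieldType) (C : coalgebra k).
Implicit Types D : comodule (cop C).

Lemma functional_subspace (V : lmodType k) :
  subspace (fun f : V -> k^o => linear f).
Proof.
by split=> [|a f f' fl fl']; [apply: lin_cst0|apply: lin_comb].
Qed.

(** The full linear dual of a right comodule; the dual algebra acts on the left, by precomposition
    with its right action on [D]. *)
Definition dmod D : Type := subspace_type (functional_subspace D).
HB.instance Definition _ D := GRing.Zmodule.copy (dmod D) (subspace_type (functional_subspace D)).

Definition dmod_fun D (x : dmod D) : D -> k^o := subspace_val x.

Lemma dmod_linear D (x : dmod D) : linear (dmod_fun x).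
Proof. exact: (subspace_valP x). Qed.

Definition dmod_of D (f : D -> k^o) (fl : linear f) : dmod D :=
  subspace_elt (functional_subspace D) fl.

Lemma dmodP D (x y : dmod D) : (forall d, dmod_fun x d = dmod_fun y d) -> x = y.
Proof. by move=> h; apply: val_inj; apply: funext. Qed.

Definition dmod_scale D (f : dual C) (x : dmod D) : dmod D :=
  dmod_of (lin_comp (dmod_linear x) (comod_dot_linear (M := D) (to_cop f))).

Lemma dmod_scaleA D f f' (x : dmod D) :
  dmod_scale f (dmod_scale f' x) = dmod_scale (f * f') x.
Proof.
apply: dmodP => d; rewrite /dmod_fun /= -comod_dot_mul.
by rewrite to_cop_mul.
Qed.
Lemma dmod_scale1 D : left_id 1 (@dmod_scale D).
Proof.
move=> x; apply: dmodP => d; rewrite /dmod_fun /=.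
by have -> : to_cop 1 = dual_one (cop C); [apply: dual_ext|rewrite comod_dot1].
Qed.
Lemma dmod_scaleDr D : right_distributive (@dmod_scale D) +%R.
Proof. by move=> f x y; apply: dmodP. Qed.
Lemma dmod_scaleDl D (x : dmod D) : {morph (@dmod_scale D)^~ x : f f' / f + f'}.
Proof.
move=> f f'; apply: dmodP => d; rewrite /dmod_fun /=.
have -> : to_cop (f + f') = to_cop f + to_cop f' by apply: dual_ext.
by rewrite comod_dotDl (linD (dmod_linear x)).
Qed.
HB.instance Definition _ D := GRing.Zmodule_isLmodule.Build (dual C) (dmod D)
  (@dmod_scaleA D) (@dmod_scale1 D) (@dmod_scaleDr D) (@dmod_scaleDl D).

Definition dmod_ob D : mod_cat C := dmod D.

Lemma dmod_scaleE D f (x : dmod D) d : dmod_fun (f *: x) d = dmod_fun x (to_cop f |> d).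
Proof. by []. Qed.

Lemma dmodE D f (x y : dmod D) d :
  dmod_fun (f *: x + y) d = dmod_fun x (to_cop f |> d) + dmod_fun y d.
Proof. by []. Qed.

Definition dmod_pull D D' (h : D -> D') (hh : comod_hom h) (x : dmod D') : dmod D :=
  dmod_of (lin_comp (dmod_linear x) hh.1).

Lemma dmod_pullE D D' (h : D -> D') (hh : comod_hom h) (x : dmod D') d :
  dmod_fun (dmod_pull hh x) d = dmod_fun x (h d).
Proof. by []. Qed.

Lemma dmod_pull_mor D D' (h : D -> D') (hh : comod_hom h) :
  @mor _ (mod_cat C) (dmod D') (dmod D) (dmod_pull hh).
Proof.
move=> f x y; apply: dmodP => d.
by rewrite dmod_pullE !dmodE !dmod_pullE comod_homE.
Qed.

Section DualSes.
Variables (X Y : comod_cat (cop C)) (S : ses X Y).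
Let ih : comod_hom (inc S) := inc_mor S.
Let ph : comod_hom (prj S) := prj_mor S.

Lemma dual_inc_inj : injective (dmod_pull ph).
Proof.
move=> x y e; apply: dmodP => d; have [z <-] := prj_surj S d.
by rewrite -!(dmod_pullE ph) e.
Qed.

Lemma dual_prj_surj x : exists y, dmod_pull ih y = x.
Proof.
have [F Fl FE] := linear_extend (inc_lin S) (@inc_inj _ _ _ _ S) (dmod_linear x).
by exists (dmod_of Fl); apply: dmodP => d; rewrite dmod_pullE -FE.
Qed.

Lemma dual_exact x : dmod_pull ih x = 0 <-> exists y, dmod_pull ph y = x.
Proof.
split=> [x0|[y <-]]; last first.
  by apply: dmodP => d; rewrite !dmod_pullE prj_inc (lin0 (dmod_linear y)).
pose G (p : (X : comodule (cop C)) * k^o) := exists2 e, prj S e = p.1 & dmod_fun x e = p.2.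
have [||F Fl FE] := @linear_relation_extend k X k^o G.
- split; first by exists 0; [apply: lin0 (prj_lin S)|apply: lin0 (dmod_linear x)].
  move=> a p q [e e1 e2] [e' e1' e2']; exists (a *: e + e').
    by rewrite (prj_lin S) e1 e1'.
  by rewrite (dmod_linear x) e2 e2'.
- move=> w [e /(ses_exact S)[y <-] /= <-].
  by rewrite -(dmod_pullE ih) x0.
exists (dmod_of Fl); apply: dmodP => d; rewrite dmod_pullE.
by apply: FE; exists d.
Qed.

Definition dual_ses : ses (dmod_ob Y) (dmod_ob X) :=
  @Ses k (mod_cat C) (dmod_ob Y) (dmod_ob X) (dmod_ob (mid S)) (dmod_pull ph) (dmod_pull ih)
    (dmod_pull_mor ph) (dmod_pull_mor ih) dual_inc_inj dual_prj_surj dual_exact.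

End DualSes.

Definition regC : mod_cat C := Upsilon C (reg_comod C).

(* d |-> (x |-> x(d_(0)) d_(1)) identifies D with the continuous homomorphisms
   from its dual module to C. *)
Definition ev D (d : D) (x : dmod D) : C := coeff (dmod_fun x) d.

Lemma dual_ev D (d : D) (x : dmod D) (f : dual C) : f (ev d x) = dmod_fun x (to_cop f |> d).
Proof. exact: (dual_coeff (dmod_linear x) (to_cop f) d). Qed.

Lemma counit_ev D (d : D) (x : dmod D) : counit (ev d x) = dmod_fun x d.
Proof. exact: (counit_coeff (dmod_linear x) d). Qed.

Lemma ev_mor D (d : D) : @mor _ (mod_cat C) (dmod_ob D) regC (ev d).
Proof.
move=> f x y; apply: dual_sep => f'.
rewrite dual_ev dmodE -[_ *: _]/(comod_dot (M := reg_comod C) f (ev d x)).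
rewrite (linD (dual_linear f')) -dual_mulE !dual_ev; congr (_ + _).
by rewrite -to_cop_mul comod_dot_mul.
Qed.

Lemma ev_linear D (x : dmod D) : linear (fun d => ev d x).
Proof. exact: (coeff_linear (dmod_linear x)). Qed.

Lemma ev_pull D D' (h : D -> D') (hh : comod_hom h) d x :
  ev d (dmod_pull hh x) = ev (h d) x.
Proof. by apply: dual_sep => f; rewrite !dual_ev dmod_pullE comod_homE. Qed.

(** All homomorphisms from the dual of [D] to C are continuous. This holds for finite copowers,
    whose duals are free of finite rank, and for their subcomodules by [embedding_reflexive]. *)
Definition reflexive_comod D : Prop :=
  forall h : car (dmod_ob D) -> car regC, mor h -> exists d : D, forall x, h x = ev d x.

Lemma zcomod_dmod0 (x : dmod (zcomod (cop C))) : x = 0.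
Proof.
apply: dmodP => d; rewrite [d](zcomod_eq0 (C := cop C)).
by rewrite (lin0 (dmod_linear x)) (lin0 (dmod_linear _)).
Qed.

Lemma zcomod_projective : projective_ob (dmod_ob (zcomod (cop C))).
Proof.
move=> X Y S h hm; exists (fun=> 0); first exact: mor_zero.
move=> x; rewrite [x in RHS]zcomod_dmod0 (lin0 (prj_lin S)).
by rewrite (lin0 (mor_linear hm)).
Qed.

Lemma zcomod_reflexive : reflexive_comod (zcomod (cop C)).
Proof.
move=> h hm; exists 0 => x; rewrite [x]zcomod_dmod0 (lin0 (ev_linear _)).
exact: lin0 (mor_linear hm).
Qed.

Let dreg := dmod (reg_comod (cop C)).
(** With [dreg_one] this exhibits the dual of the regular right comodule as the free left module of
    rank one on the counit. Hence it is projective, and a homomorphism to C is the evaluation at the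
    image of the counit. *)
Definition dreg_dual (x : dreg) : dual C := @Dual k C (dmod_fun x) (dmod_linear x).
Definition dreg_one : dreg := dmod_of (D := reg_comod (cop C)) (@counit_linear _ C).

Lemma dreg_dualD f x y : dreg_dual (f *: x + y) = f * dreg_dual x + dreg_dual y.
Proof.
apply: dual_ext => c; rewrite -[LHS]/(dmod_fun (f *: x + y) c) dmodE.
congr (_ + _).
have := dual_mulE (C := cop C) (to_cop (dreg_dual x)) (to_cop f) c.
by rewrite to_cop_mul => /esym.
Qed.

Lemma dreg_generated x : x = dreg_dual x *: dreg_one.
Proof.
apply: dmodP => c; rewrite dmod_scaleE.
have := dual_mulE (C := cop C) (to_cop (dual_one C)) (to_cop (dreg_dual x)) c.
by rewrite to_cop_mul dual_mulr1.
Qed.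

Lemma reg_projective : projective_ob (dmod_ob (reg_comod (cop C))).
Proof.
move=> X Y S h hm; have [e eE] := prj_surj S (h dreg_one).
exists (fun x => dreg_dual x *: (e : mid S)).
  by move=> f x y; rewrite dreg_dualD scalerDl scalerA.
move=> x; have := prj_mor S (dreg_dual x) e 0; rewrite addr0 => ->.
rewrite (lin0 (prj_lin S)) addr0 eE [in RHS](dreg_generated x).
by have := hm (dreg_dual x) dreg_one 0; rewrite !addr0 (lin0 (mor_linear hm)) addr0.
Qed.

Lemma reg_reflexive : reflexive_comod (reg_comod (cop C)).
Proof.
move=> h hm; exists (h dreg_one : C) => x; rewrite [in LHS](dreg_generated x).
have E := hm (dreg_dual x) dreg_one 0; rewrite !addr0 (lin0 (mor_linear hm)) addr0 in E.
rewrite [LHS]E; apply: dual_sep => f; rewrite dual_ev.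
rewrite -[_ *: _]/(comod_dot (M := reg_comod C) (dreg_dual x) (h dreg_one)) -dual_mulE.
have := dual_mulE (C := cop C) (to_cop (dreg_dual x)) (to_cop f) (h dreg_one).
by rewrite to_cop_mul.
Qed.

Section DsumDual.
Variables D1 D2 : comodule (cop C).
Let D := dsum_comod D1 D2.
Let l (d : D1) : D := (d, 0).
Let r (d : D2) : D := (0, d).

Let lh : comod_hom l.
Proof. by apply: dsum_pair_hom; [apply: comod_hom_id|apply: comod_hom_zero]. Qed.
Let rh : comod_hom r.
Proof. by apply: dsum_pair_hom; [apply: comod_hom_zero|apply: comod_hom_id]. Qed.
Let fh := dsum_fst_hom D1 D2.
Let sh := dsum_snd_hom D1 D2.

Let lrE d1 d2 : l d1 + r d2 = (d1, d2) :> D.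
Proof. by congr (_, _); rewrite /= ?addr0 ?add0r. Qed.

Lemma dmod_dsum (x : dmod D) :
  x = dmod_pull fh (dmod_pull lh x) + dmod_pull sh (dmod_pull rh x).
Proof.
apply: dmodP => -[d1 d2]; transitivity (dmod_fun x (l d1) + dmod_fun x (r d2)); last by [].
by rewrite -(linD (dmod_linear x)) lrE.
Qed.

Lemma dsum_projective : projective_ob (dmod_ob D1) -> projective_ob (dmod_ob D2) ->
  projective_ob (dmod_ob D).
Proof.
move=> p1 p2 X Y S h hm.
have [s1 m1 e1] := p1 X Y S _ (mor_comp hm (dmod_pull_mor fh)).
have [s2 m2 e2] := p2 X Y S _ (mor_comp hm (dmod_pull_mor sh)).
exists (fun x => s1 (dmod_pull lh x) + s2 (dmod_pull rh x)).
  by apply: mor_add; [apply: mor_comp m1 (dmod_pull_mor lh)|apply: mor_comp m2 (dmod_pull_mor rh)].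
move=> x; rewrite (linD (prj_lin S)) e1 e2 -(linD (mor_linear hm)).
by congr (h _); rewrite [RHS]dmod_dsum.
Qed.

Lemma dsum_reflexive : reflexive_comod D1 -> reflexive_comod D2 -> reflexive_comod D.
Proof.
move=> r1 r2 h hm.
have [d1 E1] := r1 _ (mor_comp hm (dmod_pull_mor fh)).
have [d2 E2] := r2 _ (mor_comp hm (dmod_pull_mor sh)).
exists (d1, d2) => x; rewrite [in LHS](dmod_dsum x) (linD (mor_linear hm)) E1 E2 !ev_pull.
by rewrite -[LHS]/((ev (l d1) x : C) + ev (r d2) x) -(linD (ev_linear x)) lrE.
Qed.

End DsumDual.

Lemma cofree_projective r : projective_ob (dmod_ob (cofree (cop C) r)).
Proof.
by elim: r => [|r IH]; [apply: zcomod_projective|apply: dsum_projective reg_projective IH].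
Qed.

Lemma cofree_reflexive r : reflexive_comod (cofree (cop C) r).
Proof.
by elim: r => [|r IH]; [apply: zcomod_reflexive|apply: dsum_reflexive reg_reflexive IH].
Qed.

End DualModule.

(** * The two resolutions *)

Section SpliceHeads.
Local Open Scope ring_scope.
Variables (k : fieldType) (A : kcat k).

Lemma splice_mor_head m (X Y X' Y' : A) (f : car Y -> car Y') (g : car X -> car X')
    (S : splice m X Y) (S' : splice m X' Y') : splice_mor f g S S' ->
  exists2 h : car (mid (projT2 (head_ses S))) -> car (mid (projT2 (head_ses S'))),
    mor h & forall y, h (inc (projT2 (head_ses S)) y) = inc (projT2 (head_ses S')) (f y).
Proof.
case: m S S' => [|m] S S' /=; first by case=> h [hm h1 _]; exists h.
by case=> t [_ [h [hm h1 _]] _]; exists h.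
Qed.

Lemma all_ext_of_tail (P : A -> Prop) m (X Y : A) (S : splice m X Y) :
  (forall J, P J -> forall f : car Y -> car J, mor f -> extends (projT2 (head_ses S)) f) ->
  tail_ext P S -> all_ext P S.
Proof. by case: m S => [|m] S. Qed.

Variables (A' : kcat k) (F : exact_functor A A').

Lemma head_fun_splice m (X Y : A) (S : splice m X Y) :
  head_ses (fun_splice F S) = existT _ (F (projT1 (head_ses S))) (fun_ses F (projT2 (head_ses S))).
Proof. by case: m S => [|m] S. Qed.

Lemma last_fun_splice m (X Y : A) (S : splice m X Y) :
  last_ses (fun_splice F S) = existT _ (F (projT1 (last_ses S))) (fun_ses F (projT2 (last_ses S))).
Proof. by elim: m Y S => [|m IH] Y S //=; rewrite IH. Qed.

Lemma mids_in_fun_splice (P : A -> Prop) (P' : A' -> Prop) m (X Y : A) (S : splice m X Y) :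
  (forall J, P J -> P' (F J)) -> mids_in P S -> mids_in P' (fun_splice F S).
Proof.
move=> PP; elim: m Y S => [|m IH] Y S /=; first exact: PP.
by move=> [/PP h1 /IH h2].
Qed.

End SpliceHeads.

Section Stages.
Local Open Scope ring_scope.
Variables (k : fieldType) (C : coalgebra k) (g : coaugmentation C).
Local Notation B := (cop C).
Local Notation gB := (cop_coaug g).
Local Notation kC := (triv_comod g : comod_cat C).
Local Notation kC' := (Upsilon C kC).
Local Notation u := (g 1).

Lemma restr_ups_scale (M : comodule C) (a : k) (x : restr (ups_obj M)) : a *: x = a *: (x : M).
Proof. exact: dual_const_dot. Qed.

Lemma ups_scaleE (M : comodule C) (f : dual C) (x : ups_obj M) : f *: x = f |> (x : M).
Proof. by []. Qed.

Lemma triv_mor (M : comodule C) (z : M) : soc g z ->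
  @mor _ (mod_cat C) kC' (Upsilon C M) (fun a : car kC => (a : k) *: z).
Proof. by move=> sz; apply: (ups_mor (soc_mor sz)). Qed.

Lemma triv_morP (M : comodule C) (q : car kC' -> car (Upsilon C M)) : mor q ->
  soc g (q (1 : k^o) : M) /\ q = (fun a : car kC => (a : k) *: (q (1 : k^o) : M)).
Proof.
move=> qm; have q0 : q 0 = 0 := lin0 (mor_linear qm).
have qf (f : dual C) (a : k^o) : q ((f u : k) * a : k^o) = f |> (q a : M).
  have E := qm f a 0; rewrite !addr0 q0 addr0 in E; rewrite -[RHS]E.
  by congr q; rewrite (Upsilon_triv f (a : Upsilon C kC)).
split.
  by move=> f af; rewrite -qf [f u]af mul0r.
apply/funext => a; have := qf (dual_const C a) 1.
by rewrite dual_const_dot /= counit_u !mulr1.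
Qed.

Definition kunit : car kC' -> car (regC C) := fun a : car kC => (a : k) *: u.

Lemma kunit_mor : mor kunit.
Proof. exact: (@triv_mor (reg_comod C) u (soc_unit g)). Qed.

(* E is the dual of the embedding of a right comodule into its minimal finite
   cofree envelope, with cokernel D: the continuous homomorphisms D^* -> C are
   those that extend to the free module in the middle of E. *)
Definition head_ok (X : mod_cat C) (D : comodule B) (E : ses X (dmod_ob D)) : Prop :=
  [/\ forall h : car (mid E) -> car (regC C), mor h ->
        exists d : D, forall x, h (inc E x) = ev d x,
      forall d : D, exists2 h : car (mid E) -> car (regC C),
        mor h & forall x, h (inc E x) = ev d x
    & forall s : car (mid E) -> car kC', mor s -> forall x, s (inc E x) = 0].

Lemma soc_of_ev (D : comodule B) (d : D) (f : dmod D -> k) :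
  (forall x, ev d x = f x *: u) -> soc gB d.
Proof.
move=> h f' af; apply: functional_sep => x xl.
have -> : x (f' |> d) = of_cop f' (ev d (dmod_of xl)).
  by rewrite dual_ev of_copK.
by rewrite h (linZ (dual_linear _)) [of_cop f' u]af scaler0.
Qed.

Lemma soc_ev (D : comodule B) (d : D) (x : dmod D) : soc gB d -> ev d x = (dmod_fun x d : k) *: u.
Proof.
move=> sd; apply: dual_sep => f; rewrite dual_ev (socE _ sd) (linZ (dmod_linear x)).
by rewrite (linZ (dual_linear f)) -![_ *: _]/(_ * _) mulrC.
Qed.

Section DualOfEmbedding.
Variables (D : comodule B) (r : nat) (h : D -> cofree B r).
Hypotheses (hh : comod_hom h) (hi : injective h).
Hypothesis hs : forall y, soc gB y -> exists2 x, soc gB x & h x = y.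

Definition embedding_ses : ses (dmod_ob D) (dmod_ob (coker_comod hh)) :=
  dual_ses (coker_ses hh hi).

Lemma embedding_ses_projective : projective_ob (mid embedding_ses).
Proof. exact: cofree_projective. Qed.

Lemma embedding_inc x : inc embedding_ses x = dmod_pull (coker_pi_hom hh) x.
Proof. exact: dmodP. Qed.

Lemma embedding_head_ok : head_ok embedding_ses.
Proof.
split.
- move=> t tm; have [d E] := cofree_reflexive tm.
  exists (cokpi hh.1 d : coker_comod hh) => x.
  by rewrite E embedding_inc ev_pull.
- move=> d; have [d' dE] := coker_surj d.
  exists (ev d'); first exact: ev_mor.
  by move=> x; rewrite embedding_inc ev_pull dE.
(* Followed by the inclusion of k into C, [s] becomes the evaluation at a socle element of the
   cofree comodule; by minimality this element comes from [D] and vanishes in the cokernel. *)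
move=> s sm x; have [d E] := cofree_reflexive (mor_comp kunit_mor sm).
have /hs[y _ yE] : soc gB d by apply: soc_of_ev => z; rewrite -E.
have := E (inc embedding_ses x); rewrite embedding_inc ev_pull -yE.
have -> : cokpi hh.1 (h y) = 0 :> coker_comod hh by apply: cokpi0.
rewrite (lin0 (ev_linear x)) => /(congr1 (@counit _ C)).
rewrite (linZ (@counit_linear _ C)) counit_u (lin0 (@counit_linear _ C)).
by rewrite -[_ *: _]/(_ * _) mulr1.
Qed.

(** Composed with the surjection from the dual of the cofree comodule, [t] is the evaluation at some
    [y]. If [y] were not in the image of [D], a functional zero on that image and 1 at [y] would be
    killed by the surjection but not by the evaluation. *)
Lemma embedding_reflexive : reflexive_comod D.
Proof.
move=> t tm; have pm : mor (prj embedding_ses) := prj_mor embedding_ses.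
have [y E] := cofree_reflexive (mor_comp tm pm).
have [d dy] : exists d, h d = y.
  apply: contrapT => ny.
  have [||f fl [f0 f1]] := @functional_off k _ (fun z => exists d, h d = z) y.
  - split; first by exists 0; apply: lin0 hh.1.
    by move=> a _ _ [d1 <-] [d2 <-]; exists (a *: d1 + d2); rewrite hh.1.
  - exact: ny.
  have p0 : prj embedding_ses (dmod_of fl) = 0.
    by apply: dmodP => d; rewrite /dmod_fun /= f0 //; exists d.
  have := E (dmod_of fl); rewrite p0 (lin0 (mor_linear tm)).
  move=> /(congr1 (@counit _ C)); rewrite counit_ev (lin0 (@counit_linear _ C)).
  by rewrite /dmod_fun /= f1 => /esym/eqP; rewrite oner_eq0.
exists d => x; have [z <-] := prj_surj embedding_ses x.
by rewrite E -dy -(ev_pull hh).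
Qed.

End DualOfEmbedding.

Arguments embedding_ses_projective {D r h} hh hi.
Arguments embedding_reflexive {D r h} hh hi.
Arguments embedding_head_ok {D r h} hh hi hs.

(** The dual of the trivial right comodule is only isomorphic to [kC'], where the resolution has to
    end. The dependent pair records that the middle term and the inclusion are unchanged, on which
    projectivity and [head_ok] depend. *)
Lemma ses_iso (A : kcat k) (X X' Y : A) (E : ses X Y) (i : car X -> car X') :
  mor i -> bijective i -> exists E' : ses X' Y,
    existT (fun P => car Y -> car P) (mid E') (inc E') = existT _ (mid E) (inc E).
Proof.
move=> im [j ij ji]; have pm := mor_comp im (prj_mor E).
have ps x : exists e, i (prj E e) = x.
  by have [e eE] := prj_surj E (j x); exists e; rewrite eE ji.
have ex e : i (prj E e) = 0 <-> exists y, inc E y = e.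
  rewrite -ses_exact; split=> [e0|->]; last exact: lin0 (mor_linear im).
  by rewrite -[LHS]ij e0 -(lin0 (mor_linear im)) ij.
by exists (Ses (inc_mor E) pm (@inc_inj _ _ _ _ E) ps ex).
Qed.

(** Injectivity relative to the sequences along which maps into C extend. It passes from C to its
    finite copowers. *)
Definition Cext (J : mod_cat C) : Prop :=
  forall (X Y : mod_cat C) (S : ses X Y),
    (forall h : car Y -> car (regC C), mor h -> extends S h) ->
    forall f : car Y -> car J, mor f -> extends S f.

(* Z is the cosyzygy of the left comodule k in its minimal finite cofree
   coresolution R; T is the dual of the corresponding resolution of the right
   comodule k, with cosyzygy D.  In [st_tail], all homomorphisms into C extend
   because the syzygies other than the last one are finitely generated. *)
Record stage m (Z : comodule C) (R : splice m (Z : comod_cat C) kC)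
    (D : comodule B) (T : splice m kC' (dmod_ob D)) : Prop := Stage {
  st_cofree : mids_in (fun J : comod_cat C => exists r, J = cofree C r) R;
  st_last : forall y : (mid (projT2 (last_ses R)) : comodule C),
    soc g y -> prj (projT2 (last_ses R)) y = 0;
  st_proj : mids_in (@projective_ob _ (mod_cat C)) T;
  st_tail : tail_ext Cext T;
  st_head : head_ok (projT2 (head_ses T))
}.

Lemma triv_basis (B0 : coalgebra k) (g0 : coaugmentation B0)
    (e := fun _ : 'I_1 => (1 : triv_comod g0)) :
  [/\ free_family e, forall i, soc g0 (e i) & spans e (@soc k B0 g0 (triv_comod g0))].
Proof.
split=> [|i|x _]; last 2 first.
- exact: soc_triv.
- by exists [:: (x : k, ord0)]; rewrite comb1 -[RHS]/(_ * _) mulr1.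
apply: (@free_dual k 'I_1 (triv_comod g0) e (fun _ => id)) => // i j.
by rewrite asboolT // [i]ord1 [j]ord1.
Qed.

Hypothesis ln : locally_nilpotent g.
Let lnB : locally_nilpotent gB := cop_locally_nilpotent ln.

Lemma embed_last (M : comodule C) r (h : M -> cofree C r) (hh : comod_hom h) (hi : injective h) :
  (forall y, soc g y -> exists2 x, soc g x & h x = y) ->
  forall y, soc g y -> prj (coker_ses hh hi) y = 0.
Proof.
move=> hs y /hs[x _ <-]; exact: (prj_inc (coker_ses hh hi)).
Qed.

Definition triv_dual (x : dmod (triv_comod gB)) : car kC := dmod_fun x (1 : k^o).

Lemma triv_dual_mor : @mor _ (mod_cat C) (dmod_ob (triv_comod gB)) kC' triv_dual.
Proof.
move=> f x y; rewrite /triv_dual dmodE (Upsilon_triv f (dmod_fun x (1 : k^o) : Upsilon C kC)).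
congr (_ + _).
have -> : to_cop f |> (1 : triv_comod gB) = (f u : k) *: (1 : triv_comod gB) by apply: dual_actE.
exact: linZ (dmod_linear x) _ _.
Qed.

Lemma triv_dual_bij : bijective triv_dual.
Proof.
have al (a : k) : linear (fun x : triv_comod gB => (x : k) * a : k^o).
  by move=> b x y; rewrite mulrDl -[_ *: _]/(_ * _) -mulrA.
exists (fun a : car kC => dmod_of (al a)) => [x|a]; last by rewrite /triv_dual /dmod_fun /= mul1r.
apply: dmodP => d; transitivity ((d : k) *: dmod_fun x (1 : k^o)); first by [].
rewrite -(linZ (dmod_linear x)); congr (dmod_fun x _).
by rewrite -[LHS]/(_ * _) mulr1.
Qed.

(* The quotient B / k embeds into D, so that functionals on D separating soc D
   separate the socle of B / k. *)
Definition unit_quotient (D : comodule B) : Prop :=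
  exists2 p : reg_comod B -> D, comod_hom p &
    p u = 0 /\ forall b, p b = 0 -> soc gB (b : reg_comod B).

Lemma stage0 : exists Z R D T, @stage 0 Z R D T /\ unit_quotient D.
Proof.
have [fe se sp] := triv_basis g; have [h [hh hi hs]] := comod_embed ln fe se sp.
have [fe' se' sp'] := triv_basis gB; have [h' [hh' hi' hs']] := comod_embed lnB fe' se' sp'.
have [E EE] := ses_iso (embedding_ses hh' hi') triv_dual_mor triv_dual_bij.
exists (coker_comod hh), (coker_ses hh hi), (coker_comod hh'), E; split; last first.
  (* Here [D] is the quotient of B (+) 0 by the image of k, and B is mapped to it through the first
     summand. The element [u] dies because the socle of the cofree comodule comes from k. *)
  have ih : comod_hom (fun b : reg_comod B => (b, 0) : cofree B 1).
    by apply: dsum_pair_hom; [apply: comod_hom_id|apply: comod_hom_zero].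
  exists (fun b => cokpi hh'.1 (b, 0)); first exact: comod_hom_comp (coker_pi_hom hh') ih.
  split.
    have /hs'[x _ <-] : soc gB ((u, 0) : cofree B 1).
      by apply: (soc_hom ih); apply: (soc_unit gB).
    by rewrite [LHS]cokpi0.
  move=> b /(coker_exact hh')[x xE].
  have bx : b = (h' x).1 by rewrite xE.
  by rewrite bx; apply: (soc_hom (dsum_fst_hom _ _)); apply: soc_hom hh' (soc_triv gB x).
split=> //=; first by exists 1.
- exact: embed_last hs.
- have := embedding_ses_projective hh' hi'.
  by have := congr1 (@projT1 _ _) EE => /= ->.
have := embedding_head_ok hh' hi' hs'; rewrite /head_ok.
move: EE; case: E => P i p im pm ii ps ex /= EE.
pose Q (t : {P : mod_cat C & car (dmod_ob (coker_comod hh')) -> car P}) :=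
  [/\ forall h : car (projT1 t) -> car (regC C), mor h ->
        exists d, forall x, h (projT2 t x) = ev d x,
      forall d, exists2 h : car (projT1 t) -> car (regC C),
        mor h & forall x, h (projT2 t x) = ev d x
    & forall s : car (projT1 t) -> car kC', mor s -> forall x, s (projT2 t x) = 0].
by rewrite -[_ -> _]/(Q (existT _ _ _) -> Q (existT _ P i)) EE.
Qed.

Lemma stage_step m (Z : comodule C) (R : splice m (Z : comod_cat C) kC) (D : comodule B)
    (T : splice m kC' (dmod_ob D)) r r' (e : 'I_r -> Z) (e' : 'I_r' -> D) :
  stage R T ->
  free_family e -> (forall i, soc g (e i)) -> spans e (@soc _ _ g Z) ->
  free_family e' -> (forall i, soc gB (e' i)) -> spans e' (@soc _ _ gB D) ->
  exists Z' R' D' T', @stage m.+1 Z' R' D' T'.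
Proof.
move=> st fe se sp fe' se' sp'; have [h [hh hi hs]] := comod_embed ln fe se sp.
have [h' [hh' hi' hs']] := comod_embed lnB fe' se' sp'.
exists (coker_comod hh), (snoc R (coker_ses hh hi)), (coker_comod hh').
exists (existT _ (dmod_ob D) (embedding_ses hh' hi', T)).
split.
- by apply: mids_in_snoc (st_cofree st) _; exists r.
- by rewrite last_snoc; apply: embed_last hs.
- by split; [apply: embedding_ses_projective|apply: st_proj st].
(* The old head now belongs to the tail. As [D] embeds into a finite copower, every homomorphism
   from its dual to C is an evaluation, and evaluations extend by [head_ok]. *)
- apply: all_ext_of_tail (st_tail st) => J CJ f fm; apply: CJ fm => t tm.
  have [d E] := embedding_reflexive hh' hi' _ tm; have [_ b2 _] := st_head st.
  by have [s sm sE] := b2 d; exists s => // x; rewrite sE E.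
- exact: embedding_head_ok.
Qed.

Lemma Cext_dsum (M N : comodule C) : Cext (Upsilon C M) -> Cext (Upsilon C N) ->
  Cext (Upsilon C (dsum_comod M N)).
Proof.
move=> cM cN X Y S ex f fm.
have [s1 m1 e1] := cM X Y S ex _ (mor_comp (fmap_mor (Upsilon C) (dsum_fst_hom M N)) fm).
have [s2 m2 e2] := cN X Y S ex _ (mor_comp (fmap_mor (Upsilon C) (dsum_snd_hom M N)) fm).
exists (fun x => (s1 x, s2 x) : dsum_comod M N).
  move=> a x y; rewrite (m1 a x y) (m2 a x y) !ups_scaleE.
  set z : dsum_comod M N := (s1 x, s2 x); rewrite [RHS]surjective_pairing.
  congr (_, _).
    by rewrite -[RHS]/((a |> z).1 + s1 y) (comod_homE a z (dsum_fst_hom M N)).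
  by rewrite -[RHS]/((a |> z).2 + s2 y) (comod_homE a z (dsum_snd_hom M N)).
by move=> y; rewrite e1 e2 /= -surjective_pairing.
Qed.

Lemma Cext_cofree r : Cext (Upsilon C (cofree C r)).
Proof.
elim: r => [|r IH]; last by apply: Cext_dsum IH => X Y S ex f fm; apply: ex.
move=> X Y S _ f fm; exists (fun=> 0); first exact: mor_zero.
by move=> y; rewrite [RHS](zcomod_eq0 (C := C)).
Qed.

Section StageProperties.
Variables (m : nat) (Z : comodule C) (R : splice m (Z : comod_cat C) kC).
Variables (D : comodule B) (T : splice m kC' (dmod_ob D)).
Hypothesis st : stage R T.

Local Notation U := (fun_splice (Upsilon C) R).
Local Notation factM := (@mod_factorizing k C).

Lemma stage_mids_Cext : mids_in Cext U.
Proof.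
by apply: mids_in_fun_splice (st_cofree st) => J [r ->]; apply: Cext_cofree.
Qed.

Lemma stage_proj_zero (X : mod_cat C) (S : splice m X kC') (f : car (dmod_ob D) -> car kC') :
  splice_mor f (fun=> 0) T S -> f = fun=> 0.
Proof.
move=> /(proj_homotopy factM (st_proj st))[s sm sE]; have [_ _ c] := st_head st.
by apply/funext => x; rewrite -sE c.
Qed.

Lemma stage_proj_extends (f : car (dmod_ob D) -> car kC') :
  extends (projT2 (head_ses T)) f -> f = fun=> 0.
Proof.
by move=> [s sm sE]; have [_ _ c] := st_head st; apply/funext => x; rewrite -sE c.
Qed.

Lemma stage_inj_lifts (q : car kC -> car (Z : comod_cat C)) :
  lifts (projT2 (last_ses R)) q -> q = fun=> 0.
Proof.
move=> [s sm sE]; apply/funext => a; rewrite -sE (st_last st) //.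
exact: mor_soc sm.
Qed.

(** If [f] = 0, the homotopy lifts [q] to the last cofree term; the lift has its value in the socle,
    which is killed by minimality of the coresolution. *)
Lemma stage_lift_zero (f : car (dmod_ob D) -> car kC') (q : car kC' -> car (Upsilon C Z)) :
  splice_mor f q T U -> mor q -> f = (fun=> 0) -> q = fun=> 0.
Proof.
move=> h qm f0; have := ext_homotopy factM (st_tail st) stage_mids_Cext h.
rewrite last_fun_splice /= => -[|s sm sE].
  by exists (fun=> 0); [apply: mor_zero|rewrite f0].
have [_ qE] := triv_morP qm; have [ss _] := triv_morP sm.
have q1 : q (1 : k^o) = 0 by rewrite -sE; apply: (st_last st ss).
by rewrite qE q1; apply/funext => a; apply: (@scaler0 k Z).
Qed.

(** By [head_ok] evaluations extend, and [f] extends componentwise. The hypothesis is about all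
    homomorphisms to C rather than the coordinates, which makes it stable under the induction on
    [r]. *)
Lemma stage_continuous (r : nat) (X : mod_cat C) (E : ses X (dmod_ob D))
    (f : car (dmod_ob D) -> car (Upsilon C (cofree C r))) :
  head_ok E -> mor f ->
  (forall p : cofree C r -> reg_comod C, comod_hom p -> exists d, forall x, p (f x) = ev d x) ->
  extends E f.
Proof.
move=> [_ b2 _]; elim: r f => [|r IH] f fm hf.
  exists (fun=> 0); first exact: mor_zero.
  by move=> y; rewrite [RHS](zcomod_eq0 (C := C)).
have fh := dsum_fst_hom (reg_comod C) (cofree C r).
have sh := dsum_snd_hom (reg_comod C) (cofree C r).
have [d0 E0] := hf _ fh; have [s1 m1 e1] := b2 d0.
have [|s2 m2 e2] := IH _ (mor_comp (fmap_mor (Upsilon C) sh) fm).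
  by move=> p ph; apply: (hf (fun x => p x.2)); apply: comod_hom_comp ph sh.
exists (fun x => (s1 x, s2 x) : cofree C r.+1).
  move=> a x y; rewrite (m1 a x y) (m2 a x y) !ups_scaleE.
  set z : cofree C r.+1 := (s1 x, s2 x); rewrite [RHS]surjective_pairing.
  congr (_, _).
    by rewrite -[RHS]/((a |> z).1 + s1 y) (comod_homE a z fh).
  by rewrite -[RHS]/((a |> z).2 + s2 y) (comod_homE a z sh).
by move=> y; rewrite e1 e2 -E0 /= -surjective_pairing.
Qed.

Definition soc_functional (d : D) : car (dmod_ob D) -> car kC' :=
  fun x => dmod_fun x d : car kC.

Lemma soc_functional_mor d : soc gB d -> mor (soc_functional d).
Proof.
move=> sd f x y; rewrite /soc_functional dmodE (socE _ sd).
rewrite (Upsilon_triv f (dmod_fun x d : Upsilon C kC)); congr (_ + _).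
exact: linZ (dmod_linear x) _ _.
Qed.

(** The graph of the isomorphism between soc D and soc Z: evaluation at [d] and multiplication by
    [z] are the two ends of a comparison morphism between the resolutions. *)
Definition soc_rel (d : D) (z : Z) : Prop :=
  [/\ soc gB d, soc g z
    & splice_mor (soc_functional d)
        ((fun a : car kC => (a : k) *: z) : car kC' -> car (Upsilon C Z)) T U].

(** The composite of the evaluation at [d] with k -> C^r has components that are evaluations at
    multiples of [d], as [d] is in the socle; so it extends over the head even when D is not
    reflexive. *)
Lemma soc_rel_left d : soc gB d -> exists z, soc_rel d z.
Proof.
move=> sd; have dm := soc_functional_mor sd.
have := @ext_lift _ _ factM Cext _ _ _ _ _ T U _ (st_tail st) stage_mids_Cext dm.
rewrite head_fun_splice /= => h.
have [|q qm qE] := h.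
  move: (mids_in_head (st_cofree st)).
  move: (projT2 (head_ses R)) => S [r rE]; case: S rE => M i p im pm ii ps ex /= rE.
  move: i p im pm ii ps ex; rewrite rE => i p im pm ii ps ex.
  apply: (stage_continuous (st_head st)).
    exact: (@mor_comp k (mod_cat C) (dmod_ob D) kC' (Upsilon C (cofree C r)) i
      (soc_functional d) (ups_mor im) dm).
  move=> t th; pose z := t (i (1 : k^o)).
  have sz : soc g z by apply: soc_hom th _; apply: soc_hom im _; apply: soc_triv.
  exists ((counit z : k) *: d) => x.
  rewrite (linZ (ev_linear x)) soc_ev // -[X in dmod_fun x X](scale1r d).
  have -> : soc_functional d x = (dmod_fun x d : k) *: (1 : k^o).
    by rewrite /soc_functional -[RHS]/(_ * _) mulr1.
  rewrite (linZ (mor_linear im)) (linZ th.1) -/z scale1r.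
  by rewrite {1}(soc_reg sz) !scalerA mulrC.
have [sq qE'] := triv_morP qm; exists (q (1 : k^o)); split=> //.
by rewrite qE' in qE.
Qed.

(** Projectivity provides the left end [f]. The inclusion of k into C extends to the first cofree
    term by injectivity, and composing gives a map from the middle of the head to C; by [head_ok] it
    restricts to an evaluation, so that [f] is the evaluation at a socle element. *)
Lemma soc_rel_right z : soc g z -> exists d, soc_rel d z.
Proof.
move=> sz; have qm := triv_mor sz.
have [f fm fE] := proj_lift factM U (st_proj st) qm.
have [h hm hE] := splice_mor_head fE; move: h hm hE; rewrite head_fun_splice /= => h hm hE.
have um := soc_mor (soc_unit g).
have [p pm pE] := @reg_injective k C _ _ (projT2 (head_ses R)) _ um.
have [b1 _ _] := st_head st; have [d dE] := b1 _ (@mor_comp k (mod_cat C) _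
    (Upsilon C (mid (projT2 (head_ses R)))) (regC C) p h (ups_mor pm) hm).
have fd x : ev d x = (f x : k) *: u by rewrite -dE hE; apply: pE.
have sd : soc gB d by apply: soc_of_ev fd.
exists d; split=> //; suff -> : soc_functional d = f by [].
apply/funext => x; rewrite /soc_functional -counit_ev fd.
by rewrite (linZ (@counit_linear _ C)) counit_u -[LHS]/(_ * _) mulr1.
Qed.

Lemma soc_rel_subspace : subspace (fun p : D * Z => soc_rel p.1 p.2).
Proof.
split=> [|a [d z] [d' z'] /= [sd sz h] [sd' sz' h']].
  split; [by case: (soc_subspace gB D)|by case: (soc_subspace g Z)|].
  have := splice_mor_zero T U; congr splice_mor; apply/funext => x.
    by rewrite /soc_functional (lin0 (dmod_linear x)).
  by rewrite scaler0.
split; [exact: (soc_subspace gB D).2|exact: (soc_subspace g Z).2|].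
have := splice_mor_lincomb a h h'; congr splice_mor; apply/funext => x.
  by rewrite /soc_functional (dmod_linear x) restr_ups_scale.
by rewrite restr_ups_scale scalerDr !scalerA mulrC.
Qed.

Lemma soc_rel0l z : soc_rel 0 z -> z = 0.
Proof.
move=> [_ sz h]; have := stage_lift_zero h (triv_mor sz).
have -> : soc_functional 0 = fun=> 0.
  by apply/funext => x; rewrite /soc_functional (lin0 (dmod_linear x)).
by move=> /(_ erefl)/(congr1 (@^~ (1 : k^o))); rewrite scale1r.
Qed.

Lemma soc_rel0r d : soc_rel d 0 -> d = 0.
Proof.
move=> [sd _ h]; have := @stage_proj_zero _ U (soc_functional d).
have -> : (fun=> 0) = (fun a : car kC => (a : k) *: (0 : Z)) :> (car kC' -> car (Upsilon C Z)).
  by apply/funext => a; rewrite scaler0.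
move=> /(_ h) e; apply: functional_sep => f fl.
exact: (congr1 (@^~ (dmod_of fl)) e).
Qed.

Lemma soc_rel_comb (I : Type) (d : I -> D) (z : I -> Z) s :
  (forall i, soc_rel (d i) (z i)) -> soc_rel (comb d s) (comb z s).
Proof.
move=> h; have [r0 rL] := soc_rel_subspace.
apply: (big_ind2 soc_rel) => [||p _]; first exact: r0.
- by move=> x1 x2 y1 y2 h1 h2; have := rL 1 (_, _) (_, _) h1 h2; rewrite /= !scale1r.
by have := rL p.1 (_, _) 0 (h p.2) r0; rewrite /= !addr0.
Qed.

Lemma soc_basis_transport (I : Type) (z : I -> Z) :
  free_family z -> (forall i, soc g (z i)) -> spans z (@soc _ _ g Z) ->
  exists d : I -> D, [/\ free_family d, forall i, soc gB (d i) & spans d (@soc _ _ gB D)].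
Proof.
move=> fz sz pz; have /choice[d dP] i : exists d, soc_rel d (z i) by apply: soc_rel_right.
exists d; split=> [s s0|i|x sx]; last 2 first.
- by case: (dP i).
- have [y xy] := soc_rel_left sx; have [|s sE] := pz y; first by case: xy.
  exists s; apply/eqP; rewrite -subr_eq0; apply/eqP; apply: soc_rel0r.
  have [_ rL] := soc_rel_subspace.
  have := rL (-1) (_, _) (_, _) (soc_rel_comb s dP) xy.
  by rewrite /= !scaleN1r sE addNr addrC.
by apply: fz; apply: soc_rel0l; rewrite -s0; apply: soc_rel_comb.
Qed.

Lemma stage_comod_repr :
  ext_repr (n := m.+1) (@mor _ (comod_cat C) kC Z : (car kC -> car (Z : comod_cat C)) -> Prop)
    (fun q (E : yext m.+1 kC kC) => mor q /\ splice_mor id q E R).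
Proof.
apply: inj_ext_repr.
- exact: comod_factorizing.
- exact: comod_has_pullbacks.
- by apply: mids_in_impl (st_cofree st) => J [r ->]; apply: cofree_injective.
- exact: stage_inj_lifts.
Qed.

Lemma stage_mod_repr :
  ext_repr (n := m.+1) (@mor _ (mod_cat C) (dmod_ob D) kC' : (car (dmod_ob D) -> car kC') -> Prop)
    (fun f (E : yext m.+1 kC' kC') => mor f /\ splice_mor f id T E).
Proof.
apply: proj_ext_repr.
- exact: mod_factorizing.
- exact: mod_has_pushouts.
- exact: st_proj st.
- exact: stage_proj_extends.
Qed.

Lemma stage_soc_basis (I : Type) : ext_dim m.+1 kC kC I ->
  exists z : I -> Z, [/\ free_family z, forall i, soc g (z i) & spans z (@soc _ _ g Z)].
Proof.
have rep := stage_comod_repr; have [eta [etaP _ eta_s]] := ext_repr_coord rep.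
move=> /(ext_dim_repr rep etaP eta_s)[e [fe em sp]].
have eE i a : e i a = (a : k) *: (e i (1 : k^o) : Z).
  rewrite -(linZ (mor_linear (em i))); congr (e i _).
  by rewrite -[RHS]/(_ * _) mulr1.
have cE s a : comb e s a = (a : k) *: comb (fun i => e i (1 : k^o) : Z) s.
  rewrite /comb fct_sumE scaler_sumr; apply: eq_bigr => p _.
  by rewrite -[LHS]/(p.1 *: e p.2 a) eE !scalerA mulrC.
exists (fun i => e i (1 : k^o)); split=> [s s0|i|z sz].
- by apply: fe; apply/funext => a; rewrite cE s0 scaler0.
- exact: mor_soc (em i).
have [s sE] := sp _ (soc_mor sz); exists s.
by have := congr1 (@^~ (1 : k^o)) sE; rewrite cE !scale1r.
Qed.

End StageProperties.

(** Finiteness is given for left comodules only; [soc_basis_transport] provides the finite basis of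
    the socle on the right side. *)
Lemma stage_exists m :
  (forall i, (1 <= i <= m)%N -> ext_finite_dim i kC kC) -> exists Z R D T, @stage m Z R D T.
Proof.
elim: m => [_|m IH fin].
  by have [Z [R [D [T [st _]]]]] := stage0; exists Z, R, D, T.
have [|Z [R [D [T st]]]] := IH.
  by move=> i /andP[i1 im]; apply: fin; rewrite i1 ltnW.
have [|r dr] := fin m.+1; first by rewrite leqnn.
have [z [fz sz pz]] := stage_soc_basis st dr.
have [d [fd sd pd]] := soc_basis_transport st fz sz pz.
exact: stage_step st fz sz pz fd sd pd.
Qed.

End Stages.

(** * Cardinality of dual comodules *)

Section LocallyFinite.
Local Open Scope ring_scope.
Variable k : fieldType.

Lemma coef_In (I : Type) (s : seq (k * I)) i : coef s i <> 0 -> List.In i [seq p.2 | p <- s].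
Proof.
elim: s => [|[a j] s IH]; first by rewrite /coef big_nil.
rewrite /coef big_cons /=; case: asboolP => [-> _|_ h]; first by left.
by right; apply: IH.
Qed.

(** The coordinates are composed with a single linear projection onto [S]; extending them one by one
    could lose finiteness of the support outside [S]. *)
Lemma subspace_coord (V : lmodType k) (S : V -> Prop) (I : Type) (e : I -> V) :
  subspace S -> free_family e -> spans e S ->
  exists c : I -> V -> k^o, [/\ forall i, linear (c i),
    forall x, exists r : seq I, forall i, c i x <> 0 -> List.In i r
    & forall x, S x -> (forall i, c i x = 0) -> x = 0].
Proof.
move=> sS fe sp; have [c [cl _ cE]] := free_coord fe.
have [P Pl PE] := @linear_extend k (subspace_type sS) V (subspace_type sS)
  (@subspace_val _ _ _ sS) id (fun _ _ _ => erefl) val_inj (fun _ _ _ => erefl).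
exists (fun i x => c i (subspace_val (P x))); split=> [i|x|x Sx h].
- by apply: lin_comp (cl i) _; apply: lin_comp Pl; apply: subspace_val_linear.
- have [s ->] := sp _ (subspace_valP (P x)); exists [seq p.2 | p <- s] => i.
  by rewrite cE; apply: coef_In.
have [s sE] := sp _ Sx; rewrite sE; apply: comb_coef0 => i.
have Px : subspace_val (P x) = x.
  by rewrite -[in P x](erefl : subspace_val (subspace_elt sS Sx) = x) PE.
by rewrite -cE -sE -{1}Px; apply: h.
Qed.

End LocallyFinite.

Section DualCardinality.
Local Open Scope ring_scope.
Variables (k : fieldType) (B : coalgebra k) (g : coaugmentation B).
Hypothesis ln : locally_nilpotent g.
Local Notation u := (g 1).

Variables (I : Type) (f : I -> dual B).
Hypothesis f_aug : forall i, aug g (f i).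
Hypothesis f_finite : forall b, exists r : seq I, forall i, f i b <> 0 -> List.In i r.
(* The f_i separate the points of the socle of B / k u. *)
Hypothesis f_sep : forall b, (forall h h', aug g h -> aug g h' -> dual_mul h h' b = 0) ->
  (forall i, f i b = 0) -> forall h, aug g h -> h b = 0.

Lemma augs_cat s t : augs g (s ++ t) = augs g s && augs g t.
Proof. exact: all_cat. Qed.

(* If all f_i kill x but some f in the augmentation ideal does not, a word of
   maximal length not killing x, followed by a functional, turns x into a b in B
   that contradicts [f_sep]. *)
Lemma soc_generators (M : comodule B) (x : M) : (forall i, f i |> x = 0) -> soc g x.
Proof.
move=> fx; have [N0 N0P] := comod_nilpotent ln x.
pose Q N := `[< forall s, augs g s -> (N <= size s)%N -> act s x = 0 >].
have exQ : exists N, Q N by exists N0; apply/asboolP.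
case: (ex_minnP exQ) => -[|N] /asboolP NP Nmin h ah.
  by rewrite (NP [::] isT isT : x = 0); apply: lin0 (comod_dot_linear h).
have [N1|N1] := eqVneq N 0.
  by rewrite N1 in NP; apply: (NP [:: h]) => //=; rewrite andbT; apply/asboolP.
have [s [sa Ns sx]] : exists s, [/\ augs g s, (N <= size s)%N & act s x <> 0].
  apply: contrapT => ns; have : Q N.
    by apply/asboolP => s sa Ns; apply: contrapT => sx; apply: ns; exists s.
  by move=> /Nmin; rewrite ltnn.
case/lastP: s sa Ns sx => [|s h0]; first by rewrite leqn0 (negPf N1).
rewrite augs_rcons size_rcons act_rcons => /andP[/asboolP ah0 sa] Ns sx.
have [chi chil chix] : exists2 chi : M -> k^o, linear chi & chi (act s (h0 |> x)) <> 0.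
  apply: contrapT => nchi; apply: sx; apply: functional_sep => chi chil.
  by apply: contrapT => h1; apply: nchi; exists chi.
have pl := lin_comp chil (act_linear (M := M) s).
case: chix; have := @dual_coeff k B M _ pl h0 x => <-.
apply: (f_sep _ _ ah0) => [h1 h2 a1 a2|i]; rewrite dual_coeff //; last first.
  by rewrite fx (lin0 (act_linear s)) (lin0 chil).
rewrite comod_dot_mul; have := NP (s ++ [:: h1; h2]).
rewrite act_cat /= => ->; first exact: lin0 chil.
  by rewrite augs_cat sa /= andbT; apply/andP; split; apply/asboolP.
by rewrite size_cat /= addn2 ltnS.
Qed.

Variables (D : comodule B) (J : Type) (c : J -> D -> k^o).
Hypothesis c_lin : forall j, linear (c j).
Hypothesis c_finite : forall x, exists r : seq J, forall j, c j x <> 0 -> List.In j r.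
Hypothesis c_sep : forall x, soc g x -> (forall j, c j x = 0) -> x = 0.

Let psi (t : seq I * J) (x : D) : k^o := c t.2 (act (map f t.1) x).

Let psi_linear t : linear (psi t).
Proof. exact: lin_comp (c_lin t.2) (act_linear _). Qed.

Lemma finitely_many_letters (x : D) : exists r : seq I, forall i, f i |> x <> 0 -> List.In i r.
Proof.
suff [r rP] : exists r : seq I, forall i, dual_act (f i) (coact x) <> 0 -> List.In i r by exists r.
elim/tens_ind1: (coact x) => s; rewrite tclsE; elim: s => [|[b m] s [r IH]].
  by exists [::] => i; rewrite big_nil (lin0 (dual_act_linear _)).
have [r' rP] := f_finite b; exists (r' ++ r) => i.
rewrite big_cons (linD (dual_act_linear _)) dual_actE => h.
apply/List.in_or_app; have [h0|h0] := pselect (f i b = 0); last by left; apply: rP.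
by right; apply: IH => e; apply: h; rewrite e h0 scale0r addr0.
Qed.

(** The last letter of a word is applied first, and only finitely many letters do not kill [x]; the
    rest of the word acts on an element of lower nilpotency order. The empty word leaves the
    finitely many [c j]. *)
Lemma words_finite (x : D) : exists r : seq (seq I * J), forall t, psi t x <> 0 -> List.In t r.
Proof.
have [N] := comod_nilpotent ln x; elim: N x => [|N IH] x NP.
  exists [::] => t; have -> : x = 0 by apply: (NP [::]).
  by rewrite (lin0 (psi_linear t)).
have [r0 r0P] := c_finite x; have [q qP] := finitely_many_letters x.
have /choice[r rP] i : exists r : seq (seq I * J), forall t, psi t (f i |> x) <> 0 -> List.In t r.
  apply: IH => s sa Ns; rewrite -act_rcons; apply: NP; last by rewrite size_rcons.
  by rewrite augs_rcons sa andbT; apply/asboolP.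
exists ([seq ([::], j) | j <- r0] ++ flatten [seq [seq (rcons t.1 i, t.2) | t <- r i] | i <- q]).
move=> [w j]; case/lastP: w => [|w i] h; apply/List.in_or_app.
  by left; apply: (List.in_map (fun j => ([::], j))); apply: r0P.
right; have hi : psi (w, j) (f i |> x) <> 0 by move: h; rewrite /psi /= map_rcons act_rcons.
have iq : List.In i q.
  by apply: qP => e; apply: hi; rewrite e (lin0 (psi_linear _)).
elim: q iq {qP} => //= i' q IHq [->|/IHq h']; apply/List.in_or_app; last by right.
by left; apply: (List.in_map (fun t => (rcons t.1 i, t.2)) _ (w, j)); apply: rP.
Qed.

(** By [soc_generators] an element outside the socle survives some letter, so that the letters alone
    lead from a nonzero element to a nonzero element of the socle. *)
Lemma words_separate (x : D) : (forall t, psi t x = 0) -> x = 0.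
Proof.
move=> h; apply: contrapT => x0.
suff [w [w0 ws]] : exists w, act (map f w) x <> 0 /\ soc g (act (map f w) x).
  by apply: w0; apply: c_sep ws _ => j; apply: (h (w, j)).
have [N] := comod_nilpotent ln x; elim: N x x0 {h} => [|N IH] x x0 NP.
  by case: x0; apply: (NP [::]).
have [sx|nsx] := pselect (soc g x); first by exists [::].
have [i fx] : exists i, f i |> x <> 0.
  apply: contrapT => ni; apply: nsx; apply: soc_generators => i.
  by apply: contrapT => fx; apply: ni; exists i.
have [|w [w0 ws]] := IH _ fx.
  move=> s sa Ns; rewrite -act_rcons; apply: NP; last by rewrite size_rcons.
  by rewrite augs_rcons sa andbT; apply/asboolP.
by exists (rcons w i); rewrite map_rcons act_rcons.
Qed.

Lemma embeds_dual_comodule : embeds {x : D -> k^o | linear x} (seq I * J -> k).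
Proof.
exact: embeds_functionals psi_linear words_finite words_separate.
Qed.

End DualCardinality.

Section ErdosKaplansky.
Local Open Scope ring_scope.
Variable k : fieldType.

(** The vectors of powers 1, a, a^2, ..., placed along a sequence in [L]. A linear relation between
    them annihilates the values of every polynomial, in particular of the one that vanishes at all
    nodes but one. *)
Lemma vandermonde_free (L : Type) : infinite L ->
  exists v : k -> L -> k^o, free_family v.
Proof.
move=> [i ii]; have vP (a : k) : exists v : L -> k^o, forall n, v (i n) = a ^+ n.
  have /choice[v vP] l : exists c : k, forall n, i n = l -> c = a ^+ n.
    have [[n nl]|N] := pselect (exists n, i n = l); last by exists 0 => n nl; case: N; exists n.
    by exists (a ^+ n) => m; rewrite -nl => /ii ->.
  by exists v => n; apply: vP.
have /choice[v vE] := vP; exists v => s s0 b.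
set t := undup [seq (p.2 : {classic k}) | p <- s].
have [bt|bt] := boolP ((b : {classic k}) \in t); last first.
  by apply: coef_notin; rewrite -mem_undup.
have pw n : \sum_(a <- t) coef s a * (a : k) ^+ n = 0.
  have E := congr1 (@^~ (i n)) s0; rewrite comb_undup -/t fct_sumE in E.
  by apply: etrans E; apply: eq_bigr => a _; rewrite -(vE a n).
have ev (p : {poly k}) : \sum_(a <- t) coef s a * p.[a : k] = 0.
  under eq_bigr => a _ do rewrite horner_coef mulr_sumr.
  rewrite exchange_big big1 // => j _.
  under eq_bigr => a _ do rewrite mulrCA.
  by rewrite -mulr_sumr pw mulr0.
pose p : {poly k} := \prod_(a <- t | a != b) ('X - (a : k)%:P).
have pb : p.[b] != 0.
  rewrite horner_prod prodf_seq_neq0; apply/allP => a _; apply/implyP => ab.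
  rewrite hornerXsubC subr_eq0 eq_sym; apply/eqP => e; by rewrite e eqxx in ab.
have := ev p; rewrite (bigD1_seq (b : {classic k})) ?undup_uniq //= big_seq_cond.
rewrite big1 => [|a /andP[at_ ab]].
  by rewrite addr0 => /eqP; rewrite mulf_eq0 (negPf pb) orbF => /eqP.
suff -> : p.[a : k] = 0 by rewrite mulr0.
apply/eqP; rewrite horner_prod prodf_seq_eq0; apply/hasP; exists a => //.
by rewrite ab hornerXsubC subrr eqxx.
Qed.

End ErdosKaplansky.

(** * Comparison of the Ext spaces *)

Section Bases.
Local Open Scope ring_scope.
Variable k : fieldType.

(* A free family of size |k|, resp. |L|, extends to a basis X with |X| >= |k|, and
   then the finite combinations of X are not more numerous than X. *)
Lemma Erdos_Kaplansky (L : Type) : infinite L ->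
  exists (X : Type) (e : X -> L -> k^o), free_family e /\ embeds (L -> k) X.
Proof.
move=> iL; have sT : subspace (fun _ : L -> k^o => True) by [].
have key (Y : Type) (e0 : Y -> L -> k^o) : infinite Y -> embeds k Y -> free_family e0 ->
    exists (X : Type) (e : X -> L -> k^o), free_family e /\ embeds (L -> k) X.
  move=> iY kY fe0; have [X [e [fe _ sp YX]]] := basis_extend sT fe0 (fun=> Logic.I).
  exists X, e; split=> //.
  have iX := embeds_trans iY YX.
  apply: embeds_trans (embeds_seq_prod iX (embeds_trans kY YX) (embeds_refl X)).
  apply: embeds_trans (embeds_span sp).
  by exists (fun x : L -> k => exist (fun _ : L -> k^o => True) x Logic.I) => x y [].
have [kL|Lk] := embeds_total k L; last first.
  by have [v fv] := vandermonde_free k iL; apply: key (embeds_trans iL Lk) (embeds_refl k) fv.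
apply: (key L (fun l l' => (`[< l = l' >])%:R)) => //.
by apply: (@free_dual k L _ _ (fun l x => x l)).
Qed.

Lemma free_bij (I J : Type) (V : lmodType k) (e : J -> V) (f : I -> J) :
  injective f -> free_family e -> free_family (fun i => e (f i)).
Proof.
move=> fi fe s s0 i; have := fe [seq (p.1, f p.2) | p <- s].
rewrite /comb big_map => /(_ s0 (f i)) <-; rewrite /coef big_map; apply: eq_bigl => p.
by apply/asboolP/asboolP => [->|/fi].
Qed.

Lemma spans_bij (I J : Type) (V : lmodType k) (e : J -> V) (f : I -> J) (S : V -> Prop) :
  (forall j, exists i, f i = j) -> spans e S -> spans (fun i => e (f i)) S.
Proof.
move=> /choice[h fh] sp x /sp[s ->]; exists [seq (p.1, h p.2) | p <- s].
by rewrite /comb big_map; apply: eq_bigr => p _; rewrite fh.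
Qed.

(* By Cantor's theorem A -> k is not covered by the finite combinations of at
   most |A| vectors. *)
Lemma embeds_basis_size (A I : Type) (V : lmodType k) (H : V -> Prop) (e : I -> V) :
  infinite A -> embeds k A -> spans e H -> embeds (A -> k) {x | H x} -> embeds (A -> k) I.
Proof.
move=> iA kA sp AH; have AI := embeds_trans AH (embeds_span sp).
have [leIA|leAI] := embeds_total I A.
  have := embeds_trans AI (embeds_seq_prod iA kA leIA).
  by case/(@Cantor_embeds A k 0 1); apply/eqP; rewrite eq_sym oner_eq0.
have iI := embeds_trans iA leAI.
exact: embeds_trans AI (embeds_seq_prod iI (embeds_trans kA leAI) (embeds_refl I)).
Qed.

Lemma embeds_free_dual (A X : Type) (V : lmodType k) (e : X -> V) : free_family e ->
  embeds A X -> embeds (A -> k) {f : V -> k^o | linear f}.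
Proof.
move=> fe AX; apply: embeds_trans (embeds_fun_dom 0 AX) _.
have /choice[F FP] (t : X -> k) :
    exists f : {f : V -> k^o | linear f}, forall x, sval f (e x) = t x.
  by have [f fl fE] := free_extend (t : X -> k^o) fe; exists (exist _ f fl).
by exists F => t t' E; apply/funext => x; rewrite -!FP E.
Qed.

End Bases.

Section MainTheorem.
Local Open Scope ring_scope.
Variables (k : fieldType) (C : coalgebra k) (g : coaugmentation C).
Hypothesis ln : locally_nilpotent g.
Local Notation B := (cop C).
Local Notation gB := (cop_coaug g).
Local Notation kC := (triv_comod g : comod_cat C).
Local Notation kC' := (Upsilon C kC).
Local Notation u := (g 1).
Local Notation lnB := (cop_locally_nilpotent ln).

Lemma embeds_dmod (I L : Type) (D : comodule B) (d : L -> D) :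
  ext_dim 1 kC kC I -> embeds I L -> infinite L ->
  free_family d -> spans d (@soc _ _ gB D) -> embeds (dmod D) (L -> k).
Proof.
move=> dI IL iL fd pd; have [Z0 [R0 [D0 [T0 [st0 [p ph [pu pP]]]]]]] := stage0 ln.
have [z0 [fz0 sz0 pz0]] := stage_soc_basis st0 dI.
have [d0 [fd0 sd0 pd0]] := soc_basis_transport st0 fz0 sz0 pz0.
have [c0 [c0l c0f c0s]] := subspace_coord (soc_subspace gB D0) fd0 pd0.
have [c [cl cf cs]] := subspace_coord (soc_subspace gB D) fd pd.
(* The letters come from the first stage, where B / k embeds into D0 and soc D0 is Ext^1: they are
   the coordinates of soc D0 pulled back along [p]. *)
pose f i : dual B := Dual (lin_comp (c0l i) ph.1).
have f_aug i : aug gB (f i) by rewrite /aug /= pu (lin0 (c0l i)).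
have f_fin b : exists r : seq I, forall i, f i b <> 0 -> List.In i r by exact: c0f.
have f_sep b : (forall h h', aug gB h -> aug gB h' -> dual_mul h h' b = 0) ->
    (forall i, f i b = 0) -> forall h, aug gB h -> h b = 0.
  (* Vanishing of all products of two factors puts [h' |> b] into [k u], which [p] kills, so [p b]
     is in the socle. Its coordinates vanish, hence [p b] = 0 and [b] is a multiple of [u]. *)
  move=> b2 fb h ah; have pb : p b = 0.
    apply: c0s fb => h' ah'; rewrite -(comod_homE h' _ ph).
    have hb : forall h, aug gB h -> h (h' |> (b : reg_comod B)) = 0.
      by move=> h'' ah''; rewrite -dual_mulE; apply: b2.
    rewrite (reg_span_u hb).
    by rewrite (linZ ph.1) pu scaler0.
  rewrite (soc_reg (pP _ pb)) (linZ (dual_linear h)) [h _]ah; exact: scaler0.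
have E := embeds_dual_comodule lnB f_aug f_fin f_sep cl cf cs.
apply: embeds_trans (_ : embeds _ {x : D -> k^o | linear x}) _.
  exists (fun x => exist (fun x : D -> k^o => linear x) (dmod_fun x) (dmod_linear x)).
  by move=> x y [] e; apply: dmodP => t; rewrite e.
apply: embeds_trans E (embeds_fun_dom 0 _).
apply: embeds_trans (embeds_square iL); apply: embeds_prod (embeds_refl L).
exact: embeds_trans (embeds_seq IL) (embeds_seq_infinite iL).
Qed.

(** If [q] and [q'] classify the two extensions and their images have the common class [f], then the
    difference of the two comparison morphisms from [T] to the image of [R] has ends 0 and [q - q'],
    and [stage_lift_zero] applies. *)
Lemma Ext_map_injective m (Z : comodule C) (R : splice m (Z : comod_cat C) kC)
    (D : comodule B) (T : splice m kC' (dmod_ob D)) :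
  stage R T -> injective (@Ext_map k _ _ (Upsilon C) m.+1 kC kC).
Proof.
move=> st x y xy; have [E hx] := ext_classP x; have [E' hy] := ext_classP y.
have repC := stage_comod_repr st; have repM := stage_mod_repr st.
have [q [qm qE]] := er_tot repC E; have [q' [qm' qE']] := er_tot repC E'.
have [f [fm fE]] := er_tot repM (fun_splice (Upsilon C) E).
have e : yequiv (fun_splice (Upsilon C) E') (fun_splice (Upsilon C) E).
  have : Ext_map (Upsilon C) y (fun_splice (Upsilon C) E).
    by rewrite -xy; exists E; rewrite ?hx; apply: Relation_Operators.rst_refl.
  rewrite /= => -[E1]; rewrite hy => h1 h2.
  exact: Relation_Operators.rst_trans (fun_yequiv (Upsilon C) h1) h2.
have [_ fE'] : mor f /\ splice_mor f id T (fun_splice (Upsilon C) E').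
  by apply/(er_yequiv repM f e).
have sE := fun_splice_mor (Upsilon C) (mor_id kC) qm qE.
have sE' := fun_splice_mor (Upsilon C) (mor_id kC) qm' qE'.
have d := splice_mor_sub (splice_mor_comp fE sE) (splice_mor_comp fE' sE').
have qq : q = q'.
  have z := stage_lift_zero st d.
  have dm : mor (fun x : car kC' => q x - q' x : car (Upsilon C Z)).
    exact: (@mor_sub k (mod_cat C) _ _ _ _ (ups_mor qm) (ups_mor qm')).
  have {}z := z dm; apply/funext => a; apply/eqP; rewrite -subr_eq0; apply/eqP.
  apply: (congr1 (@^~ a) (z _)); apply/funext => t; exact: subrr.
apply: Ext_ext; rewrite hx hy.
apply: (represents_uniq (rho := fun q (E : yext m.+1 kC kC) => mor q /\ splice_mor id q E R)).
  exact: (@represents_class _ _ _ _ _ _ _ _ repC q E (conj qm qE)).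
by rewrite qq; apply: (@represents_class _ _ _ _ _ _ _ _ repC q' E' (conj qm' qE')).
Qed.

Section Cardinality.
Variables (m : nat) (Z : comodule C) (R : splice m (Z : comod_cat C) kC).
Variables (D : comodule B) (T : splice m kC' (dmod_ob D)).
Hypothesis st : stage R T.
Variables (L I : Type).
Hypotheses (dL : ext_dim m.+1 kC kC L) (iL : infinite L).
Hypotheses (dI : ext_dim 1 kC kC I) (IL : embeds I L).

Let homs : (car (dmod_ob D) -> car kC') -> Prop := @mor _ (mod_cat C) (dmod_ob D) kC'.

Lemma embeds_k_fun : embeds k (L -> k).
Proof. by have [i _] := iL; exists (fun a _ => a) => a b /(congr1 (@^~ (i 0))). Qed.

Lemma embeds_L_fun : embeds L (L -> k).
Proof.
exists (fun l l' => (`[< l = l' >])%:R) => l l' /(congr1 (@^~ l)).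
rewrite asboolT //; case: asboolP => [->//|_ /eqP]; by rewrite oner_eq0.
Qed.

Lemma embeds_homs_upper : embeds {f | homs f} ((L -> k) -> k).
Proof.
have [z [fz sz pz]] := stage_soc_basis st dL.
have [d [fd sd pd]] := soc_basis_transport st fz sz pz.
apply: embeds_trans (embeds_fun_dom (0 : k) (embeds_dmod dI IL iL fd pd)).
by exists (fun f => sval f) => -[f fm] [f' fm'] /= e; apply: eq_exist.
Qed.

(** On the restrictions of functionals to soc D, the dual algebra acts through the augmentation, so
    that each functional [t] on k^L yields a homomorphism [F t]. A free family in k^L as large as
    k^L itself provides enough functionals. *)
Lemma embeds_homs_lower : embeds ((L -> k) -> k) {f | homs f}.
Proof.
have [z [fz sz pz]] := stage_soc_basis st dL.
have [d [fd sd pd]] := soc_basis_transport st fz sz pz.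
have [X [e [fe AX]]] := Erdos_Kaplansky k iL.
apply: embeds_trans (embeds_free_dual fe AX) _.
pose F (t : (L -> k^o) -> k^o) (x : car (dmod_ob D)) : car kC' :=
  t (fun l => dmod_fun x (d l)) : car kC.
have Fm t : linear t -> homs (F t).
  move=> tl a x y.
  rewrite (Upsilon_triv a (F t x : Upsilon C kC)).
  transitivity (t (((a u : k) *: (fun l => dmod_fun x (d l))) + (fun l => dmod_fun y (d l)))).
    by congr (t _); apply/funext => l; rewrite dmodE (socE _ (sd l)) (linZ (dmod_linear x)).
  by rewrite tl.
exists (fun t => exist _ (F (sval t)) (Fm _ (svalP t))) => -[t tl] [t' tl'] [] /= e'.
apply: eq_exist; apply/funext => x; have [f fl fE] := free_extend x fd.
have := congr1 (@^~ (dmod_of fl)) e'; rewrite /F /=.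
by have -> : (fun l => dmod_fun (dmod_of fl) (d l)) = x by exact: funext.
Qed.

(** With A = k^L, which is at least as large as k, the space of homomorphisms has as many elements
    as k^A, and a vector space of that size has dimension equal to its cardinality. *)
Lemma ext_dim_mod : ext_dim m.+1 kC' kC' ((L -> k) -> k).
Proof.
have rep := stage_mod_repr st; have [eta [etaP _ eta_s]] := ext_repr_coord rep.
apply/(ext_dim_repr rep etaP eta_s).
have [J [e [fe eh sp]]] := subspace_basis (er_sub rep).
have JT : embeds J ((L -> k) -> k).
  apply: embeds_trans embeds_homs_upper.
  exists (fun j => exist _ (e j) (eh j)) => i j []; exact: free_inj.
have TJ : embeds ((L -> k) -> k) J.
  apply: embeds_basis_size sp embeds_homs_lower; last exact: embeds_k_fun.
  exact: embeds_trans iL embeds_L_fun.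
have [f [h fh hf]] := embeds_bij TJ JT.
exists (fun t => e (f t)); split=> //.
  exact: free_bij (can_inj fh) fe.
by apply: spans_bij sp => j; exists (h j).
Qed.

(** The Ext space over C has at most as many elements as k^L, being spanned by [L], while the one
    over C^* is at least as large as the set of functions from k^L to k. *)
Lemma Ext_map_not_surjective :
  ~ (forall y, exists x, @Ext_map k _ _ (Upsilon C) m.+1 kC kC x = y).
Proof.
move=> /embeds_surj E; have rep := stage_mod_repr st.
have [eta [etaP _ eta_s]] := ext_repr_coord rep.
have repC := stage_comod_repr st; have [xi [xiP xi_i xi_s]] := ext_repr_coord repC.
have [e [_ _ sp]] := (ext_dim_repr repC xiP xi_s L).1 dL.
have iA := embeds_trans iL embeds_L_fun.
have CA : embeds (Ext m.+1 kC kC) (L -> k).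
  apply: embeds_trans (embeds_seq_prod iA embeds_k_fun embeds_L_fun).
  apply: embeds_trans (embeds_span sp).
  by exists (fun x => exist _ (xi x) (xiP x).1) => x y [] /xi_i.
have HE : embeds {f | homs f} (Ext m.+1 kC' kC').
  have /choice[h hE] (f : {f | homs f}) : exists x, eta x = sval f by apply: eta_s (svalP f).
  by exists h => -[f fm] [f' fm'] /(congr1 eta); rewrite !hE /= => e'; apply: eq_exist.
have := embeds_trans (embeds_trans embeds_homs_lower HE) (embeds_trans E CA).
by case/(@Cantor_embeds (L -> k) k 0 1); apply/eqP; rewrite eq_sym oner_eq0.
Qed.

End Cardinality.
End MainTheorem.

(* (L -> k) -> k has cardinality kappa ^ (kappa ^ lambda) when L has
   cardinality lambda and k has cardinality kappa. *)
Theorem theorem6p1 (k : fieldType) (C : coalgebra k) (g : coaugmentation C)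
    (C_conilpotent : conilpotent g) (n : nat) (n_ge1 : 1 <= n)
    (Extn_infinite :
       ~ ext_finite_dim n (triv_comod g : comod_cat C)
                          (triv_comod g : comod_cat C))
    (n_minimal : forall m : nat, 1 <= m < n ->
       ext_finite_dim m (triv_comod g : comod_cat C)
                        (triv_comod g : comod_cat C)) :
  let kC : comod_cat C := triv_comod g in
  let kC' : mod_cat C := Upsilon C kC in
  let map : Ext n kC kC -> Ext n kC' kC' :=
    @Ext_map k (comod_cat C) (mod_cat C) (Upsilon C) n kC kC in
  [/\ injective map,
      ~ (forall y : Ext n kC' kC', exists x : Ext n kC kC, map x = y)
    & forall L : Type,
        ext_dim n kC kC L -> ext_dim n kC' kC' ((L -> k) -> k)].
Proof.
case: n n_ge1 Extn_infinite n_minimal => // m _ inf fin kC kC' map.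
have ln := conilpotent_locally_nilpotent C_conilpotent.
have [|Z [R [D [T st]]]] := @stage_exists k C g ln m.
  by move=> i /andP[i1 im]; apply: fin; rewrite i1 ltnS.
have rep := stage_comod_repr st; have [xi [xiP xi_i xi_s]] := ext_repr_coord rep.
have iL L : ext_dim m.+1 kC kC L -> infinite L.
  move=> dL; have [//|[r [f [h fh hf]]]] := finite_or_infinite L; case: inf; exists r.
  have [e [fe eh sp]] := (ext_dim_repr rep xiP xi_s L).1 dL.
  apply/(ext_dim_repr rep xiP xi_s); exists (fun i => e (f i)); split=> //.
    exact: free_bij (can_inj fh) fe.
  by apply: spans_bij sp => j; exists (h j).
have dim1 L : ext_dim m.+1 kC kC L -> exists2 I, ext_dim 1 kC kC I & embeds I L.
  (* For n = 1 the first Ext space is the infinite one and [L] itself is taken; for n > 1 it is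
     finite-dimensional, and ['I_r] embeds into the infinite type [L]. *)
  move=> dL; case: (m) dL fin (iL) => [|m'] dL fin' iL'.
    by exists L => //; apply: embeds_refl.
  have [//|r dr] := fin' 1; exists 'I_r => //.
  by apply: embeds_trans (iL' L dL); exists val; apply: val_inj.
split; first exact: Ext_map_injective st.
  have [L [e [fe eh sp]]] := subspace_basis (er_sub rep).
  have dL : ext_dim m.+1 kC kC L by apply/(ext_dim_repr rep xiP xi_s); exists e.
  by have [I dI IL] := dim1 L dL; exact (Ext_map_not_surjective st dL (iL L dL)).
by move=> L dL; have [I dI IL] := dim1 L dL; exact (ext_dim_mod ln st dL (iL L dL) dI IL).
Qed.
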